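(* Let $P,Q,C,A_1,\dots,A_r,B_1,\dots,B_s$ be matrices in $\mathbb{C}^{N\times N}$ with $\Re(P)>0$, $\Re(Q)>0$, $\Re(A_i)>0$ for all $i=1,\dots,r$ and $\Re(B_j)>0$ for all $j=1,\dots,s$. Then the generalized incomplete exponential matrix function ${}_rE_s$ satisfies $$\Gamma^{-1}(Q)\Gamma^{-1}(C)\Gamma(Q+C)\int_t^x (x-u)^{C-I}(u-t)^{Q-I}\;{}_{r}E_{s}\left[(x,P,Q;z(u-t)^k)\left|\begin{matrix}A_1,A_2,\dots,A_r\\ B_1,B_2,\dots,B_s\end{matrix}\right.\right]du$$ $$=(x-t)^{C+Q-I}\;{}_{r+k}E_{s+k}\left[(x,P,Q;z(x-t)^k)\left|\begin{matrix}A_1,A_2,\dots,A_r,\Delta(k,Q)\\ B_1,B_2,\dots,B_s,\Delta(k,Q+C)\end{matrix}\right.\right],$$ where $\Delta(k,Q)$ represents the sequence of $k$ parameters $\frac{Q}{k},\frac{Q+I}{k},\frac{Q+2I}{k},\dots,\frac{Q+(k-1)I}{k}$.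
   Context: $I$ is the identity matrix in $\mathbb{C}^{N\times N}$; $t^{M}=\exp(M\ln t)$ for $t>0$; $\Re(M)>0$ means that every eigenvalue of $M$ has positive real part. $x$ is a positive real number; the same $x$ is both the upper limit of integration and the incompleteness parameter of ${}_rE_s$. $\Gamma(M)$ is the gamma matrix function, $\Gamma(M)=\int_0^\infty u^{M-I}e^{-u}du$ for $\Re(M)>0$; $\Gamma^{-1}(M)$ is the reciprocal gamma function (an entire function) evaluated at $M$; and $\Gamma(M,x)=\int_x^\infty u^{M-I}e^{-u}du$ is the incomplete gamma matrix function. Pochhammer symbol: $(M)_0=I$, $(M)_\ell=M(M+I)\cdots(M+(\ell-1)I)$ for $\ell\ge1$. $\Delta(k,M)$ denotes, for any matrix $M$, the sequence $\frac{M}{k},\frac{M+I}{k},\dots,\frac{M+(k-1)I}{k}$ of $k$ parameters. For lower parameters $B_j$ such that $B_j+\ell I$ is invertible for all integers $\ell\ge0$, $${}_rE_s\left[(x,P,Q;z)\left|\begin{matrix}A_1,\dots,A_r\\ B_1,\dots,B_s\end{matrix}\right.\right]=\sum_{\ell=0}^\infty \frac{z^\ell}{\ell!}\prod_{i=1}^r(A_i)_\ell\Big[\prod_{j=1}^s(B_j)_\ell\Big]^{-1}\Gamma(\ell P+Q,x)\Gamma^{-1}(\ell P+Q),$$ provided that the series converges.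
   Formalization: The formal theorem also assumes Re(C)>0, QC=CQ, and that Q and C commute with every A_i; without these the integral can diverge (C=0) or the identity fails for non-commuting matrices (e.g. k=r=1, s=0, C=I, Q=diag(1,2), A_1 not diagonal). *)

(* Defs.v *)
From HB Require Import structures.
From mathcomp Require Import all_boot all_order all_algebra.
From mathcomp Require Import all_classical all_reals all_analysis.
From mathcomp Require Import complex.

Set Implicit Arguments.
Unset Strict Implicit.
Unset Printing Implicit Defensive.

Import Order.TTheory GRing.Theory Num.Theory.
Import numFieldNormedType.Exports.

Local Open Scope classical_set_scope.
Local Open Scope ring_scope.
Local Open Scope complex_scope.

(* The modulus topology on R[i], so that limits of complex matrices make
   sense ('M[R[i]]_N then carries the entrywise topology). *)
HB.instance Definition _ (R : realType) := NormedModule.copy R[i] R[i]^o.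

Section MatrixFunctions.
Variables (R : realType) (N : nat).
Implicit Types (M P Q : 'M[R[i]]_N) (A B : seq 'M[R[i]]_N).
Implicit Types (f : R -> 'M[R[i]]_N) (F G : set_system R).

Definition re_pos M : Prop := forall a : R[i], eigenvalue M a -> 0 < complex.Re a.

Definition expmx M : 'M[R[i]]_N :=
  limn (series (fun n => (n`!)%:R^-1 *: M ^+ n)).

(* t^M; meaningful for t > 0 only, since [ln t = 0] for t <= 0. *)
Definition powmx (t : R) M : 'M[R[i]]_N := expmx ((ln t)%:C *: M).

Definition integralmx (a b : R) f : 'M[R[i]]_N :=
  \matrix_(i, j)
    ((\int[lebesgue_measure]_(u in `[a, b]) complex.Re (f u i j))
     +i* (\int[lebesgue_measure]_(u in `[a, b]) complex.Im (f u i j))).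

(* Improper integral: the joint limit of [integralmx a b f] as the endpoints
   a and b follow the filters F and G.  At an endpoint near which f is bounded
   this is the usual integral up to that endpoint. *)
Definition improper_cvg F G f : Prop :=
  cvg ((fun ab : R * R => integralmx ab.1 ab.2 f) @ filter_prod F G).

Definition improper F G f : 'M[R[i]]_N :=
  lim ((fun ab : R * R => integralmx ab.1 ab.2 f) @ filter_prod F G).

Definition gammamx M : 'M[R[i]]_N :=
  improper 0^'+ (pinfty_nbhs R)
    (fun u => (expR (- u))%:C *: powmx u (M - 1%:M)).

Definition incgammamx M (x : R) : 'M[R[i]]_N :=
  improper x^'+ (pinfty_nbhs R)
    (fun u => (expR (- u))%:C *: powmx u (M - 1%:M)).

Definition pochhammer M (l : nat) : 'M[R[i]]_N :=
  \prod_(i < l) (M + i%:R%:M).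

(* The entire function 1 / Gamma, by Gauss's formula
     1 / Gamma(z) = lim_n z (z + 1) ... (z + n) n^(-z) / n!.
   The approximants are entire and converge locally uniformly, so the limit
   taken on matrices is the value of 1 / Gamma at M in the functional
   calculus, for every M (also when M has eigenvalues at poles of Gamma). *)
Definition rgammamx M : 'M[R[i]]_N :=
  limn (fun n => (n`!)%:R^-1 *: (pochhammer M n.+1 * powmx n%:R (- M))).

Definition Delta (k : nat) M : seq 'M[R[i]]_N :=
  [seq k%:R^-1 *: (M + j%:R%:M) | j <- iota 0 k].

Definition incE_term (x : R) P Q A B (z : R[i]) (l : nat) : 'M[R[i]]_N :=
  (z ^+ l / (l`!)%:R) *:
    ((\prod_(M <- A) pochhammer M l) * invmx (\prod_(M <- B) pochhammer M l)
     * incgammamx (l%:R *: P + Q) x * rgammamx (l%:R *: P + Q)).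

Definition incE_cvg (x : R) P Q A B (z : R[i]) : Prop :=
  cvgn (series (incE_term x P Q A B z)).

Definition incE (x : R) P Q A B (z : R[i]) : 'M[R[i]]_N :=
  limn (series (incE_term x P Q A B z)).

End MatrixFunctions.

(* Main.v *)
(* Every matrix A with Re(A) > 0 satisfies |exp(-sA)| <= K e^(-ds): by
   Cayley-Hamilton exp(-sA) is annihilated by a product of first order operators,
   which are inverted one at a time. This is all the positivity that is needed: it gives
   convergent integrals and invertible Pochhammer symbols.

   Write beta_m for the integral of (1 - v)^(C - I) v^(Q + (m - 1) I) over (0, 1).
   Integration by parts gives beta_m (Q + m) = beta_(m+1) (Q + C + m), so that
   beta_0 (Q)_m = beta_m (Q + C)_m, and v = 1 - w / m gives beta_(m+1) m^C -> Gamma(C).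
   Combined with the Gauss product this yields
   beta_0 Gamma^-1(Q) = Gamma(C) Gamma^-1(Q + C), hence Gamma(C) Gamma^-1(C) = I (Q = I)
   and Gamma^-1(Q) Gamma^-1(C) Gamma(Q + C) beta_0 = I.

   After scaling to (0, 1) the integrand is a power series sum_l v^(kl) T_l against the beta
   kernel. Term by term integration would give sum_l beta_(kl) T_l =
   beta_0 sum_l (Q)_(kl) (Q + C)_(kl)^-1 T_l, the right-hand side by the Gauss formula
   for (M)_(kl). But the two series need not converge absolutely, and v = 1 may lie
   on the circle of convergence. So one integrates over [a, b] first:
   the l-th term is sigma_(kl)(a, b) (Q)_(kl) (Q + C)_(kl)^-1 T_l, where sigma_m(a, b)
   tends to beta_0 and sum_m |sigma_m - sigma_(m+1)| is bounded uniformly in (a, b), since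
   the increments are boundary terms of the integration by parts. Abel's summation
   argument then gives the limit. *)

Require Import Defs.
From mathcomp Require Import all_boot all_order all_algebra.
From mathcomp Require Import all_classical all_reals all_analysis.
From mathcomp Require Import complex.
From mathcomp Require Import ring lra zify.

Set Implicit Arguments.
Unset Strict Implicit.
Unset Printing Implicit Defensive.

Import Order.TTheory GRing.Theory Num.Theory.
Import numFieldNormedType.Exports.

Local Open Scope classical_set_scope.
Local Open Scope ring_scope.
Local Open Scope complex_scope.

(** Everything is reduced to real estimates by a real-valued entrywise norm. Integrals are handled
    through primitives and a mean value inequality with a scalar majorant. The recurring majorant is
    the derivative of [- 1 / (1 + w ^ d)]: it is of order [w ^ (d - 1)] at 0, is integrable at
    infinity, and its primitive stays in [-1, 0], so the bounds are uniform in the endpoints of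
    integration.

    The decisive estimate is the uniform variation of the convergence factors. At an endpoint v
    their increments are [v^m (1 - v)^C v^Q] times [(Q)_(m+1)^-1 (Q + C)_m], and the Gauss products
    show that the latter has the size of [m^(C - I)]. With [w = m (1 - v)] the whole is at most a
    constant times [e^-w |w^C| / m]. Its sum over m is a Riemann sum of an integral against dw / w,
    which is invariant under scaling, hence bounded independently of v even as v tends to 1.

    As the reciprocal gamma function is given by Gauss's limit, the relations between beta and gamma
    are first proved as exact identities for the approximants and then passed to the limit. *)

Section ComplexL1.
Variable R : realType.
Implicit Types a b : R[i].

Lemma cReD a b : complex.Re (a + b) = complex.Re a + complex.Re b.
Proof. by case: a; case: b. Qed.

Lemma cImD a b : complex.Im (a + b) = complex.Im a + complex.Im b.
Proof. by case: a; case: b. Qed.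

Lemma cReN a : complex.Re (- a) = - complex.Re a.
Proof. by case: a. Qed.

Lemma cImN a : complex.Im (- a) = - complex.Im a.
Proof. by case: a. Qed.

Lemma cReM a b : complex.Re (a * b) =
  complex.Re a * complex.Re b - complex.Im a * complex.Im b.
Proof. by case: a; case: b. Qed.

Lemma cImM a b : complex.Im (a * b) =
  complex.Re a * complex.Im b + complex.Im a * complex.Re b.
Proof. by case: a => ? ?; case: b => ? ?; rewrite /= addrC. Qed.

Lemma cRe_sum I (r : seq I) (P : pred I) (F : I -> R[i]) :
  complex.Re (\sum_(i <- r | P i) F i) = \sum_(i <- r | P i) complex.Re (F i).
Proof. exact: (big_morph _ cReD erefl). Qed.

Lemma cIm_sum I (r : seq I) (P : pred I) (F : I -> R[i]) :
  complex.Im (\sum_(i <- r | P i) F i) = \sum_(i <- r | P i) complex.Im (F i).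
Proof. exact: (big_morph _ cImD erefl). Qed.

(** Real-valued, unlike the modulus on [R[i]], whose values lie in [R[i]]; it is still
    submultiplicative. *)
Definition l1c a : R := `|complex.Re a| + `|complex.Im a|.

Lemma l1c_ge0 a : 0 <= l1c a.
Proof. by rewrite addr_ge0. Qed.

Lemma l1cD a b : l1c (a + b) <= l1c a + l1c b.
Proof. by rewrite /l1c cReD cImD addrACA lerD // ler_normD. Qed.

Lemma l1cN a : l1c (- a) = l1c a.
Proof. by rewrite /l1c cReN cImN !normrN. Qed.

Lemma l1cM a b : l1c (a * b) <= l1c a * l1c b.
Proof.
rewrite /l1c cReM cImM.
apply: le_trans (lerD (ler_normB _ _) (ler_normD _ _)) _.
by rewrite !normrM mulrDl !mulrDr; lra.
Qed.

Lemma l1c_real (r : R) : l1c r%:C = `|r|.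
Proof. by rewrite /l1c /= normr0 addr0. Qed.

Lemma l1cMr (r : R) a : l1c (r%:C * a) = `|r| * l1c a.
Proof. by rewrite /l1c cReM cImM /= !mul0r subr0 addr0 !normrM mulrDr. Qed.

Lemma normc_le_l1c a : `|a| <= (l1c a)%:C.
Proof.
case: a => x y; rewrite normc_def lecR /=.
rewrite -[leRHS]ger0_norm ?l1c_ge0 // -sqrtr_sqr ler_wsqrtr // /l1c /=.
rewrite sqrrD !real_normK ?num_real // -addrA lerD2l.
by rewrite lerDr mulrn_wge0 // mulr_ge0.
Qed.

Lemma l1c_le_normc a (e : R) : `|a| <= e%:C -> l1c a <= 2 * e.
Proof.
case: a => x y; rewrite normc_def lecR /= => h.
have hx : `|x| <= e.
  apply: le_trans h; rewrite -sqrtr_sqr ler_wsqrtr //.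
  by rewrite lerDl sqr_ge0.
have hy : `|y| <= e.
  apply: le_trans h; rewrite -sqrtr_sqr ler_wsqrtr //.
  by rewrite lerDr sqr_ge0.
by rewrite /l1c /=; lra.
Qed.

Lemma l1c_eq0 a : l1c a = 0 -> a = 0.
Proof.
case: a => x y; rewrite /l1c /= => /eqP.
by rewrite paddr_eq0 // !normr_eq0 => /andP[/eqP-> /eqP->].
Qed.

End ComplexL1.

(** * The entrywise L1 norm *)

Section MatrixNorm.
Variables (R : realType) (N : nat).
Implicit Types A B : 'M[R[i]]_N.

(** Summing over all entries makes it submultiplicative. The identity has norm [N], which is why
    [nrm 1] appears in later bounds. *)
Definition nrm A : R := \sum_i \sum_j l1c (A i j).

Lemma nrm_ge0 A : 0 <= nrm A.
Proof. by apply: sumr_ge0 => i _; apply: sumr_ge0 => j _; exact: l1c_ge0. Qed.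

Lemma nrmD A B : nrm (A + B) <= nrm A + nrm B.
Proof.
rewrite /nrm -big_split ler_sum // => i _; rewrite -big_split ler_sum // => j _.
by rewrite mxE l1cD.
Qed.

Lemma nrmN A : nrm (- A) = nrm A.
Proof. by apply: eq_bigr => i _; apply: eq_bigr => j _; rewrite mxE l1cN. Qed.

Lemma nrmB A B : nrm (A - B) <= nrm A + nrm B.
Proof. by rewrite -(nrmN B) nrmD. Qed.

Lemma nrmBC A B : nrm (A - B) = nrm (B - A).
Proof. by rewrite -nrmN opprB. Qed.

Lemma nrm0 : nrm 0 = 0.
Proof.
by apply: big1 => i _; apply: big1 => j _; rewrite mxE (l1c_real 0) normr0.
Qed.

Lemma nrm_eq0 A : nrm A = 0 -> A = 0.
Proof.
move=> /eqP; rewrite psumr_eq0 => [/allP h|i _]; last first.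
  by apply: sumr_ge0 => j _; exact: l1c_ge0.
apply/matrixP => i j; have := h i (mem_index_enum _) => /=.
rewrite psumr_eq0 => [/allP/(_ j (mem_index_enum _))/= /eqP /l1c_eq0 ->|? _].
  by rewrite mxE.
exact: l1c_ge0.
Qed.

Lemma l1c_le_nrm A i j : l1c (A i j) <= nrm A.
Proof.
rewrite /nrm (bigD1 i) //= (bigD1 j) //= -addrA lerDl addr_ge0 //.
  by apply: sumr_ge0 => ? _; exact: l1c_ge0.
by apply: sumr_ge0 => ? _; apply: sumr_ge0 => ? _; exact: l1c_ge0.
Qed.

Lemma nrm_le A (e : R) : (forall i j, l1c (A i j) <= e) -> nrm A <= (N * N)%:R * e.
Proof.
move=> h; rewrite /nrm.
apply: (@le_trans _ _ (\sum_(i < N) \sum_(j < N) e)).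
  by apply: ler_sum => i _; apply: ler_sum => j _.
by rewrite !sumr_const card_ord -mulrnA mulr_natl.
Qed.

Lemma nrmM A B : nrm (A * B) <= nrm A * nrm B.
Proof.
rewrite /nrm mulr_suml ler_sum // => i _.
apply: (@le_trans _ _ (\sum_j \sum_k l1c (A i k) * l1c (B k j))).
  apply: ler_sum => j _; rewrite mxE.
  apply: (@big_ind2 _ _ (fun x (y : R) => l1c x <= y)).
  - by rewrite (l1c_real 0) normr0.
  - by move=> x1 x2 y1 y2 h1 h2; apply: le_trans (l1cD _ _) (lerD h1 h2).
  - by move=> k _; exact: l1cM.
rewrite exchange_big /= mulr_suml ler_sum // => k _.
rewrite -mulr_sumr ler_wpM2l ?l1c_ge0 //.
rewrite [leRHS](bigD1 k) //= lerDl.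
by apply: sumr_ge0 => ? _; apply: sumr_ge0 => ? _; exact: l1c_ge0.
Qed.

Lemma nrmZr (c : R) A : nrm (c%:C *: A) = `|c| * nrm A.
Proof.
rewrite /nrm mulr_sumr; apply: eq_bigr => i _; rewrite mulr_sumr.
by apply: eq_bigr => j _; rewrite mxE l1cMr.
Qed.

Lemma nrm_sum I (r : seq I) (P : pred I) (F : I -> 'M[R[i]]_N) :
  nrm (\sum_(i <- r | P i) F i) <= \sum_(i <- r | P i) nrm (F i).
Proof.
apply: (@big_ind2 _ _ (fun x (y : R) => nrm x <= y)) => //.
- by rewrite nrm0.
- by move=> x1 x2 y1 y2 h1 h2; apply: le_trans (nrmD _ _) (lerD h1 h2).
Qed.

Lemma nrmMr_le A B (x y : R) : nrm A <= x -> nrm B <= y -> nrm (A * B) <= x * y.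
Proof.
by move=> hA hB; apply: le_trans (nrmM _ _) (ler_pM _ _ hA hB); exact: nrm_ge0.
Qed.

End MatrixNorm.

(** * Limits of matrices through the real-valued norm *)

Section MatrixCvg.
Variables (R : realType) (N : nat).
Local Notation M := 'M[R[i]]_N.

Lemma mx_hausdorff : hausdorff_space M.
Proof. exact: norm_hausdorff. Qed.

Context {T : Type} {F : set_system T} {FF : ProperFilter F}.
Implicit Types (f g : T -> M) (l m : M).

Lemma cvg_nrmP f l : f @ F --> l <-> nrm (f x - l) @[x --> F] --> (0 : R).
Proof.
split.
- move=> /cvg_ballP h; apply/cvgr0Pnorm_le => e e0.
  (* The 2 comes from comparing [l1c] with the modulus, [N * N] is the number of entries, and the
     successor keeps [d] positive when [N = 0]. *)
  pose d := e / (2 * (N * N).+1%:R).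
  have d0 : 0 < d by rewrite divr_gt0 // mulr_gt0.
  have d0' : (0 : R[i]) < d%:C by rewrite ltcR.
  have := h _ d0'; apply: filterS => x /= [_ hx].
  rewrite ger0_norm ?nrm_ge0 //.
  apply: (@le_trans _ _ ((N * N)%:R * (2 * d))).
    apply: nrm_le => i j; apply: l1c_le_normc.
    by rewrite !mxE distrC; exact/ltW/hx.
  rewrite /d -[(N * N).+1]addn1 natrD; set n : R := (N * N)%:R.
  have n0 : 0 <= n by rewrite ler0n.
  have -> : n * (2 * (e / (2 * (n + 1)))) = e * (n / (n + 1)).
    by field; rewrite gt_eqF // ltr_wpDl.
  apply: ler_piMr; first exact: ltW.
  by rewrite ler_pdivrMr ?ltr_wpDl //; lra.
- move=> /cvgr0Pnorm_lt h; apply/cvg_ballP => e e0.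
  have e_real : e = (complex.Re e)%:C.
    by apply/esym/RRe_real; rewrite realE ltW.
  have := h (complex.Re e); rewrite -ltcR -e_real => /(_ e0).
  apply: filterS => x /=; rewrite ger0_norm ?nrm_ge0 // => hx.
  split => // i j; rewrite /ball /= e_real.
  apply: le_lt_trans (normc_le_l1c _) _; rewrite ltcR; apply: le_lt_trans hx.
  have -> : l i j - f x i j = - ((f x - l) i j) by rewrite !mxE opprB.
  by rewrite l1cN l1c_le_nrm.
Qed.

Lemma cvg_mx_le f l (g : T -> R) : (\forall x \near F, nrm (f x - l) <= g x) ->
  g @ F --> (0 : R) -> f @ F --> l.
Proof.
move=> h g0; apply/cvg_nrmP; apply: (@squeeze_cvgr _ _ _ _ (fun=> 0) g) => //.
- by apply: filterS h => x ->; rewrite nrm_ge0.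
- exact: cvg_cst.
Qed.

Lemma mx_cvg_unique f l m : f @ F --> l -> f @ F --> m -> l = m.
Proof. exact: (@cvg_unique _ mx_hausdorff). Qed.

Lemma mx_cvg_lim f l : f @ F --> l -> lim (f @ F) = l.
Proof. exact: (@cvg_lim _ mx_hausdorff). Qed.

Lemma cvg_nrm f l : f @ F --> l -> nrm (f x) @[x --> F] --> nrm l.
Proof.
move=> /cvg_nrmP/cvgr0Pnorm_lt h; apply/cvgrPdist_lt => e e0.
apply: filterS (h e e0) => x; rewrite ger0_norm ?nrm_ge0 //; apply: le_lt_trans.
rewrite ler_norml; have := nrmD (f x - l) l; have := nrmD (l - f x) (f x).
by rewrite !subrK (nrmBC l); lra.
Qed.

Lemma nrm_near_bounded f l : f @ F --> l -> \forall x \near F, nrm (f x) <= nrm l + 1.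
Proof.
move=> /cvg_nrm/cvgrPdist_lt/(_ 1 ltr01); apply: filterS => x.
rewrite ltr_norml; lra.
Qed.

Lemma cvg_mxM f g l m : f @ F --> l -> g @ F --> m ->
  f x * g x @[x --> F] --> l * m.
Proof.
move=> fl gm.
apply: (@cvg_mx_le _ _ (fun x => nrm (f x - l) * nrm (g x) + nrm l * nrm (g x - m))).
  near=> x.
  have -> : f x * g x - l * m = (f x - l) * g x + l * (g x - m).
    by rewrite mulrBl mulrBr addrA subrK.
  by apply: le_trans (nrmD _ _) (lerD _ _); apply: nrmM.
have -> : (0 : R) = 0 * nrm m + nrm l * 0 by rewrite mul0r mulr0 addr0.
apply: cvgD; [apply: cvgM|apply: cvgMr].
- by move/cvg_nrmP: fl.
- exact: cvg_nrm.
- by move/cvg_nrmP: gm.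
Unshelve. all: by end_near. Qed.

Lemma cvg_mxMl l g m : g @ F --> m -> l * g x @[x --> F] --> l * m.
Proof. by apply: cvg_mxM; exact: cvg_cst. Qed.

Lemma cvg_mxMr f l m : f @ F --> l -> f x * m @[x --> F] --> l * m.
Proof. by move=> h; apply: cvg_mxM; [exact: h|exact: cvg_cst]. Qed.

Lemma mx_cvg_comm f l B : f @ F --> l -> (forall x, GRing.comm (f x) B) -> GRing.comm l B.
Proof.
move=> fl h; apply: (@mx_cvg_unique (fun x => f x * B)).
  exact: cvg_mxMr.
have -> : (fun x => f x * B) = (fun x => B * f x) by apply/funext => x; exact: h.
exact: cvg_mxMl.
Qed.

Lemma nrm_lim_le f l (c : R) : f @ F --> l -> (\forall x \near F, nrm (f x) <= c) ->
  nrm l <= c.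
Proof.
move=> fl h; have := cvg_nrm fl => hl.
rewrite -(cvg_lim _ hl) //; apply: limr_le => //.
by apply/cvg_ex; exists (nrm l).
Qed.

Lemma cvg_bigsum I (r : seq I) (h : I -> T -> R) (a : I -> R) :
  (forall i, h i @ F --> a i) ->
  \sum_(i <- r) h i x @[x --> F] --> \sum_(i <- r) a i.
Proof.
move=> ha; elim: r => [|i r IH].
  by rewrite big_nil; under eq_fun do rewrite big_nil; exact: cvg_cst.
rewrite big_cons; under eq_fun do rewrite big_cons.
by apply: cvgD; [exact: ha|exact: IH].
Qed.

Lemma cvg_mx_entry f l : (forall i j,
    complex.Re (f x i j) @[x --> F] --> complex.Re (l i j) /\
    complex.Im (f x i j) @[x --> F] --> complex.Im (l i j)) -> f @ F --> l.
Proof.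
move=> h; apply/cvg_nrmP; rewrite /nrm.
have Z : \sum_(i < N) \sum_(j < N) (0 : R) = 0 by rewrite big1 // => i _; rewrite big1.
suff: \sum_i \sum_j l1c ((f x - l) i j) @[x --> F] --> \sum_(i < N) \sum_(j < N) (0 : R).
  by rewrite Z.
apply: (@cvg_bigsum _ _ (fun i x => \sum_j l1c ((f x - l) i j)) (fun=> _)) => i.
apply: (@cvg_bigsum _ _ (fun j x => l1c ((f x - l) i j)) (fun=> _)) => j.
have -> : (0 : R) = `|complex.Re (l i j) - complex.Re (l i j)|
                   + `|complex.Im (l i j) - complex.Im (l i j)|.
  by rewrite !subrr normr0 addr0.
have -> : (fun x => l1c ((f x - l) i j)) =
   (fun x => `|complex.Re (f x i j) - complex.Re (l i j)|
                   + `|complex.Im (f x i j) - complex.Im (l i j)|).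
  by apply/funext => x; rewrite /l1c !mxE cReD cImD cReN cImN.
have [h1 h2] := h i j.
by apply: cvgD; apply: cvg_norm; apply: cvgB => //; exact: cvg_cst.
Qed.

Lemma Re_entry_le l i j : `|complex.Re (l i j)| <= nrm l.
Proof. by apply: le_trans (l1c_le_nrm _ i j); rewrite lerDl. Qed.

Lemma Im_entry_le l i j : `|complex.Im (l i j)| <= nrm l.
Proof. by apply: le_trans (l1c_le_nrm _ i j); rewrite lerDr. Qed.

Lemma cvg_entry f l i j : f @ F --> l ->
    complex.Re (f x i j) @[x --> F] --> complex.Re (l i j) /\
    complex.Im (f x i j) @[x --> F] --> complex.Im (l i j).
Proof.
move=> /cvg_nrmP/cvgr0Pnorm_le h; split; apply/cvgrPdist_le => e e0;
  apply: filterS (h e e0) => x; rewrite ger0_norm ?nrm_ge0 //; apply: le_trans.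
- rewrite nrmBC; apply: le_trans (Re_entry_le _ i j).
  by rewrite !mxE cReD cReN.
- rewrite nrmBC; apply: le_trans (Im_entry_le _ i j).
  by rewrite !mxE cImD cImN.
Qed.

(* Completeness: the increments of [f] are dominated by those of a convergent
   real function. *)
Lemma mx_cvg_dominated f (g : T -> R) (S : set T) : F S ->
  (forall x y, S x -> S y -> nrm (f x - f y) <= `|g x - g y|) ->
  cvg (g @ F) -> cvg (f @ F).
Proof.
move=> FS h /cvg_ex[/= a /cvgrPdist_lt ga].
have cau (e : M -> R) : (forall A B, e (A - B) = e A - e B) ->
    (forall A, `|e A| <= nrm A) -> cvg (e (f x) @[x --> F]).
  move=> eB e_le; apply/cauchy_cvgP/cauchy_ballP => d d0.
  have d2 : 0 < d / 2 by rewrite divr_gt0.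
  exists (((fun x => e (f x)) @` (S `&` [set x | `|a - g x| < d / 2])),
          ((fun x => e (f x)) @` (S `&` [set x | `|a - g x| < d / 2]))).
    split; apply: filterS (filterI FS (ga _ d2)) => x hx; by exists x.
  move=> [_ _] /= [[x [Sx /= hx] <-] [y [Sy /= hy] <-]].
  rewrite /ball /= -eB; apply: le_lt_trans (e_le _) _.
  apply: le_lt_trans (h _ _ Sx Sy) _.
  move: hx hy; rewrite !ltr_norml => /andP[? ?] /andP[? ?]; apply/andP; split; lra.
apply/cvg_ex; exists (\matrix_(i, j)
   (lim (complex.Re (f x i j) @[x --> F]) +i* lim (complex.Im (f x i j) @[x --> F]))).
apply: cvg_mx_entry => i j; rewrite !mxE /=; split.
- apply: (cau (fun A => complex.Re (A i j))) => [A B|A].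
  + by rewrite !mxE cReD cReN.
  + exact: Re_entry_le.
- apply: (cau (fun A => complex.Im (A i j))) => [A B|A].
  + by rewrite !mxE cImD cImN.
  + exact: Im_entry_le.
Qed.

End MatrixCvg.

(** * Differentiation of matrix functions *)

Section RealDerivatives.
Variable R : realType.
Implicit Types f g h : R -> R.

Lemma is_derive_ext f g (v a : R) : (forall u, f u = g u) ->
  is_derive v 1 g a -> is_derive v 1 f a.
Proof. by move=> /funext ->. Qed.

Lemma is_derive_addf f g (v a b : R) : is_derive v 1 f a -> is_derive v 1 g b ->
  is_derive v 1 (fun u => f u + g u) (a + b).
Proof. exact: is_deriveD. Qed.

Lemma is_derive_subf f g (v a b : R) : is_derive v 1 f a -> is_derive v 1 g b ->
  is_derive v 1 (fun u => f u - g u) (a - b).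
Proof. exact: is_deriveB. Qed.

Lemma is_derive_mulf f g (v a b : R) : is_derive v 1 f a -> is_derive v 1 g b ->
  is_derive v 1 (fun u => f u * g u) (a * g v + f v * b).
Proof.
move=> hf hg; apply: (@is_derive_eq _ _ _ _ _ _ _ _ (is_deriveM hf hg)).
by rewrite addrC mulrC.
Qed.

Lemma is_derive_compf f g (v a b : R) : is_derive (g v) 1 f a -> is_derive v 1 g b ->
  is_derive v 1 (fun u => f (g u)) (a * b).
Proof. exact: is_derive1_comp. Qed.

Lemma is_derive_mulcf (c : R) f (v a : R) : is_derive v 1 f a ->
  is_derive v 1 (fun u => c * f u) (c * a).
Proof. exact: is_deriveZ. Qed.

Lemma is_derive_sumf n (h : 'I_n -> R -> R) (v : R) (a : 'I_n -> R) :
  (forall i, is_derive v 1 (h i) (a i)) ->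
  is_derive v 1 (fun u => \sum_(i < n) h i u) (\sum_(i < n) a i).
Proof.
elim: n h a => [|n IH] h a H.
  apply: is_derive_ext (is_derive_eq (is_derive_cst 0 v 1) _) => [u|];
  by rewrite big_ord0.
rewrite big_ord_recl.
apply: is_derive_ext (is_derive_addf (H ord0) (IH _ _ (fun i => H (lift ord0 i)))) => u.
by rewrite big_ord_recl.
Qed.

Lemma is_derive_affine (c d v : R) : is_derive v 1 (fun u => c * u + d) c.
Proof.
have := is_derive_addf (is_derive_mulcf c (is_derive_id v (1 : R))) (is_derive_cst d v 1).
by rewrite mulr1 addr0.
Qed.

Lemma is_derive_scal (c v : R) : is_derive v 1 (fun u => c * u) c.
Proof. by apply: is_derive_ext (is_derive_affine c 0 v) => u; rewrite addr0. Qed.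

Lemma is_derive_onem (v : R) : is_derive v 1 (fun u => 1 - u) (-1).
Proof. by apply: is_derive_ext (is_derive_affine (-1) 1 v) => u; rewrite mulN1r addrC. Qed.

Lemma is_derive_continuous f (v a : R) : is_derive v 1 f a -> {for v, continuous f}.
Proof. by move=> [h _]; apply/differentiable_continuous/derivable1_diffP. Qed.

Lemma is_derive_mono f (f' : R -> R) (a b : R) : a <= b ->
  (forall u, a <= u <= b -> is_derive u 1 f (f' u)) ->
  (forall u, a <= u <= b -> 0 <= f' u) -> f a <= f b.
Proof.
move=> ab df f'0.
have [u|x xab|c cab] := @MVT_segment R f f' a b ab.
- by rewrite in_itv /= => /andP[? ?]; apply: df; rewrite !ltW.
- apply: continuous_in_subspaceT => {}u; rewrite inE /= in_itv /= => uab.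
  exact: is_derive_continuous (df u uab).
rewrite -subr_ge0 => ->; rewrite mulr_ge0 ?subr_ge0 //.
by apply: f'0; move: cab; rewrite in_itv.
Qed.

Lemma is_derive_expn (m : nat) (v : R) : is_derive v 1 (fun u : R => u ^+ m) (m%:R * v ^+ m.-1).
Proof.
elim: m => [|m IH].
  by rewrite mul0r; exact: is_derive_cst.
apply: (@is_derive_ext _ (fun u => u * u ^+ m)) => [u|]; first by rewrite exprS.
apply: (is_derive_eq (is_derive_mulf (is_derive_id v (1 : R)) IH)).
rewrite mul1r -natr1 mulrDl mul1r addrC /=; congr (_ + _).
by case: m {IH} => [|m]; [rewrite !mul0r mulr0|rewrite mulrCA -exprS].
Qed.

End RealDerivatives.

Section MatrixDerivatives.
Variables (R : realType) (N : nat).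
Local Notation M := 'M[R[i]]_N.
Implicit Types (F G : R -> M) (A B : M) (v : R).

(** Tested on the real and imaginary parts of each entry, so that only derivatives of real functions
    occur. *)
Definition isD F v A := forall i j,
  is_derive v 1 (fun u => complex.Re (F u i j)) (complex.Re (A i j)) /\
  is_derive v 1 (fun u => complex.Im (F u i j)) (complex.Im (A i j)).

Lemma isD_eq F v A B : isD F v A -> A = B -> isD F v B.
Proof. by move=> ? <-. Qed.

Lemma isD_ext F G v A : (forall u, F u = G u) -> isD G v A -> isD F v A.
Proof. by move=> /funext ->. Qed.

Lemma isD_cst A v : isD (fun=> A) v 0.
Proof.
by move=> i j; rewrite mxE; split; exact: is_derive_cst.
Qed.

Lemma isD_add F G v A B : isD F v A -> isD G v B -> isD (fun u => F u + G u) v (A + B).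
Proof.
move=> hF hG i j; have [r1 i1] := hF i j; have [r2 i2] := hG i j.
rewrite mxE cReD cImD; split.
- by apply: is_derive_ext (is_derive_addf r1 r2) => u; rewrite mxE cReD.
- by apply: is_derive_ext (is_derive_addf i1 i2) => u; rewrite mxE cImD.
Qed.

Lemma isD_mul F G v A B : isD F v A -> isD G v B ->
  isD (fun u => F u * G u) v (A * G v + F v * B).
Proof.
move=> hF hG i j; rewrite !mxE -big_split /= cRe_sum cIm_sum; split.
- apply: (@is_derive_ext _ _ (fun u => \sum_k
     (complex.Re (F u i k) * complex.Re (G u k j)
      - complex.Im (F u i k) * complex.Im (G u k j)))).
    by move=> u; rewrite mxE cRe_sum; apply: eq_bigr => k _; rewrite cReM.
  apply: is_derive_sumf => k.
  have [r1 i1] := hF i k; have [r2 i2] := hG k j.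
  apply: (@is_derive_eq _ _ _ _ _ _ _ _
     (is_derive_subf (is_derive_mulf r1 r2) (is_derive_mulf i1 i2))).
  by rewrite cReD !cReM; ring.
- apply: (@is_derive_ext _ _ (fun u => \sum_k
     (complex.Re (F u i k) * complex.Im (G u k j)
      + complex.Im (F u i k) * complex.Re (G u k j)))).
    by move=> u; rewrite mxE cIm_sum; apply: eq_bigr => k _; rewrite cImM.
  apply: is_derive_sumf => k.
  have [r1 i1] := hF i k; have [r2 i2] := hG k j.
  apply: (@is_derive_eq _ _ _ _ _ _ _ _
     (is_derive_addf (is_derive_mulf r1 i2) (is_derive_mulf i1 r2))).
  by rewrite cImD !cImM; ring.
Qed.

Lemma isD_mull B F v A : isD F v A -> isD (fun u => B * F u) v (B * A).
Proof. by move=> h; apply: isD_eq (isD_mul (isD_cst B v) h) _; rewrite mul0r add0r. Qed.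

Lemma isD_mulr B F v A : isD F v A -> isD (fun u => F u * B) v (A * B).
Proof. by move=> h; apply: isD_eq (isD_mul h (isD_cst B v)) _; rewrite mulr0 addr0. Qed.

Lemma isD_scale (g : R -> R) (g' : R) F v A : is_derive v 1 g g' -> isD F v A ->
  isD (fun u => (g u)%:C *: F u) v (g'%:C *: F v + (g v)%:C *: A).
Proof.
move=> hg hF i j; have [r1 i1] := hF i j; split.
- apply: is_derive_ext (is_derive_eq (is_derive_mulf hg r1) _) => [u|].
    by rewrite mxE cReM /= mul0r subr0.
  by rewrite !mxE cReD !cReM /= !mul0r !subr0.
- apply: is_derive_ext (is_derive_eq (is_derive_mulf hg i1) _) => [u|].
    by rewrite mxE cImM /= mul0r addr0.
  by rewrite !mxE cImD !cImM /= !mul0r !addr0.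
Qed.

Lemma isD_scalec (c : R[i]) F v A : isD F v A -> isD (fun u => c *: F u) v (c *: A).
Proof.
move=> h; apply: isD_ext (isD_eq (isD_mull c%:M h) _) => [u|].
- exact/esym/mul_scalar_mx.
- exact: mul_scalar_mx.
Qed.

Lemma isD_opp F v A : isD F v A -> isD (fun u => - F u) v (- A).
Proof.
by move=> h; apply: isD_ext (isD_eq (isD_scalec (-1) h) _) => [u|]; rewrite scaleN1r.
Qed.

Lemma isD_comp (g : R -> R) (g' : R) F v A : is_derive v 1 g g' -> isD F (g v) A ->
  isD (fun u => F (g u)) v (g'%:C *: A).
Proof.
move=> hg hF i j; have [r1 i1] := hF i j; rewrite !mxE cReM cImM /= !mul0r subr0 addr0.
split.
- apply: (@is_derive_eq _ _ _ _ _ _ _ _ (is_derive_compf r1 hg)); exact: mulrC.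
- apply: (@is_derive_eq _ _ _ _ _ _ _ _ (is_derive_compf i1 hg)); exact: mulrC.
Qed.

Lemma isD_cvg F v A : isD F v A -> F u @[u --> v] --> F v.
Proof.
move=> h; apply: (@cvg_mx_entry _ _ _ (nbhs v)) => i j; have [r1 i1] := h i j; split.
- exact: is_derive_continuous r1.
- exact: is_derive_continuous i1.
Qed.

(** Each real component [h] has [|h'| <= g'], so [g + h] and [g - h] are nondecreasing; the [2 N^2]
    components give the constant. A majorant [g'] that may vary with [u] makes the inequality usable
    near singular endpoints. *)
Lemma isD_mean F (f : R -> M) (g g' : R -> R) (a b : R) : a <= b ->
  (forall u, a <= u <= b -> isD F u (f u)) ->
  (forall u, a <= u <= b -> is_derive u 1 g (g' u)) ->
  (forall u, a <= u <= b -> nrm (f u) <= g' u) ->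
  nrm (F b - F a) <= (N * N)%:R * (2 * (g b - g a)).
Proof.
move=> ab dF dg fg.
have key (h h' : R -> R) : (forall u, a <= u <= b -> is_derive u 1 h (h' u)) ->
    (forall u, a <= u <= b -> `|h' u| <= g' u) -> `|h b - h a| <= g b - g a.
  move=> dh h'g; rewrite ler_norml; apply/andP; split.
  - have := @is_derive_mono _ (fun u => g u + h u) (fun u => g' u + h' u) a b ab.
    have H : g a + h a <= g b + h b -> - (g b - g a) <= h b - h a by lra.
    move=> K; apply/H/K => u uab; first exact: is_derive_addf (dg _ uab) (dh _ uab).
    by have := h'g u uab; rewrite ler_norml; lra.
  - have := @is_derive_mono _ (fun u => g u - h u) (fun u => g' u - h' u) a b ab.
    have H : g a - h a <= g b - h b -> h b - h a <= g b - g a by lra.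
    move=> K; apply/H/K => u uab; first exact: is_derive_subf (dg _ uab) (dh _ uab).
    by have := h'g u uab; rewrite ler_norml; lra.
apply: nrm_le => i j; rewrite /l1c !mxE cReD cImD cReN cImN mulr_natl mulr2n lerD //.
- apply: (key (fun u => complex.Re (F u i j)) (fun u => complex.Re (f u i j))) => u uab.
    by have [] := dF u uab i j.
  by apply: le_trans (fg u uab); exact: Re_entry_le.
- apply: (key (fun u => complex.Im (F u i j)) (fun u => complex.Im (f u i j))) => u uab.
    by have [] := dF u uab i j.
  by apply: le_trans (fg u uab); exact: Im_entry_le.
Qed.

Lemma isD_lip F (f : R -> M) (K a b : R) : a <= b ->
  (forall u, a <= u <= b -> isD F u (f u)) ->
  (forall u, a <= u <= b -> nrm (f u) <= K) ->
  nrm (F b - F a) <= (N * N)%:R * (2 * (K * (b - a))).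
Proof.
move=> ab dF fK; rewrite mulrBr.
apply: (@isD_mean _ _ (fun u => K * u) (fun=> K) _ _ ab dF) => // u _.
by have := is_derive_affine K 0 u; under eq_fun do rewrite addr0.
Qed.

Lemma isD0_cst F (a b : R) : (forall u, a <= u <= b -> isD F u 0) -> a <= b -> F b = F a.
Proof.
move=> dF ab; apply/eqP; rewrite -subr_eq0; apply/eqP/nrm_eq0/eqP.
rewrite eq_le nrm_ge0 andbT.
have := @isD_lip F (fun=> 0) 0 a b ab dF; rewrite mul0r mulr0 mulr0; apply => u _.
by rewrite nrm0.
Qed.

End MatrixDerivatives.

(** * Sequences and series with summable increments *)

Section MatrixSequences.
Variables (R : realType) (N : nat).
Local Notation M := 'M[R[i]]_N.
Implicit Types (u : nat -> M) (b : nat -> R).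

Lemma nrm_increments u b n m : (n <= m)%N ->
  (forall k, (n <= k < m)%N -> nrm (u k.+1 - u k) <= b k) ->
  nrm (u m - u n) <= series b m - series b n.
Proof.
move=> nm; rewrite sub_series nm -(subnKC nm); move: (m - n)%N => {nm}d.
elim: d => [|d IH] H; first by rewrite addn0 subrr nrm0 big_geq.
have -> : u (n + d.+1)%N - u n = (u (n + d).+1 - u (n + d)%N) + (u (n + d)%N - u n).
  by rewrite addnS addrA subrK.
apply: le_trans (nrmD _ _) _.
rewrite addnS big_nat_recr ?leq_addr //= [leRHS]addrC; apply: lerD.
  by apply: H; rewrite leq_addr addnS ltnSn.
by apply: IH => k /andP[nk kd]; apply: H; rewrite nk addnS ltnS ltnW.
Qed.

Lemma mx_seq_cvg u b : (forall n, nrm (u n.+1 - u n) <= b n) ->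
  cvgn (series b) -> cvgn u.
Proof.
move=> ub; apply: (mx_cvg_dominated (S := setT)); first exact: filterT.
move=> m n _ _; wlog nm : m n / (n <= m)%N => [hw|].
  by case/orP: (leq_total n m) => h; [exact: hw|rewrite nrmBC distrC hw].
by apply: le_trans (nrm_increments nm (fun k _ => ub k)) (ler_norm _).
Qed.

Lemma mx_series_cvg u b : (forall n, nrm (u n) <= b n) ->
  cvgn (series b) -> cvgn (series u).
Proof.
by move=> ub; apply: mx_seq_cvg => n; rewrite seriesSB.
Qed.

Lemma nrm_series_le u b (c : R) : (forall n, nrm (u n) <= b n) ->
  series b @ \oo --> c -> forall n, nrm (series u n) <= c.
Proof.
move=> ub bc n.
have b0 k : 0 <= b k by apply: le_trans (ub k); exact: nrm_ge0.
apply: (@le_trans _ _ (series b n)).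
  by apply: le_trans (nrm_sum _ _ _) (ler_sum _ _) => k _.
rewrite -(cvg_lim _ bc) //; apply: nondecreasing_cvgn_le; last by apply/cvg_ex; exists c.
by apply/nondecreasing_seqP => k; rewrite -subr_ge0 seriesSB.
Qed.

End MatrixSequences.

Lemma left_right_inv_unique (S : pzRingType) (a n p : S) :
  n * a = 1 -> p * n = 1 -> a = p.
Proof. by move=> na pn; rewrite -[a]mul1r -pn -mulrA na mulr1. Qed.

Lemma expmxD_aux1 (S : pzRingType) (a b x y z : S) :
  x * b = b * x -> (x * y) * (a + b) = (a + b) * (x * y) ->
  (a * x * y + x * (b * y)) * z + x * y * (- (a + b) * z) = 0.
Proof.
move=> xb h.
have -> : a * x * y + x * (b * y) = x * y * (a + b).
  by rewrite [x * (b * y)]mulrA xb h -!mulrA -mulrDl.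
by rewrite mulNr mulrN [in X in _ - X]mulrA subrr.
Qed.

(** * The matrix exponential *)

Section MatrixExponential.
Variables (R : realType) (N : nat).
Local Notation M := 'M[R[i]]_N.
Implicit Types (A B : M) (s : R).

Lemma scalemxMl (c : R[i]) A B : (c *: A) * B = c *: (A * B).
Proof. exact/esym/scalemxAl. Qed.

Lemma scalemxMr (c : R[i]) A B : A * (c *: B) = c *: (A * B).
Proof. exact/esym/scalemxAr. Qed.

Lemma scalemx_exp (c : R[i]) A n : (c *: A) ^+ n = c ^+ n *: A ^+ n.
Proof.
elim: n => [|n IH]; first by rewrite !expr0 scale1r.
by rewrite !exprS IH scalemxMl scalemxMr scalerA.
Qed.

Lemma nrmMX B A n : nrm (B * A ^+ n) <= nrm B * nrm A ^+ n.
Proof.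
elim: n => [|n IH]; first by rewrite !expr0 !mulr1.
rewrite exprSr mulrA [in leRHS]exprSr mulrA.
by apply: le_trans (nrmM _ _) _; rewrite ler_wpM2r ?nrm_ge0.
Qed.

Let T A n : M := (n`!%:R)^-1 *: A ^+ n.

Let factV n : (n`!%:R : R[i])^-1 = ((n`!%:R)^-1 : R)%:C.
Proof. by rewrite fmorphV rmorph_nat. Qed.

Let T_le A n : nrm (T A n) <= (nrm (1 : M) *: exp_coeff (nrm A)) n.
Proof.
rewrite /T factV nrmZr ger0_norm ?invr_ge0 // /exp_coeff /=.
rewrite -[A ^+ n]mul1r; apply: le_trans (ler_wpM2l _ (nrmMX _ _ _)) _.
  by rewrite invr_ge0.
by rewrite [leLHS]mulrC -mulrA.
Qed.

Let bound_cvg A : series (nrm (1 : M) *: exp_coeff (nrm A)) @ \oo -->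
  nrm (1 : M) * expR (nrm A).
Proof. by rewrite seriesZ; apply: cvgZr; exact: is_cvg_series_exp_coeff. Qed.

Lemma is_cvg_expmx A : cvgn (series (T A)).
Proof. by apply: mx_series_cvg (@T_le A) _; apply/cvg_ex; eexists; exact: bound_cvg. Qed.

Lemma cvg_expmx A : series (T A) @ \oo --> expmx A.
Proof. exact: is_cvg_expmx. Qed.

Lemma nrm_expmx A : nrm (expmx A) <= nrm (1 : M) * expR (nrm A).
Proof.
apply: (nrm_lim_le (@cvg_expmx A)); apply: nearW => n.
exact: (nrm_series_le (T_le A) (@bound_cvg A) n).
Qed.

Lemma expmx0 : expmx 0 = 1 :> M.
Proof.
apply: (mx_cvg_lim (F := \oo)).
have h : \forall n \near \oo, 1 = series (T 0) n.
  near=> n; have n0 : (0 < n)%N by near: n; exact: nbhs_infty_gt.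
  rewrite -(prednK n0) /series /= big_nat_recl // big1 => [|i _].
    by rewrite /T fact0 invr1 scale1r expr0 addr0.
  by rewrite /T expr0n /= scaler0.
by apply: (cvg_trans (near_eq_cvg h)); exact: cvg_cst.
Unshelve. all: by end_near. Qed.

Lemma expmx_comm A B : GRing.comm A B -> GRing.comm (expmx A) B.
Proof.
move=> AB; apply: (mx_cvg_comm (@cvg_expmx A)) => n.
apply/commr_sym; rewrite /series /=; apply: commr_sum => k _.
rewrite /GRing.comm /T scalemxMl scalemxMr; congr (_ *: _).
by apply: commrX; exact: commr_sym.
Qed.

(** [e] stands for the real or imaginary part of an entry. Differentiating the real power series
    with coefficients [c B] replaces [B] by [B * A], so its derivative is a series of the same
    form. *)
Let entry_derive A (e : M -> R) (e_sum : forall n (F : nat -> M),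
    e (\sum_(0 <= k < n) F k) = \sum_(0 <= k < n) e (F k))
  (eZ : forall (r : R) B, e (r%:C *: B) = r * e B)
  (e_le : forall B, `|e B| <= nrm B)
  (e_cvg : forall (f : nat -> M) l, f @ \oo --> l -> e (f n) @[n --> \oo] --> e l) s :
  is_derive s 1 (fun v => e (expmx (v%:C *: A))) (e (A * expmx (s%:C *: A))).
Proof.
pose c B n := (n`!%:R)^-1 * e (B * A ^+ n).
have c_diffs B : pseries_diffs (c B) = c (B * A).
  apply/funext => n; rewrite /pseries_diffs /c factS natrM invfM exprS !mulrA.
  by rewrite divff ?mul1r // pnatr_eq0.
have c_cvg B v : e (B * expmx (v%:C *: A)) = limn (pseries (c B) v).
  apply/esym/cvg_lim => //.
  have -> : pseries (c B) v = fun n => e (B * series (T (v%:C *: A)) n).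
    apply/funext => n; rewrite /series /= mulr_sumr e_sum; apply: eq_bigr => k _.
    rewrite /c /T scalemx_exp scalerA -rmorphXn factV -rmorphM scalemxMr eZ.
    by rewrite mulrAC.
  exact: e_cvg (cvg_mxMl (l := B) (@cvg_expmx (v%:C *: A))).
have c_is_cvg B v : cvgn (pseries (c B) v).
  apply: normed_cvg.
  pose b n := nrm B * exp_coeff (nrm A * `|v|) n.
  have bE : b = nrm B *: exp_coeff (nrm A * `|v|) by [].
  apply: (@series_le_cvg _ _ b) => [n|n|n|].
  - exact: normr_ge0.
  - by rewrite /b mulr_ge0 ?nrm_ge0 // exp_coeff_ge0 // mulr_ge0 ?nrm_ge0.
  - rewrite /= /c !normrM [`|_^-1|]ger0_norm ?invr_ge0 // normrX /b /exp_coeff /= exprMn.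
    have h := le_trans (e_le (B * A ^+ n)) (nrmMX B A n).
    have f0 : 0 <= (n`!%:R : R)^-1 by rewrite invr_ge0.
    have v0 : 0 <= `|v| ^+ n by rewrite exprn_ge0.
    apply: le_trans (ler_wpM2r v0 (ler_wpM2l f0 h)) _.
    by rewrite le_eqVlt; apply/orP; left; apply/eqP; ring.
  - by rewrite bE seriesZ; apply: is_cvgZr; exact: is_cvg_series_exp_coeff.
(* Any radius above [|s|] would do, since all these series converge everywhere. *)
have := @pseries_snd_diffs R (c 1) (`|s| + 1) s (c_is_cvg _ _).
rewrite !c_diffs mul1r => /(_ (c_is_cvg _ _) (c_is_cvg _ _)).
rewrite -c_cvg => h; apply: is_derive_ext (h _) => [u|].
  by rewrite -c_cvg mul1r.
by rewrite [ltRHS]ger0_norm ?addr_ge0 // ltrDl.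
Qed.

Lemma isD_expmx A s : isD (fun v => expmx (v%:C *: A)) s (A * expmx (s%:C *: A)).
Proof.
move=> i j; split.
- apply: (@entry_derive A (fun B => complex.Re (B i j))) => [n F|r B|B|f l fl].
  + by rewrite summxE cRe_sum.
  + by rewrite mxE cReM /= mul0r subr0.
  + exact: Re_entry_le.
  + by have [] := cvg_entry i j fl.
- apply: (@entry_derive A (fun B => complex.Im (B i j))) => [n F|r B|B|f l fl].
  + by rewrite summxE cIm_sum.
  + by rewrite mxE cImM /= mul0r addr0.
  + exact: Im_entry_le.
  + by have [] := cvg_entry i j fl.
Qed.

(** The product of the exponentials of [v A], [v B] and [- v (A + B)] has derivative zero in [v];
    comparing [v = 1] with [v = 0] takes the place of a Cauchy product of series. *)
Lemma expmxD_aux A B : GRing.comm A B ->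
  expmx A * expmx B * expmx (- (A + B)) = 1.
Proof.
move=> AB.
pose E (X : M) (v : R) := expmx (v%:C *: X).
pose G v := E A v * E B v * E (- (A + B)) v.
have cE X Y v : GRing.comm X Y -> GRing.comm (E X v) Y.
  by move=> h; apply: expmx_comm; rewrite /GRing.comm scalemxMl scalemxMr h.
suff : G 1 = G 0.
  by rewrite /G /E !scale0r !expmx0 !scale1r !mulr1.
apply: isD0_cst ler01 => u _.
apply: isD_eq (isD_mul (isD_mul (isD_expmx A u) (isD_expmx B u)) (isD_expmx _ u)) _.
rewrite -/(E A u) -/(E B u) -/(E _ u).
have HAB : E A u * E B u * (A + B) = (A + B) * (E A u * E B u).
  apply/esym/commrM; apply/commr_sym/cE; apply: commrD.
  - by [].
  - exact: AB.
  - exact: commr_sym AB.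
  - by [].
exact: (expmxD_aux1 _ (cE _ _ u AB) HAB).
Qed.

Lemma expmxD A B : GRing.comm A B -> expmx (A + B) = expmx A * expmx B.
Proof.
move=> AB.
have hN : expmx (A + B) * expmx (- (A + B)) = 1.
  have := @expmxD_aux (A + B) 0 _; rewrite addr0 expmx0 mulr1; apply.
  by rewrite /GRing.comm mulr0 mul0r.
have h := expmxD_aux AB.
exact: left_right_inv_unique (mulmx1C hN) h.
Qed.

Lemma expmxN A : expmx A * expmx (- A) = 1.
Proof. by rewrite -expmxD ?subrr ?expmx0 //; apply/commrN. Qed.

End MatrixExponential.

(** * Integrals of matrix functions *)

Section RealPrimitive.
Variable R : realType.
Implicit Types (g G : R -> R) (S : set R).
Notation mu := (@lebesgue_measure R).

Lemma Rintegral_FTC2 g G (a b : R) : a <= b ->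
  (forall u, a <= u <= b -> is_derive u 1 G (g u)) ->
  (forall u, a <= u <= b -> {for u, continuous g}) ->
  \int[mu]_(u in `[a, b]) g u = G b - G a.
Proof.
rewrite le_eqVlt => /predU1P[<- _ _|ab dG cg].
  by rewrite set_itv1 Rintegral_set1 subrr.
rewrite /Rintegral (@continuous_FTC2 _ g G a b ab) //.
- apply: continuous_in_subspaceT => u; rewrite inE /= in_itv /=; exact: cg.
- split.
  + move=> u; rewrite in_itv /= => /andP[au ub].
    by apply: ex_derive; apply: dG; rewrite !ltW.
  + apply: cvg_at_right_filter; apply: is_derive_continuous (dG a _).
    by rewrite lexx ltW.
  + apply: cvg_at_left_filter; apply: is_derive_continuous (dG b _).
    by rewrite lexx ltW.
- move=> u; rewrite in_itv /= => /andP[au ub]; rewrite derive1E.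
  by apply: derive_val; apply: dG; rewrite !ltW.
Qed.

Lemma Rprimitive_exists g S (a b : R) : open S -> is_interval S -> S a -> S b ->
  (forall u, S u -> {for u, continuous g}) ->
  exists G, forall u, a <= u <= b -> is_derive u 1 G (g u).
Proof.
move=> oS iS Sa Sb cg.
have near_pt v : S v -> exists2 e : R, 0 < e & forall w, `|v - w| < e -> S w.
  by move=> Sv; have /nbhs_ballP[e /= e0 he] := open_nbhs_nbhs (conj oS Sv); exists e.
have [ea ea0 hea] := near_pt a Sa; have [eb eb0 heb] := near_pt b Sb.
(* The integral starts to the left of [a], and integrability reaches beyond [b], so that the
   primitive has two-sided derivatives at [a] and [b] as well. *)
pose a1 := a - ea / 2; pose b1 := b + eb / 2.
have Sa1 : S a1 by apply: hea; rewrite /a1 ger0_norm; lra.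
have Sb1 : S b1 by apply: heb; rewrite /b1 ler0_norm; lra.
exists (fun x => \int[mu]_(u in `[a1, x]) g u) => u /andP[au ub].
have a1u : a1 < u by rewrite /a1; lra.
have ub1 : u < b1 by rewrite /b1; lra.
have intg : mu.-integrable `[a1, b1] (EFin \o g).
  apply: continuous_compact_integrable; first exact: segment_compact.
  apply: continuous_in_subspaceT => w; rewrite inE /= in_itv /= => wab.
  by apply: cg; exact: iS Sa1 Sb1 _ wab.
have Su : S u by apply: iS Sa1 Sb1 _ _; rewrite !ltW.
have [dG G'] := continuous_FTC1_closed ub1 intg a1u (cg u Su).
by apply: DeriveDef => //; rewrite -derive1E.
Qed.

End RealPrimitive.

Section MatrixIntegral.
Variables (R : realType) (N : nat).
Local Notation M := 'M[R[i]]_N.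
Implicit Types (f g F : R -> M) (S : set R) (a b c : R).

Definition cont_on S f := forall u, S u -> f v @[v --> u] --> f u.

Lemma integralmx_FTC2 f F a b : a <= b ->
  (forall u, a <= u <= b -> isD F u (f u)) -> cont_on [set u | a <= u <= b] f ->
  integralmx a b f = F b - F a.
Proof.
move=> ab dF cf; apply/matrixP => i j; rewrite !mxE.
have h1 := @Rintegral_FTC2 R (fun u => complex.Re (f u i j))
  (fun u => complex.Re (F u i j)) a b ab.
have h2 := @Rintegral_FTC2 R (fun u => complex.Im (f u i j))
  (fun u => complex.Im (F u i j)) a b ab.
have dF1 u : a <= u <= b -> is_derive u 1 (fun u => complex.Re (F u i j)) (complex.Re (f u i j)).
  by move=> uab; have [] := dF u uab i j.
have dF2 u : a <= u <= b -> is_derive u 1 (fun u => complex.Im (F u i j)) (complex.Im (f u i j)).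
  by move=> uab; have [] := dF u uab i j.
rewrite (h1 dF1) ?(h2 dF2) => [|u uab|u uab].
- by case: (F b i j) => ? ?; case: (F a i j).
- by have [] := cvg_entry i j (cf u uab).
- by have [] := cvg_entry i j (cf u uab).
Qed.

(** Once a primitive is available, splitting, bounds, linearity and affine substitution become
    statements about derivatives. *)
Lemma primitive_exists S f a b : open S -> is_interval S -> S a -> S b ->
  cont_on S f -> exists F, (forall u, a <= u <= b -> isD F u (f u)) /\
    (forall c d, a <= c -> c <= d -> d <= b -> integralmx c d f = F d - F c).
Proof.
move=> oS iS Sa Sb cf.
have h1 i j : exists G : R -> R, forall u, a <= u <= b ->
    is_derive u 1 G (complex.Re (f u i j)).
  by apply: (Rprimitive_exists oS iS Sa Sb) => u Su; have [] := cvg_entry i j (cf u Su).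
have h2 i j : exists G : R -> R, forall u, a <= u <= b ->
    is_derive u 1 G (complex.Im (f u i j)).
  by apply: (Rprimitive_exists oS iS Sa Sb) => u Su; have [] := cvg_entry i j (cf u Su).
pose G1 i j := projT1 (cid (h1 i j)); pose G2 i j := projT1 (cid (h2 i j)).
pose F u : M := \matrix_(i, j) (G1 i j u +i* G2 i j u).
have dF u : a <= u <= b -> isD F u (f u).
  move=> uab i j; split.
  - apply: (@is_derive_ext _ _ (G1 i j)) => [v|]; first by rewrite mxE.
    by rewrite /G1; case: cid => /= G; apply.
  - apply: (@is_derive_ext _ _ (G2 i j)) => [v|]; first by rewrite mxE.
    by rewrite /G2; case: cid => /= G; apply.
exists F; split => // c d ac cd db; apply: integralmx_FTC2 => // [u|u] /= /andP[cu ud].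
- by apply: dF; rewrite (le_trans ac cu) (le_trans ud db).
- by apply: cf; apply: iS Sa Sb _ _; rewrite (le_trans ac cu) (le_trans ud db).
Qed.

Variable S : set R.
Hypotheses (oS : open S) (iS : is_interval S).

Lemma integralmx_split f a b c : cont_on S f -> S a -> S c -> a <= b -> b <= c ->
  integralmx a c f = integralmx a b f + integralmx b c f.
Proof.
move=> cf Sa Sc ab bc; have [F [_ h]] := primitive_exists oS iS Sa Sc cf.
rewrite !h //; last exact: le_trans bc.
by rewrite [RHS]addrC addrA subrK.
Qed.

Lemma integralmx_le f (g g' : R -> R) a b : cont_on S f -> S a -> S b -> a <= b ->
  (forall u, a <= u <= b -> is_derive u 1 g (g' u)) ->
  (forall u, a <= u <= b -> nrm (f u) <= g' u) ->
  nrm (integralmx a b f) <= (N * N)%:R * (2 * (g b - g a)).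
Proof.
move=> cf Sa Sb ab dg fg; have [F [dF h]] := primitive_exists oS iS Sa Sb cf.
by rewrite h //; exact: isD_mean dg fg.
Qed.

Lemma integralmx_le_cst f (K : R) a b : cont_on S f -> S a -> S b -> a <= b ->
  (forall u, a <= u <= b -> nrm (f u) <= K) ->
  nrm (integralmx a b f) <= (N * N)%:R * (2 * (K * (b - a))).
Proof.
move=> cf Sa Sb ab fK; have [F [dF h]] := primitive_exists oS iS Sa Sb cf.
by rewrite h //; exact: isD_lip dF fK.
Qed.

Lemma cont_onD f g : cont_on S f -> cont_on S g -> cont_on S (fun u => f u + g u).
Proof. by move=> cf cg u Su; exact: cvgD (cf u Su) (cg u Su). Qed.

Lemma cont_onM f g : cont_on S f -> cont_on S g -> cont_on S (fun u => f u * g u).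
Proof. by move=> cf cg u Su; exact: cvg_mxM (cf u Su) (cg u Su). Qed.

Lemma cont_on_cst (A : M) : cont_on S (fun=> A).
Proof. by move=> u _; exact: cvg_cst. Qed.

Lemma integralmxD f g a b : cont_on S f -> cont_on S g -> S a -> S b -> a <= b ->
  integralmx a b (fun u => f u + g u) = integralmx a b f + integralmx a b g.
Proof.
move=> cf cg Sa Sb ab; have [F [dF hF]] := primitive_exists oS iS Sa Sb cf.
have [G [dG hG]] := primitive_exists oS iS Sa Sb cg.
rewrite hF // hG // (@integralmx_FTC2 _ (fun u => F u + G u)) //.
- by rewrite opprD addrACA.
- by move=> u uab; exact: isD_add (dF _ uab) (dG _ uab).
- move=> u uab; have Su : S u by exact: iS Sa Sb _ uab.
  exact: cont_onD cf cg u Su.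
Qed.

Lemma integralmxMr f (B : M) a b : cont_on S f -> S a -> S b -> a <= b ->
  integralmx a b (fun u => f u * B) = integralmx a b f * B.
Proof.
move=> cf Sa Sb ab; have [F [dF hF]] := primitive_exists oS iS Sa Sb cf.
rewrite hF // (@integralmx_FTC2 _ (fun u => F u * B)) //.
- by rewrite mulrBl.
- by move=> u uab; exact: isD_mulr (dF _ uab).
- move=> u uab; have Su : S u by exact: iS Sa Sb _ uab.
  exact: cont_onM cf (@cont_on_cst B) u Su.
Qed.

Lemma integralmxMl f (B : M) a b : cont_on S f -> S a -> S b -> a <= b ->
  integralmx a b (fun u => B * f u) = B * integralmx a b f.
Proof.
move=> cf Sa Sb ab; have [F [dF hF]] := primitive_exists oS iS Sa Sb cf.
rewrite hF // (@integralmx_FTC2 _ (fun u => B * F u)) //.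
- by rewrite mulrBr.
- by move=> u uab; exact: isD_mull (dF _ uab).
- move=> u uab; have Su : S u by exact: iS Sa Sb _ uab.
  exact: cont_onM (@cont_on_cst B) cf u Su.
Qed.

Lemma cont_onB f g : cont_on S f -> cont_on S g -> cont_on S (fun u => f u - g u).
Proof. by move=> cf cg u Su; exact: cvgB (cf u Su) (cg u Su). Qed.

Lemma integralmxB f g a b : cont_on S f -> cont_on S g -> S a -> S b -> a <= b ->
  integralmx a b (fun u => f u - g u) = integralmx a b f - integralmx a b g.
Proof.
move=> cf cg Sa Sb ab.
have cNg := cont_onM (@cont_on_cst (- 1)) cg.
have -> : (fun u => f u - g u) = (fun u => f u + (- 1 * g u)).
  by apply/funext => u; rewrite mulN1r.
by rewrite integralmxD // integralmxMl // mulN1r.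
Qed.

Lemma cont_on_sum (f : nat -> R -> M) n : (forall k, cont_on S (f k)) ->
  cont_on S (fun u => \sum_(0 <= k < n) f k u).
Proof.
move=> cf; elim: n => [|n IH].
  have -> : (fun u => \sum_(0 <= k < 0) f k u) = (fun=> 0).
    by apply/funext => u; rewrite big_geq.
  exact: cont_on_cst.
have -> : (fun u => \sum_(0 <= k < n.+1) f k u) =
    (fun u => \sum_(0 <= k < n) f k u + f n u).
  by apply/funext => u; rewrite big_nat_recr.
exact: cont_onD IH (cf n).
Qed.

Lemma integralmx_sum (f : nat -> R -> M) n a b : (forall k, cont_on S (f k)) ->
  S a -> S b -> a <= b ->
  integralmx a b (fun u => \sum_(0 <= k < n) f k u) = \sum_(0 <= k < n) integralmx a b (f k).
Proof.
move=> cf Sa Sb ab; elim: n => [|n IH].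
  have -> : (fun u => \sum_(0 <= k < 0) f k u) = (fun=> 0).
    by apply/funext => u; rewrite big_geq.
  rewrite big_geq //.
  by rewrite (@integralmx_FTC2 _ (fun=> 0)) ?subrr // => u _; [exact: isD_cst|exact: cvg_cst].
have -> : (fun u => \sum_(0 <= k < n.+1) f k u) =
    (fun u => \sum_(0 <= k < n) f k u + f n u).
  by apply/funext => u; rewrite big_nat_recr.
rewrite big_nat_recr //= -IH; apply: integralmxD => //; exact: cont_on_sum.
Qed.

Lemma integralmx_affine f c (d : R) a b : 0 < c -> cont_on S f ->
  S (c * a + d) -> S (c * b + d) -> a <= b ->
  c%:C *: integralmx a b (fun v => f (c * v + d)) = integralmx (c * a + d) (c * b + d) f.
Proof.
move=> c0 cf Sa Sb ab; have [F [dF hF]] := primitive_exists oS iS Sa Sb cf.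
have ab' : c * a + d <= c * b + d by rewrite lerD2r ler_pM2l.
rewrite hF //.
have itv v : a <= v <= b -> c * a + d <= c * v + d <= c * b + d.
  by case/andP=> ? ?; rewrite !lerD2r !ler_pM2l //; apply/andP.
have cne : c%:C != 0 :> R[i] by rewrite eq_complex /= negb_and gt_eqF.
rewrite (@integralmx_FTC2 _ (fun v => c%:C^-1 *: F (c * v + d))) //.
- by rewrite -scalerBr scalerA divff // scale1r.
- move=> v vab; have := isD_scalec (c%:C^-1) (isD_comp (is_derive_affine c d v) (dF _ (itv v vab))).
  by rewrite scalerA mulVf // scale1r.
- move=> v vab; apply: (@cvg_comp _ _ _ (fun v => c * v + d) f _ (nbhs (c * v + d))).
    exact: is_derive_continuous (is_derive_affine c d v).
  by apply: cf; apply: iS Sa Sb _ _; exact: itv.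
Qed.

Lemma integralmx_affineN f c (d : R) a b : 0 < c -> cont_on S f ->
  S (d - c * a) -> S (d - c * b) -> a <= b ->
  c%:C *: integralmx a b (fun v => f (d - c * v)) = integralmx (d - c * b) (d - c * a) f.
Proof.
move=> c0 cf Sa Sb ab; have [F [dF hF]] := primitive_exists oS iS Sb Sa cf.
have ab' : d - c * b <= d - c * a by rewrite lerD2l lerN2 ler_pM2l.
rewrite hF //.
have itv v : a <= v <= b -> d - c * b <= d - c * v <= d - c * a.
  by case/andP=> ? ?; rewrite !lerD2l !lerN2 !ler_pM2l //; apply/andP.
have cne : c%:C != 0 :> R[i] by rewrite eq_complex /= negb_and gt_eqF.
have daff (v : R) : is_derive v 1 (fun v => d - c * v) (- c).
  have := is_derive_affine (- c) d v.
  by apply: is_derive_ext => u; rewrite mulNr addrC.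
rewrite (@integralmx_FTC2 _ (fun v => (- c%:C^-1) *: F (d - c * v))) //.
- by rewrite -scalerBr scalerA mulrN divff // scaleN1r opprB.
- move=> v vab; have := isD_scalec (- c%:C^-1) (isD_comp (daff v) (dF _ (itv v vab))).
  by rewrite scalerA rmorphN mulrNN mulVf // scale1r.
- move=> v vab; apply: (@cvg_comp _ _ _ (fun v => d - c * v) f _ (nbhs (d - c * v))).
    exact: is_derive_continuous (daff v).
  by apply: cf; apply: iS Sb Sa _ _; exact: itv.
Qed.

End MatrixIntegral.

(** * Exponential decay of exp(-sA) *)

Section Decay.
Variables (R : realType) (N : nat).
Local Notation M := 'M[R[i]]_N.
Implicit Types (A B V : M) (s : R).

(* [|g|^2] of a solution of [g' = - lam g - h], [lam = a + b i], satisfies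
   [(|g|^2)' <= - (a + d) |g|^2 + |h|^2 / (a - d)] by Young's inequality. *)
Lemma linear_ode_decay (p q h k : R -> R) (a b d K : R) : 0 < d -> d < a ->
  (forall s, 0 <= s -> is_derive s 1 p (- (a * p s - b * q s) - h s)) ->
  (forall s, 0 <= s -> is_derive s 1 q (- (a * q s + b * p s) - k s)) ->
  (forall s, 0 <= s -> `|h s| <= K * expR (- (d * s))) ->
  (forall s, 0 <= s -> `|k s| <= K * expR (- (d * s))) ->
  exists C, forall s, 0 <= s -> `|p s| <= C * expR (- (d * s)) /\
                                `|q s| <= C * expR (- (d * s)).
Proof.
move=> d0 da dp dq hK kK.
pose e := a - d; have e0 : 0 < e by rewrite /e; lra.
pose n s := p s * p s + q s * q s.
(* The factor 2 collects one use of Young's inequality for [p] and one for [q]. *)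
pose c0 := 2 * K ^+ 2 / e.
have dn s : 0 <= s -> exists2 n' : R, is_derive s 1 n n' &
    n' + (a + d) * n s <= c0 * expR (- (2 * d * s)).
  move=> s0; eexists.
    apply: is_derive_addf; apply: is_derive_mulf.
    - exact: dp.
    - exact: dp.
    - exact: dq.
    - exact: dq.
  have young x y : - (2 * x * y) <= e * x ^+ 2 + y ^+ 2 / e.
    have : 0 <= (e * x + y) ^+ 2 / e by rewrite divr_ge0 ?sqr_ge0 ?ltW.
    have -> : (e * x + y) ^+ 2 / e = e * x ^+ 2 + 2 * x * y + y ^+ 2 / e.
      by field; rewrite gt_eqF.
    lra.
  have sq y : `|y| <= K * expR (- (d * s)) -> y ^+ 2 / e <= K ^+ 2 / e * expR (- (2 * d * s)).
    move=> yK; rewrite [leRHS]mulrAC ler_pM2r ?invr_gt0 //.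
    have -> : - (2 * d * s) = - (d * s) + - (d * s) by ring.
    rewrite expRD -expr2 -exprMn -real_normK ?num_real // lerXn2r ?nnegrE //.
    exact: le_trans yK.
  have y1 := young (p s) (h s); have y2 := young (q s) (k s).
  have s1 := sq _ (hK s s0); have s2 := sq _ (kK s s0).
  rewrite /n /c0 /e in y1 y2 s1 s2 *.
  have -> : 2 * K ^+ 2 / (a - d) * expR (- (2 * d * s)) =
    2 * (K ^+ 2 / (a - d) * expR (- (2 * d * s))) by ring.
  move: y1 y2 s1 s2; move: (_ / _ * expR _) (h s ^+ 2 / _) (k s ^+ 2 / _) => X Y Z.
  by move=> y1 y2 s1 s2; lra.
(* [dn] gives the derivative of [n] only as an existential witness; choice turns it into a
   function. *)
pose n' s := if pselect (0 <= s) is left s0 then projT1 (cid2 (dn s s0)) else 0.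
have n'P s : 0 <= s -> is_derive s 1 n (n' s) /\
    n' s + (a + d) * n s <= c0 * expR (- (2 * d * s)).
  by move=> s0; rewrite /n'; case: pselect => // s0'; case: cid2.
pose D := n 0 + c0 / e.
have nD s : 0 <= s -> n s <= D * expR (- (2 * d * s)).
  move=> s0.
  have dE (c u : R) : is_derive u 1 (fun u => expR (c * u)) (expR (c * u) * c).
    exact: is_derive_compf (is_derive_expR _) (is_derive_scal c u).
  (* Integrating factor [expR ((a + d) * u)]: as [e = (a + d) - 2 d], the derivative of this
     difference is the slack in [dn] times that factor. *)
  have := @is_derive_mono R (fun u => c0 / e * expR (e * u) - expR ((a + d) * u) * n u)
    (fun u => c0 / e * (expR (e * u) * e) - (expR ((a + d) * u) * (a + d) * n u +
       expR ((a + d) * u) * n' u)) 0 s s0.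
  rewrite !mulr0 expR0 mulr1 mul1r => H.
  have {H} : c0 / e - n 0 <= c0 / e * expR (e * s) - expR ((a + d) * s) * n s.
    apply: H => u /andP[u0 _].
    - exact: is_derive_subf (is_derive_mulcf (c0 / e) (dE e u))
        (is_derive_mulf (dE (a + d) u) (n'P u u0).1).
    - have [_ H] := n'P u u0.
      have -> : c0 / e * (expR (e * u) * e) = expR ((a + d) * u) * (c0 * expR (- (2 * d * u))).
        have -> : e * u = (a + d) * u + - (2 * d * u) by rewrite /e; ring.
        by rewrite expRD; field; rewrite gt_eqF.
      rewrite subr_ge0 -mulrA -mulrDr ler_wpM2l ?expR_ge0 //; lra.
  have -> : e * s = (a + d) * s + - (2 * d * s) by rewrite /e; ring.
  have E0 := expR_gt0 ((a + d) * s).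
  rewrite expRD => H.
  rewrite -(ler_pM2l E0).
  have c00 : 0 <= c0 / e.
    have ei : 0 <= e^-1 by rewrite invr_ge0 ltW.
    exact: mulr_ge0 (mulr_ge0 (mulr_ge0 (ler0n _ 2) (sqr_ge0 K)) ei) ei.
  have n00 : 0 <= n 0 by rewrite addr_ge0 // -expr2 sqr_ge0.
  have H2 : 1 <= expR ((a + d) * s) * expR (- (2 * d * s)).
    rewrite -expRD -[leLHS]expR0 ler_expR.
    have -> : (a + d) * s + - (2 * d * s) = e * s by rewrite /e; ring.
    by rewrite mulr_ge0 // ltW.
  rewrite /D mulrCA [leRHS]mulrDl.
  have H3 : n 0 <= n 0 * (expR ((a + d) * s) * expR (- (2 * d * s))) by rewrite ler_peMr.
  apply: (@le_trans _ _ (n 0 + c0 / e * (expR ((a + d) * s) * expR (- (2 * d * s))))).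
    move: H c00; clear; move: (c0 / e) (n 0) (_ * _) (_ * n s) => x y z w; lra.
  by rewrite lerD2r.
have D0 : 0 <= D.
  have := nD 0 (lexx _); rewrite mulr0 oppr0 expR0 mulr1; apply: le_trans.
  by rewrite addr_ge0 // -expr2 sqr_ge0.
(* [D <= (D + 1) ^ 2] spares a square root of [D]. *)
have key x s : 0 <= s -> x ^+ 2 <= n s -> `|x| <= (D + 1) * expR (- (d * s)).
  move=> s0 xn; rewrite -(@ler_pXn2r _ 2) ?nnegrE ?normr_ge0 //; last first.
    by rewrite mulr_ge0 ?expR_ge0 // addr_ge0.
  rewrite real_normK ?num_real //; apply: (le_trans xn); apply: (le_trans (nD s s0)).
  have -> : - (2 * d * s) = - (d * s) + - (d * s) by ring.
  rewrite expRD exprMn -expr2 ler_wpM2r ?sqr_ge0 //.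
  rewrite expr2; have := mulr_ge0 D0 D0; lra.
exists (D + 1) => s s0; split; apply: key => //; rewrite /n expr2 ?lerDl ?lerDr -expr2;
  exact: sqr_ge0.
Qed.

Lemma mx_ode_decay (G H : R -> M) (lam : R[i]) (d K : R) : 0 < d -> d < complex.Re lam ->
  (forall s, 0 <= s -> isD G s (- (lam *: G s) - H s)) ->
  (forall s, 0 <= s -> nrm (H s) <= K * expR (- (d * s))) ->
  exists C, forall s, 0 <= s -> nrm (G s) <= C * expR (- (d * s)).
Proof.
move=> d0 dlam dG HK.
have ent i j : exists C, forall s, 0 <= s -> l1c (G s i j) <= C * expR (- (d * s)).
  have [s s0|s s0|s s0|s s0|C hC] := @linear_ode_decay
     (fun s => complex.Re (G s i j)) (fun s => complex.Im (G s i j))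
     (fun s => complex.Re (H s i j)) (fun s => complex.Im (H s i j))
     (complex.Re lam) (complex.Im lam) d K d0 dlam.
  - apply: (is_derive_eq (dG s s0 i j).1).
    by rewrite !mxE cReD !cReN cReM.
  - apply: (is_derive_eq (dG s s0 i j).2).
    by rewrite !mxE cImD !cImN cImM.
  - by apply: le_trans (HK s s0); exact: Re_entry_le.
  - by apply: le_trans (HK s s0); exact: Im_entry_le.
  exists (C + C) => s s0; rewrite mulrDl lerD //; by have [] := hC s s0.
pose C i j := projT1 (cid (ent i j)).
exists (\sum_i \sum_j C i j) => s s0.
rewrite mulr_suml ler_sum // => i _; rewrite mulr_suml ler_sum // => j _.
by rewrite /C; case: cid => /= c; apply.
Qed.

(* Equivalent to [re_pos A], but visibly stable under sums of commuting
   matrices. *)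
Definition decay A := exists d K : R, [/\ 0 < d, d <= 1 &
  forall s, 0 <= s -> nrm (expmx ((- s)%:C *: A)) <= K * expR (- (d * s))].

Lemma isD_expmxN A s :
  isD (fun v => expmx ((- v)%:C *: A)) s (- A * expmx ((- s)%:C *: A)).
Proof.
have := isD_comp (is_derive_affine (-1) 0 s) (isD_expmx A ((-1) * s + 0)).
rewrite addr0 mulN1r rmorphN rmorph1 scaleN1r mulNr.
by apply: isD_ext => u; rewrite addr0 mulN1r.
Qed.

Lemma expmxZ_comm (c : R[i]) A B : GRing.comm A B -> GRing.comm (expmx (c *: A)) B.
Proof. by move=> h; apply: expmx_comm; rewrite /GRing.comm scalemxMl scalemxMr h. Qed.

Lemma decay_prod_aux (S : pzRingType) (v a l e : S) : v * a = a * v ->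
  v * (- a * e) = - (l * (v * e)) - (a - l) * v * e.
Proof. by move=> va; rewrite !mulrBl mulNr mulrN !mulrA va opprB addKr. Qed.

(** Put [W = (A - lam) V]. Then [G = V exp(-sA)] solves [G' = - lam G - W exp(-sA)]; the induction
    hypothesis, applied to [W], makes the forcing term decay at rate [d], and [Re lam > d] passes
    this rate on to [G]. The matrix [V] is general because it accumulates the factors that remain to
    be removed. *)
Lemma decay_prod A (d : R) (r : seq R[i]) V : 0 < d -> GRing.comm V A ->
  (forall lam, lam \in r -> d < complex.Re lam) ->
  (exists K, forall s, 0 <= s ->
    nrm ((\prod_(lam <- r) (A - lam%:M)) * V * expmx ((- s)%:C *: A)) <= K * expR (- (d * s))) ->
  exists K, forall s, 0 <= s -> nrm (V * expmx ((- s)%:C *: A)) <= K * expR (- (d * s)).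
Proof.
move=> d0; elim: r V => [|lam r IH] V VA hr.
  by move=> [K hK]; exists K => s s0; move: (hK s s0); rewrite big_nil mul1r.
have scal (B : M) (mu : R[i]) : GRing.comm B mu%:M by exact: comm_mx_scalar.
rewrite big_cons => -[K hK].
have [|lam' lr||K' hK'] := IH ((A - lam%:M) * V).
- exact: commr_sym (commrM (commrB (commr_refl A) (scal A lam)) (commr_sym VA)).
- by apply: hr; rewrite inE lr orbT.
- exists K => s s0; move: (hK s s0); rewrite [X in X * V](_ : _ =
    (\prod_(lam' <- r) (A - lam'%:M)) * (A - lam%:M)) ?mulrA //.
  apply: commr_prod => mu _; apply: commrB; last exact: scal.
  exact: commr_sym (commrB (commr_refl A) (scal A lam)).
apply: (@mx_ode_decay _ (fun s => (A - lam%:M) * V * expmx ((- s)%:C *: A)) lam d K').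
- exact: d0.
- by apply: hr; rewrite inE eqxx.
- move=> s s0; apply: isD_eq (isD_mull V (isD_expmxN A s)) _.
  rewrite (_ : lam *: (V * _) = lam%:M * (V * expmx ((- s)%:C *: A))).
    exact: decay_prod_aux.
  exact/esym/mul_scalar_mx.
- exact: hK'.
Qed.

End Decay.

Lemma seq_lower_bound (R : realType) (r : seq R[i]) : (forall z, z \in r -> 0 < complex.Re z) ->
  exists d : R, [/\ 0 < d, d <= 1 & forall z, z \in r -> d < complex.Re z].
Proof.
elim: r => [|z r IH] h; first by exists 1.
have [|d [d0 d1 hd]] := IH; first by move=> y yr; apply: h; rewrite inE yr orbT.
have z0 : 0 < complex.Re z by apply: h; rewrite inE eqxx.
(* Halving makes the bound strict at [z]. The cap [d <= 1], inherited from the empty list, later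
   gives [w ^ d <= w] for [w >= 1]. *)
exists (Num.min d (complex.Re z / 2)); split.
- by rewrite lt_min d0 divr_gt0.
- by rewrite ge_min d1.
- move=> y; rewrite inE gt_min => /predU1P[->|/hd ->//].
  by apply/orP; right; lra.
Qed.

(* The eigenvalue factors of the characteristic polynomial are peeled off one
   at a time, starting from Cayley-Hamilton. *)
Lemma re_pos_decay (R : realType) (N : nat) (A : 'M[R[i]]_N) : re_pos A -> decay A.
Proof.
case: N A => [|N] A hA.
  exists 1, 0; split => // s _; rewrite mul0r (_ : expmx _ = 0) ?nrm0 //.
  by apply/matrixP => -[].
have [r hr] := closed_field_poly_normal (char_poly A).
rewrite (monicP (char_poly_monic A)) scale1r in hr.
have rpos z : z \in r -> 0 < complex.Re z.
  by move=> zr; apply: hA; rewrite eigenvalue_root_char hr root_prod_XsubC.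
have [d [d0 d1 hd]] := seq_lower_bound rpos.
have [|K hK] := @decay_prod _ _ A d r 1 d0 (commr_sym (commr1 A)) hd.
  exists 0 => s _; rewrite mul0r mulr1.
  have -> : \prod_(lam <- r) (A - lam%:M) = 0.
    have := Cayley_Hamilton A; rewrite hr rmorph_prod /= => <-.
    by apply: eq_bigr => z _; rewrite rmorphB /= horner_mx_X horner_mx_C.
  by rewrite mul0r nrm0.
by exists d, K; split => // s s0; have := hK s s0; rewrite mul1r.
Qed.

Section DecayTheory.
Variables (R : realType) (N : nat).
Local Notation M := 'M[R[i]]_N.
Implicit Types (A B : M) (s : R).

Lemma re_pos1 : re_pos (1 : M).
Proof.
move=> a /eigenvalueP[v]; rewrite mulmx1 => h v0.
suff -> : a = 1 by rewrite ltr01.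
have [j vj] : exists j, v 0 j != 0.
  by apply/rV0Pn.
move/matrixP/(_ 0 j): h; rewrite mxE => h.
by apply: (mulIf vj); rewrite -h mul1r.
Qed.

Lemma decay1 : decay (1 : M).
Proof. exact: re_pos_decay re_pos1. Qed.

Lemma decayD A B : GRing.comm A B -> decay A -> decay B -> decay (A + B).
Proof.
move=> AB [d1 [K1 [d10 d11 h1]]] [d2 [K2 [d20 d21 h2]]].
(* The second exponential enters only through its bound [K2], so the rate stays [d1 <= 1]. *)
exists d1, (K1 * K2); split => // s s0.
have -> : (- s)%:C *: (A + B) = (- s)%:C *: A + (- s)%:C *: B by rewrite scalerDr.
rewrite expmxD; last by rewrite /GRing.comm !scalemxMl !scalemxMr AB.
have {}h1 := h1 s s0; have {}h2 := h2 s s0.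
apply: le_trans (nrmMr_le h1 h2) _.
have K20 : 0 <= K2.
  by have := le_trans (nrm_ge0 _) h2; rewrite pmulr_lge0 ?expR_gt0.
have K10 : 0 <= K1.
  by have := le_trans (nrm_ge0 _) h1; rewrite pmulr_lge0 ?expR_gt0.
have e2 : expR (- (d2 * s)) <= 1.
  by rewrite expR_le1 oppr_le0 mulr_ge0 // ltW.
have -> : K1 * expR (- (d1 * s)) * (K2 * expR (- (d2 * s))) =
  K1 * K2 * expR (- (d1 * s)) * expR (- (d2 * s)) by ring.
by apply: ler_piMr => //; rewrite !mulr_ge0 ?expR_ge0.
Qed.

Lemma decay_lim0 A : decay A -> nrm (expmx ((- s)%:C *: A)) @[s --> +oo] --> (0 : R).
Proof.
move=> [d [K [d0 _ h]]].
apply: (@squeeze_cvgr _ _ _ _ (fun=> 0) (fun s => K * expR (- (d * s)))).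
- near=> s; rewrite nrm_ge0 h //.
- exact: cvg_cst.
- rewrite -[X in _ --> X](mulr0 K); apply: cvgMr.
  apply: (@cvg_comp _ _ _ (fun s => d * s) (fun y => expR (- y)) _ (+oo)); last exact: cvgr_expR.
  by apply: gt0_cvgMry => //; exact: cvg_id.
Unshelve. all: by end_near. Qed.

(* A left kernel vector [v] of [A + r] satisfies [v = e^{-rs} v exp(-sA)] for
   all [s], which tends to [0]. *)
Lemma decay_unit A (r : R) : decay A -> 0 <= r -> A + r%:C%:M \in unitmx.
Proof.
move=> dA r0; rewrite -row_free_unit -kermx_eq0.
set V := kermx _; have VA : V * (A + r%:C%:M) = 0 by exact: mulmx_ker.
have {}VA : V * A = - (r%:C *: V).
  move: VA; rewrite mulrDr => /eqP; rewrite addr_eq0 => /eqP ->; congr (- _).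
  exact: mul_mx_scalar.
pose G s := (expR (- (r * s)))%:C *: (V * expmx ((- s)%:C *: A)).
have dG s : isD G s 0.
  have h : is_derive s 1 (fun s => expR (- (r * s))) (expR (- (r * s)) * - r).
    apply: is_derive_compf (is_derive_expR _) _.
    by apply: is_derive_ext (is_derive_scal (- r) s) => u; rewrite mulNr.
  apply: isD_eq (isD_scale h (isD_mull V (isD_expmxN A s))) _.
  have -> : V * (- A * expmx ((- s)%:C *: A)) = r%:C *: (V * expmx ((- s)%:C *: A)).
    by rewrite mulrA mulrN VA opprK scalemxMl.
  rewrite scalerA.
  by rewrite -scalerDl -rmorphM -rmorphD /= mulrN addNr scale0r.
have GV s : 0 <= s -> nrm V <= nrm V * nrm (expmx ((- s)%:C *: A)).
  move=> s0; have VG : nrm V = nrm (G s).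
    rewrite (@isD0_cst _ _ G 0 s) // /G mulr0 oppr0 expR0 scale1r.
    by rewrite scale0r expmx0 mulr1.
  rewrite [leLHS]VG /G nrmZr ger0_norm ?expR_ge0 //.
  apply: (le_trans _ (nrmM _ _)); apply: ler_piMl; first exact: nrm_ge0.
  by rewrite expR_le1 oppr_le0 mulr_ge0.
apply/eqP/nrm_eq0/eqP; rewrite eq_le nrm_ge0 andbT.
have := decay_lim0 dA => h0.
have h : nrm V * nrm (expmx ((- s)%:C *: A)) @[s --> +oo] --> (0 : R).
  by rewrite -[X in _ --> X](mulr0 (nrm V)); apply: cvgMr.
rewrite -(cvg_lim _ h) //; apply: limr_ge; first by apply/cvg_ex; exists 0.
near=> s; exact: GV.
Unshelve. all: by end_near. Qed.

End DecayTheory.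

(** * Matrix powers and improper integrals *)

Section MatrixPower.
Variables (R : realType) (N : nat).
Local Notation M := 'M[R[i]]_N.
Implicit Types (A B : M) (s t : R).

Lemma powmx1 A : powmx 1 A = 1.
Proof. by rewrite /powmx ln1 scale0r expmx0. Qed.

Lemma powmxMl A t s : 0 < t -> 0 < s -> powmx (t * s) A = powmx t A * powmx s A.
Proof.
move=> t0 s0; rewrite /powmx lnM ?posrE // rmorphD scalerDl expmxD //.
by rewrite /GRing.comm !scalemxMl !scalemxMr !scalerA mulrC.
Qed.

Lemma powmxD A B t : GRing.comm A B -> powmx t (A + B) = powmx t A * powmx t B.
Proof.
move=> AB; rewrite /powmx scalerDr expmxD //.
by rewrite /GRing.comm !scalemxMl !scalemxMr AB.
Qed.

Lemma powmxN A t : powmx t A * powmx t (- A) = 1.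
Proof. by rewrite /powmx scalerN expmxN. Qed.

Lemma powmx_comm A B t : GRing.comm A B -> GRing.comm (powmx t A) B.
Proof. exact: expmxZ_comm. Qed.

Lemma powmx_comm2 A B t s : GRing.comm A B -> GRing.comm (powmx t A) (powmx s B).
Proof. by move=> h; apply/powmx_comm/commr_sym/powmx_comm/commr_sym. Qed.

Lemma expmx_scalar (r : R) : expmx (r%:C *: (1 : M)) = (expR r)%:C *: (1 : M).
Proof.
pose G s : M := (expR (- s))%:C *: expmx (s%:C *: (1 : M)).
have dG s : isD G s 0.
  have h : is_derive s 1 (fun s => expR (- s)) (expR (- s) * - 1).
    exact: is_derive_compf (is_derive_expR _) (is_deriveNid s (1 : R)).
  apply: isD_eq (isD_scale h (isD_expmx 1 s)) _.
  by rewrite mul1r -scalerDl -rmorphD /= mulrN1 addNr scale0r.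
have G0 : G 0 = 1 by rewrite /G oppr0 expR0 scale1r scale0r expmx0.
have : G r = 1.
  rewrite -G0; have [r0|/ltW r0] := leP 0 r; first exact: isD0_cst.
  by apply/esym; exact: isD0_cst.
move/(congr1 (fun X => (expR r)%:C *: X)).
by rewrite /G scalerA -rmorphM -expRD subrr expR0 scale1r.
Qed.

Lemma powmx_id t : 0 < t -> powmx t (1 : M) = t%:C *: (1 : M).
Proof. by move=> t0; rewrite /powmx expmx_scalar lnK // posrE. Qed.

Lemma powmxD1 A t : 0 < t -> powmx t (A + 1) = t%:C *: powmx t A.
Proof.
move=> t0; rewrite powmxD; last exact: commr1.
by rewrite powmx_id // scalemxMr mulr1.
Qed.

Lemma powmxB1 A t : 0 < t -> t%:C *: powmx t (A - 1) = powmx t A.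
Proof. by move=> t0; have := powmxD1 (A - 1) t0; rewrite subrK => <-. Qed.

Lemma isD_powmx A t : 0 < t -> isD (fun v => powmx v A) t (A * powmx t (A - 1)).
Proof.
move=> t0; apply: isD_eq (isD_comp (is_derive1_ln t0) (isD_expmx A (ln t))) _.
rewrite -[expmx _]/(powmx t A) -(powmxB1 A t0) scalemxMr scalerA -rmorphM.
by rewrite mulVf ?gt_eqF // scale1r.
Qed.

(** The substitution [s = - ln t] turns exponential decay in [s] into a positive power of [t] near
    0. *)
Lemma decay_powmx A : decay A -> exists d K : R, [/\ 0 < d, d <= 1 &
  forall t, 0 < t -> t <= 1 -> nrm (powmx t A) <= K * t `^ d].
Proof.
move=> [d [K [d0 d1 h]]]; exists d, K; split => // t t0 t1.
have := h (- ln t); rewrite opprK => /(_ _); rewrite mulrN opprK /powR gt_eqF //.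
by apply; rewrite oppr_ge0 ln_le0.
Qed.

(** For [n > 0] this is [a <= e^a] at [a = (1 + y) / n], raised to the power [n]. *)
Lemma pow_expR_bound (n : nat) : exists C : R, forall y, 0 <= y ->
  (1 + y) ^+ n * expR (- y) <= C.
Proof.
case: n => [|n].
  by exists 1 => y y0; rewrite expr0 mul1r expR_le1 oppr_le0.
exists (n.+1%:R ^+ n.+1 * expR 1) => y y0.
have n0 : 0 < n.+1%:R :> R by rewrite ltr0n.
have h : (1 + y) / n.+1%:R <= expR ((1 + y) / n.+1%:R).
  by apply: le_trans (expR_ge1Dx _); rewrite lerDr.
have : ((1 + y) / n.+1%:R) ^+ n.+1 <= expR ((1 + y) / n.+1%:R) ^+ n.+1.
  by rewrite lerXn2r // nnegrE ?expR_ge0 // divr_ge0 ?addr_ge0 // ltW.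
rewrite -expRM_natl [X in expR X]mulrC divfK ?gt_eqF // expr_div_n ler_pdivrMr ?exprn_gt0 //.
rewrite expRD => h2.
rewrite expRN ler_pdivrMr ?expR_gt0 //; apply: le_trans h2 _.
by rewrite mulrC mulrA.
Qed.

(** Up to a constant the majorant is [w] times the derivative of [- 1 / (1 + w ^ d)]. It is of order
    [w ^ d] at 0, where the decay of [powmx] is used, and of order [w ^ (- d)] at infinity, where
    the exponential beats every power. The weight [(1 + w) ^ n] leaves room for polynomial
    factors. *)
Lemma decay_bound A (n : nat) : decay A -> exists d K : R, [/\ 0 < d, d <= 1 &
  forall w, 0 < w ->
    nrm (powmx w A) * (1 + w) ^+ n * expR (- w) <= K * (w `^ d / (1 + w `^ d) ^+ 2)].
Proof.
move=> /decay_powmx[d [K [d0 d1 h]]].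
have [L hL] : exists L : nat, nrm A <= L%:R.
  by exists (Num.truncn (nrm A)).+1; rewrite ltW // truncnS_gt.
(* Powers of [1 + w] that the exponential must absorb for [w >= 1]: [L] from [powmx w A], [n] from
   the weight, 2 from the denominator of the majorant. *)
have [C hC] := pow_expR_bound (L + n.+2)%N.
pose D := nrm (1 : M) * C.
exists d, (`|K| * 2 ^+ n * 4 + D); split => // w w0.
have wd0 : 0 < w `^ d by rewrite powR_gt0.
have W0 : 0 < (1 + w `^ d) ^+ 2 by rewrite exprn_gt0 // addr_gt0.
have C0 : 0 <= C by apply: le_trans (hC 0 (lexx _)); rewrite mulr_ge0 ?expR_ge0 ?exprn_ge0 ?addr_ge0.
have D0 : 0 <= D by rewrite mulr_ge0 // nrm_ge0.
rewrite mulrA ler_pdivlMr //.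
have [w1|/ltW w1] := leP w 1.
- have h1 : nrm (powmx w A) <= `|K| * w `^ d.
    by apply: le_trans (h w w0 w1) _; rewrite ler_wpM2r ?ler_norm // ltW.
  have h2 : (1 + w) ^+ n <= 2 ^+ n.
    by rewrite lerXn2r ?nnegrE //; lra.
  have h3 : expR (- w) <= 1 by rewrite expR_le1; lra.
  have h4 : (1 + w `^ d) ^+ 2 <= 4.
    have -> : 4 = 2 ^+ 2 :> R by rewrite expr2; lra.
    have h5 : w `^ d <= 1.
      by have := @ge0_ler_powR R d (ltW d0) w 1; rewrite !nnegrE powR1; apply; rewrite // ltW.
    by apply: lerXn2r; rewrite ?nnegrE; move: wd0 h5; move: (w `^ d) => v; lra.
  apply: (@le_trans _ _ (`|K| * w `^ d * 2 ^+ n * 1 * 4)).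
    have p1 := nrm_ge0 (powmx w A).
    have p2 : 0 <= (1 + w) ^+ n by rewrite exprn_ge0; lra.
    have p3 := expR_ge0 (- w).
    apply: ler_pM (ltW W0) _ h4; first by rewrite !mulr_ge0.
    apply: ler_pM p3 _ h3; first by rewrite mulr_ge0.
    exact: ler_pM h1 h2.
  have -> : `|K| * w `^ d * 2 ^+ n * 1 * 4 = `|K| * 2 ^+ n * 4 * w `^ d by ring.
  by rewrite ler_pM2r // lerDl.
- have h1 : nrm (powmx w A) <= nrm (1 : M) * (1 + w) ^+ L.
    apply: le_trans (nrm_expmx _) _; rewrite ler_wpM2l ?nrm_ge0 // nrmZr.
    rewrite ger0_norm ?ln_ge0 //.
    apply: (@le_trans _ _ (expR (L%:R * ln w))).
      by rewrite ler_expR mulrC ler_wpM2r ?ln_ge0.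
    by rewrite expRM_natl lnK ?posrE // lerXn2r ?nnegrE; lra.
  have h4 : (1 + w `^ d) ^+ 2 <= (1 + w) ^+ 2.
    have h5 : w `^ d <= w by exact: ler1_powR.
    by apply: lerXn2r; rewrite ?nnegrE; move: wd0 h5; move: (w `^ d) => v; lra.
  apply: (@le_trans _ _ (nrm (1 : M) * (1 + w) ^+ L * (1 + w) ^+ n * expR (- w) * (1 + w) ^+ 2)).
    apply: ler_pM (ltW W0) _ h4.
      by rewrite !mulr_ge0 ?nrm_ge0 ?expR_ge0 ?exprn_ge0; lra.
    rewrite ler_wpM2r ?expR_ge0 // ler_wpM2r ?exprn_ge0 //; lra.
  apply: (@le_trans _ _ D).
    have -> : nrm (1 : M) * (1 + w) ^+ L * (1 + w) ^+ n * expR (- w) * (1 + w) ^+ 2 =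
      nrm (1 : M) * ((1 + w) ^+ (L + n.+2) * expR (- w)).
      have -> : (L + n.+2 = L + n + 2)%N by rewrite -addnA addn2.
      by rewrite !exprD; ring.
    by rewrite ler_wpM2l ?nrm_ge0 // hC //; lra.
  have wd1 : 1 <= w `^ d.
    by have := @ge0_ler_powR R d (ltW d0) 1 w; rewrite !nnegrE powR1; apply; rewrite // ltW.
  rewrite mulrDl; apply: ler_wpDl; first by rewrite !mulr_ge0 ?exprn_ge0 // ltW.
  by rewrite ler_peMr.
Qed.

End MatrixPower.

(** * Improper integrals with a dominating primitive *)

Section Improper.
Variables (R : realType) (N : nat).
Local Notation M := 'M[R[i]]_N.

Lemma cvg_at_right_right (f : R -> R) (x : R) : {for x, continuous f} ->
  (forall u, x < u -> f x < f u) -> f @ x^'+ --> (f x)^'+.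
Proof.
move=> cf h P hP; apply: (@filterS _ (nbhs x) _ _ _ _ (cf _ hP)) => u hu xu.
by apply: hu; exact: h.
Qed.

Lemma cvg_at_left_left (f : R -> R) (x : R) : {for x, continuous f} ->
  (forall u, u < x -> f u < f x) -> f @ x^'- --> (f x)^'-.
Proof.
move=> cf h P hP; apply: (@filterS _ (nbhs x) _ _ _ _ (cf _ hP)) => u hu xu.
by apply: hu; exact: h.
Qed.

Lemma cvg_at_left_right (f : R -> R) (x : R) : {for x, continuous f} ->
  (forall u, u < x -> f x < f u) -> f @ x^'- --> (f x)^'+.
Proof.
move=> cf h P hP; apply: (@filterS _ (nbhs x) _ _ _ _ (cf _ hP)) => u hu xu.
by apply: hu; exact: h.
Qed.

Variables (S : set R) (f : R -> M) (g g' : R -> R).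
Hypotheses (oS : open S) (iS : is_interval S) (cf : cont_on S f).
Hypothesis (dg : forall u, S u -> is_derive u 1 g (g' u)).
Hypothesis (fg : forall u, S u -> nrm (f u) <= g' u).
Variables (F G : set_system R).
Context {FF : ProperFilter F} {FG : ProperFilter G}.

Let bound a b : S a -> S b -> a <= b ->
  nrm (integralmx a b f) <= (N * N)%:R * (2 * (g b - g a)).
Proof.
move=> Sa Sb ab.
by apply: (integralmx_le oS iS cf Sa Sb ab) => u uab; [apply: dg|apply: fg]; exact: iS Sa Sb _ uab.
Qed.

Let K : R := (N * N)%:R * 2.
Let kg u := K * g u.

Let boundn a b : S a -> S b -> a <= b -> nrm (integralmx a b f) <= `|kg b - kg a|.
Proof.
move=> Sa Sb ab; apply: le_trans (bound Sa Sb ab) _.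
by rewrite /kg -mulrBr mulrA ler_norm.
Qed.

Lemma improper_left_cvg c : S c -> F [set a | S a /\ a <= c] -> cvg (g @ F) ->
  cvg (integralmx a c f @[a --> F]).
Proof.
move=> Sc Fc gF.
apply: (mx_cvg_dominated (S := [set a | S a /\ a <= c]) (g := kg)) => //; last first.
  exact: is_cvgMr gF.
have key a b : S a /\ a <= c -> S b /\ b <= c -> a <= b ->
    nrm (integralmx a c f - integralmx b c f) <= `|kg a - kg b|.
  move=> [Sa ac] [Sb bc] ab.
  by rewrite (integralmx_split oS iS cf Sa Sc ab bc) addrK distrC boundn.
move=> a b ha hb; case: (leP a b) => [|/ltW] ab; first exact: key.
by rewrite nrmBC distrC; exact: key.
Qed.

Lemma improper_right_cvg c : S c -> G [set b | S b /\ c <= b] -> cvg (g @ G) ->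
  cvg (integralmx c b f @[b --> G]).
Proof.
move=> Sc Gc gG.
apply: (mx_cvg_dominated (S := [set b | S b /\ c <= b]) (g := kg)) => //; last first.
  exact: is_cvgMr gG.
have key a b : S a /\ c <= a -> S b /\ c <= b -> a <= b ->
    nrm (integralmx c a f - integralmx c b f) <= `|kg a - kg b|.
  move=> [Sa ac] [Sb bc] ab.
  by rewrite nrmBC distrC (integralmx_split oS iS cf Sc Sb ac ab) [X in nrm X]addrC addKr boundn.
move=> a b ha hb; case: (leP a b) => [|/ltW] ab; first exact: key.
by rewrite nrmBC distrC; exact: key.
Qed.

(** Splitting at an interior point [c] separates the two endpoints: the increments of each one-sided
    integral are dominated by those of [g], and the sum of the two limits is the limit along the
    product filter. *)
Lemma improper_cvg_dominated c : S c -> F [set a | S a /\ a <= c] ->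
  G [set b | S b /\ c <= b] -> cvg (g @ F) -> cvg (g @ G) -> improper_cvg F G f.
Proof.
move=> Sc Fc Gc gF gG.
have /cvg_ex[/= L1 h1] := improper_left_cvg Sc Fc gF.
have /cvg_ex[/= L2 h2] := improper_right_cvg Sc Gc gG.
apply/cvg_ex; exists (L1 + L2).
have h : integralmx ab.1 c f + integralmx c ab.2 f @[ab --> filter_prod F G] --> L1 + L2.
  exact: cvgD (cvg_comp _ _ cvg_fst h1) (cvg_comp _ _ cvg_snd h2).
apply: cvg_trans h; apply: near_eq_cvg.
exists ([set a | S a /\ a <= c], [set b | S b /\ c <= b]) => // -[a b] /= [[Sa ac] [Sb cb]].
by rewrite (integralmx_split oS iS cf Sa Sb ac cb).
Qed.

End Improper.

(** * Beta integrals *)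

Section Beta.
Variables (R : realType) (N : nat).
Local Notation M := 'M[R[i]]_N.
Variables (Q C : M).
Hypotheses (QC : GRing.comm Q C) (dQ : decay Q) (dC : decay C).

Definition I01 : set R := [set` `]0, 1[].

Lemma I01P v : I01 v <-> 0 < v < 1.
Proof. by rewrite /I01 /= in_itv. Qed.

Lemma I01_open : open I01.
Proof. exact: interval_open. Qed.

Lemma I01_interval : is_interval I01.
Proof. exact: interval_is_interval. Qed.

(** The factor [v ^ m] stays a scalar outside the matrix power, so that the kernel [betaf 0] times
    the [l]-th term of a power series in [v ^ k] is [betaf (k * l)] times a constant matrix. *)
Definition betaf (m : nat) (v : R) : M :=
  (v ^+ m)%:C *: (powmx (1 - v) (C - 1) * powmx v (Q - 1)).

Definition betab (m : nat) (v : R) : M :=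
  (v ^+ m)%:C *: (powmx (1 - v) C * powmx v Q).

Lemma isD_onem_powmx A v : v < 1 ->
  isD (fun u => powmx (1 - u) A) v (- A * powmx (1 - v) (A - 1) : M).
Proof.
move=> v1; have v0 : 0 < 1 - v by rewrite subr_gt0.
apply: isD_eq (isD_comp (is_derive_onem v) (isD_powmx A v0)) _.
by rewrite rmorphN rmorph1 scaleN1r mulNr.
Qed.

Lemma betaf_cont m : cont_on I01 (betaf m).
Proof.
move=> v /I01P /andP[v0 v1].
apply: isD_cvg (isD_scale (is_derive_expn m v) (isD_mul (isD_onem_powmx (C - 1) v1) (isD_powmx (Q - 1) v0))).
Qed.

(* Integrated over (0, 1), this is the recurrence
   beta_m (Q + m) = beta_(m+1) (Q + C + m). *)
Lemma isD_betab m v : 0 < v -> v < 1 ->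
  isD (betab m) v (betaf m v * (Q + m%:R%:M) - betaf m.+1 v * (Q + C + m%:R%:M)).
Proof.
move=> v0 v1.
apply: isD_eq (isD_scale (is_derive_expn m v) (isD_mul (isD_onem_powmx C v1) (isD_powmx Q v0))) _.
have w0 : 0 < 1 - v by rewrite subr_gt0.
have qC : GRing.comm (powmx v (Q - 1)) C.
  exact: powmx_comm (commr_sym (commrB (commr_sym QC) (commr1 C))).
have qQ : GRing.comm (powmx v (Q - 1)) Q.
  exact: powmx_comm (commr_sym (commrB (commr_refl Q) (commr1 Q))).
have pC : GRing.comm (powmx (1 - v) (C - 1)) C.
  exact: powmx_comm (commr_sym (commrB (commr_refl C) (commr1 C))).
rewrite /betaf -(powmxB1 C w0) -(powmxB1 Q v0).
move: (powmx (1 - v) (C - 1)) (powmx v (Q - 1)) qC qQ pC => p q qC qQ pC.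
have h1 : (1 - v)%:C *: p * (v%:C *: q) = ((1 - v) * v)%:C *: (p * q).
  by rewrite scalemxMl scalemxMr scalerA -rmorphM.
have h2 : - C * p * (v%:C *: q) = - (v%:C *: (p * q * C)).
  by rewrite scalemxMr mulNr -pC mulNr -[p * C * q]mulrA -qC mulrA scalerN.
have h3 : (1 - v)%:C *: p * (Q * q) = (1 - v)%:C *: (p * q * Q).
  by rewrite scalemxMl -qQ mulrA.
have h4 X (c : R[i]) : X * c%:M = c *: X by exact: mul_mx_scalar.
rewrite h1 h2 h3 !scalemxMl !mulrDr !h4.
(* At [m = 0] the truncated predecessor is harmless, both sides being 0. *)
have vm : m%:R * v ^+ m.-1 * v = m%:R * v ^+ m.
  by case: m => [|m]; [rewrite !mul0r|rewrite -mulrA -exprSr].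
rewrite scalerA -rmorphM (mulrC (1 - v)) mulrA vm.
move: (p * q * Q) (p * q * C) (p * q) => X Y Z.
apply/matrixP => i j; rewrite !mxE exprS !rmorphM rmorphB rmorph1 !rmorph_nat.
ring.
Qed.

End Beta.

Section BetaLimits.
Variables (R : realType) (N : nat).
Local Notation M := 'M[R[i]]_N.
Variables (Q C : M).
Hypotheses (QC : GRing.comm Q C) (dQ : decay Q) (dC : decay C).

Notation FP := (filter_prod (0 : R)^'+ (1 : R)^'-).

Lemma near_I01 : \forall ab \near FP, [/\ 0 < ab.1, ab.1 <= ab.2 & ab.2 < 1].
Proof.
exists ([set a | 0 < a < 1 / 2], [set b | 1 / 2 < b < 1]) => /=.
- split.
  + near=> a; apply/andP; split; first by near: a; exact: nbhs_right_gt.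
    by near: a; apply: nbhs_right_lt.
  + near=> b; apply/andP; split; last by near: b; exact: nbhs_left_lt.
    by near: b; apply: nbhs_left_gt; lra.
- by move=> [a b] /= [/andP[? ?] /andP[? ?]]; split=> //; lra.
Unshelve. all: by end_near. Qed.

Lemma powR_onem_cvg0 (d : R) : 0 < d -> (1 - v) `^ d @[v --> (1 : R)^'-] --> (0 : R).
Proof.
move=> d0; apply: (@cvg_comp _ _ _ (fun v => 1 - v) (fun y => y `^ d) _ ((0 : R)^'+)).
- have := @cvg_at_left_right R (fun v => 1 - v) 1; rewrite subrr; apply => [|u u1].
    exact: is_derive_continuous (is_derive_onem 1).
  by rewrite subr_gt0.
- exact: powR_cvg0.
Qed.

Lemma betab_bound : exists d1 d2 K : R, [/\ 0 < d1, 0 < d2 & forall v, 0 < v -> v < 1 ->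
  nrm (powmx (1 - v) C * powmx v Q) <= K * ((1 - v) `^ d2 * v `^ d1)].
Proof.
have [d1 [K1 [d10 _ h1]]] := decay_powmx dQ.
have [d2 [K2 [d20 _ h2]]] := decay_powmx dC.
exists d1, d2, (K2 * K1); split => // v v0 v1.
have w0 : 0 < 1 - v by rewrite subr_gt0.
have w1 : 1 - v <= 1 by lra.
apply: le_trans (nrmMr_le (h2 _ w0 w1) (h1 v v0 (ltW v1))) _.
by rewrite mulrACA.
Qed.

Lemma betab_cvg0 m : betab Q C m v @[v --> (0 : R)^'+] --> (0 : M) /\
  betab Q C m v @[v --> (1 : R)^'-] --> (0 : M).
Proof.
have [d1 [d2 [K [d10 d20 h]]]] := betab_bound.
have bound v : 0 < v -> v < 1 -> nrm (betab Q C m v) <= `|K| * ((1 - v) `^ d2 * v `^ d1).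
  move=> v0 v1; rewrite /betab nrmZr.
  apply: (@le_trans _ _ (1 * (`|K| * ((1 - v) `^ d2 * v `^ d1)))); last by rewrite mul1r.
  apply: ler_pM; rewrite ?normr_ge0 ?nrm_ge0 //.
    by rewrite ger0_norm ?exprn_ge0 ?exprn_ile1 // ltW.
  by apply: le_trans (h v v0 v1) _; rewrite ler_wpM2r ?mulr_ge0 ?powR_ge0 ?ler_norm.
have p1 (y d : R) : 0 < d -> 0 < y -> y < 1 -> y `^ d <= 1.
  move=> d0 y0 y1.
  by have := @ge0_ler_powR R d (ltW d0) y 1; rewrite !nnegrE powR1; apply; rewrite // ltW.
split.
- apply: (@cvg_mx_le _ _ _ _ _ _ _ (fun v => `|K| * v `^ d1)); last first.
    by rewrite -[X in _ --> X](mulr0 `|K|); apply: cvgMr; exact: powR_cvg0.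
  near=> v; rewrite subr0.
  have v0 : 0 < v by near: v; exact: nbhs_right_gt.
  have v1 : v < 1 by near: v; apply: nbhs_right_lt.
  apply: le_trans (bound v v0 v1) _; rewrite ler_wpM2l // ler_piMl ?powR_ge0 //.
  by apply: p1 => //; lra.
- apply: (@cvg_mx_le _ _ _ _ _ _ _ (fun v => `|K| * (1 - v) `^ d2)); last first.
    by rewrite -[X in _ --> X](mulr0 `|K|); apply: cvgMr; exact: powR_onem_cvg0.
  near=> v; rewrite subr0.
  have v1 : v < 1 by near: v; exact: nbhs_left_lt.
  have v0 : 0 < v by near: v; apply: nbhs_left_gt.
  apply: le_trans (bound v v0 v1) _; rewrite ler_wpM2l // ler_piMr ?powR_ge0 //.
  exact: p1.
Unshelve. all: by end_near. Qed.

(** The bound on [(1 - v)^C v^Q] is divided by [v (1 - v)]. Since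
    [1 / (v (1 - v)) = 1 / v + 1 / (1 - v)] and both powers are at most 1, the two singularities
    separate into terms with elementary primitives. *)
Lemma betaf_bound m : exists d1 d2 K : R, [/\ 0 < d1, 0 < d2 & forall v, 0 < v -> v < 1 ->
  nrm (betaf Q C m v) <= K * (v `^ (d1 - 1) + (1 - v) `^ (d2 - 1))].
Proof.
have [d1 [d2 [K [d10 d20 h]]]] := betab_bound.
exists d1, d2, `|K|; split => // v v0 v1.
have w0 : 0 < 1 - v by rewrite subr_gt0.
have p1 (y d : R) : 0 < d -> 0 < y -> y < 1 -> y `^ d <= 1.
  move=> d0 y0 y1.
  by have := @ge0_ler_powR R d (ltW d0) y 1; rewrite !nnegrE powR1; apply; rewrite // ltW.
have := h v v0 v1.
rewrite -(powmxB1 C w0) -(powmxB1 Q v0) scalemxMl scalemxMr scalerA -rmorphM nrmZr.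
rewrite (ger0_norm (mulr_ge0 (ltW w0) (ltW v0))) => hK.
rewrite /betaf nrmZr (ger0_norm (exprn_ge0 m (ltW v0))).
set X := nrm _ in hK *.
have X0 : 0 <= X by exact: nrm_ge0.
apply: (@le_trans _ _ X).
  by rewrite ler_piMl // exprn_ile1 //; exact: ltW.
have e1 : (1 - v) `^ d2 = (1 - v) * (1 - v) `^ (d2 - 1) by rewrite mulr_powRB1 // ltW.
have e2 : v `^ d1 = v * v `^ (d1 - 1) by rewrite mulr_powRB1 // ltW.
have q1 := p1 _ _ d20 w0; have q2 := p1 _ _ d10 v0 v1.
have w1 : 1 - v < 1 by lra.
have {q1}q1 := q1 w1.
have a0 := powR_gt0 (d1 - 1) v0; have b0 := powR_gt0 (d2 - 1) w0.
have hK' : (1 - v) * v * X <= `|K| * ((1 - v) `^ d2 * v `^ d1).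
  by apply: le_trans hK _; rewrite ler_wpM2r ?mulr_ge0 ?powR_ge0 ?ler_norm.
rewrite -(ler_pM2l (mulr_gt0 w0 v0)); apply: le_trans hK' _.
rewrite [leRHS]mulrCA ler_wpM2l //.
rewrite mulrDr -mulrA -e2 [(1 - v) * v]mulrC -mulrA -e1.
have z1 : 0 <= v `^ d1 by exact: powR_ge0.
have z2 : 0 <= (1 - v) `^ d2 by exact: powR_ge0.
have z3 : (1 - v) `^ d2 * v `^ d1 <= v `^ d1 by rewrite ler_piMl.
have z4 : (1 - v) `^ d2 * v `^ d1 <= (1 - v) `^ d2 by rewrite ler_piMr.
move: z1 z2 z3 z4; move: (v `^ d1) ((1 - v) `^ d2) => y z; nra.
Qed.

Lemma betaf_improper_cvg m : improper_cvg (0 : R)^'+ (1 : R)^'- (betaf Q C m).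
Proof.
have [d1 [d2 [K [d10 d20 h]]]] := betaf_bound m.
pose g v := K * (v `^ d1 / d1 - (1 - v) `^ d2 / d2).
have half : 0 < (1 / 2 : R) < 1 by lra.
have dg u : I01 u -> is_derive u 1 g (K * (u `^ (d1 - 1) + (1 - u) `^ (d2 - 1))).
  move=> /I01P/andP[u0 u1].
  have w0 : 0 < 1 - u by rewrite subr_gt0.
  have h1 := is_derive1_powR d1 u0.
  have h2 : is_derive u 1 (fun v : R => (1 - v) `^ d2) (d2 * (1 - u) `^ (d2 - 1) * (-1)).
    exact: (@is_derive_compf R (fun y : R => y `^ d2) (fun v => 1 - v) u _ _
      (is_derive1_powR d2 w0) (is_derive_onem u)).
  have h3 := is_derive_mulcf K (is_derive_subf (is_derive_mulcf d1^-1 h1) (is_derive_mulcf d2^-1 h2)).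
  have -> : g = fun v => K * (d1^-1 * v `^ d1 - d2^-1 * (1 - v) `^ d2).
    by apply/funext => v; rewrite /g !(mulrC _^-1).
  by apply: (is_derive_eq h3); field; rewrite !gt_eqF.
apply: (@improper_cvg_dominated _ _ (@I01 R) _ g _ (@I01_open R) (@I01_interval R)
  (@betaf_cont _ _ Q C m) dg _ _ _ _ _ (1 / 2)).
- by move=> u /I01P/andP[u0 u1]; exact: h.
- exact/I01P.
- near=> a; split; last by near: a; apply: nbhs_right_le; lra.
  apply/I01P/andP; split; first by near: a; exact: nbhs_right_gt.
  by near: a; apply: nbhs_right_lt.
- near=> b; split; last by near: b; apply: nbhs_left_ge; lra.
  apply/I01P/andP; split; last by near: b; exact: nbhs_left_lt.
  by near: b; apply: nbhs_left_gt.
- apply: is_cvgMr; apply: is_cvgB; apply: is_cvgMl.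
  + by apply/cvg_ex; exists 0; exact: powR_cvg0.
  + apply/cvg_ex; exists ((1 - 0) `^ d2).
    apply: (@cvg_at_right_filter _ _ (fun v : R => (1 - v) `^ d2)).
    have w0 : 0 < 1 - 0 :> R by rewrite subr0.
    exact: is_derive_continuous (@is_derive_compf R (fun y : R => y `^ d2) (fun v => 1 - v) 0 _ _
      (is_derive1_powR d2 w0) (is_derive_onem 0)).
- apply: is_cvgMr; apply: is_cvgB; apply: is_cvgMl.
  + apply/cvg_ex; exists (1 `^ d1).
    apply: (@cvg_at_left_filter _ _ (fun v : R => v `^ d1)).
    exact: is_derive_continuous (is_derive1_powR d1 ltr01).
  + by apply/cvg_ex; exists 0; exact: powR_onem_cvg0.
Unshelve. all: by end_near. Qed.

Definition beta m : M := improper (0 : R)^'+ (1 : R)^'- (betaf Q C m).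

Lemma cvg_beta m :
  integralmx ab.1 ab.2 (betaf Q C m) @[ab --> FP] --> beta m.
Proof. exact: betaf_improper_cvg. Qed.

(** The boundary terms are kept: they vanish in the limit that gives [beta_rec], and they return as
    the increments of the convergence factors. *)
Lemma betaf_int_rec m a b : 0 < a -> a <= b -> b < 1 ->
  integralmx a b (betaf Q C m) * (Q + m%:R%:M)
  - integralmx a b (betaf Q C m.+1) * (Q + C + m%:R%:M) = betab Q C m b - betab Q C m a.
Proof.
move=> a0 ab b1.
have Ia : I01 a by apply/I01P; rewrite a0 (le_lt_trans ab).
have Ib : I01 b by apply/I01P; rewrite b1 (lt_le_trans a0).
have cf k := @betaf_cont _ _ Q C k.
have oI := @I01_open R; have iI := @I01_interval R.
have cMr k (B : M) : cont_on (@I01 R) (fun u => betaf Q C k u * B).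
  exact: cont_onM (cf k) (@cont_on_cst _ _ _ B).
have e1 := integralmxMr oI iI (Q + m%:R%:M) (cf m) Ia Ib ab.
have e2 := integralmxMr oI iI (Q + C + m%:R%:M) (cf m.+1) Ia Ib ab.
have e3 := integralmxB oI iI (cMr m (Q + m%:R%:M)) (cMr m.+1 (Q + C + m%:R%:M)) Ia Ib ab.
apply: (etrans (f_equal2 (fun X Y => X - Y) (esym e1) (esym e2))).
apply: (etrans (esym e3)).
apply: integralmx_FTC2 => // [u /andP[au ub]|u uab].
  by apply: isD_betab => //; [exact: lt_le_trans au|exact: le_lt_trans b1].
have Iu : I01 u by exact: iI Ia Ib u uab.
exact: cvgB (cMr m (Q + m%:R%:M) u Iu) (cMr m.+1 (Q + C + m%:R%:M) u Iu).
Qed.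

Lemma beta_rec m : beta m * (Q + m%:R%:M) = beta m.+1 * (Q + C + m%:R%:M).
Proof.
apply/eqP; rewrite -subr_eq0; apply/eqP.
pose I k (ab : R * R) := integralmx ab.1 ab.2 (betaf Q C k).
have h1 : I m ab * (Q + m%:R%:M) - I m.+1 ab * (Q + C + m%:R%:M) @[ab --> FP] -->
    beta m * (Q + m%:R%:M) - beta m.+1 * (Q + C + m%:R%:M).
  have FPP : ProperFilter FP by typeclasses eauto.
  have ha := cvg_mxMr (m := Q + m%:R%:M) (@cvg_beta m).
  have hb := cvg_mxMr (m := Q + C + m%:R%:M) (@cvg_beta m.+1).
  exact: cvgB (ha _) (hb _).
have [b0 b1] := betab_cvg0 m.
have h2 : betab Q C m ab.2 - betab Q C m ab.1 @[ab --> FP] --> (0 : M) - 0.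
  exact: cvgB (cvg_comp _ _ cvg_snd b1) (cvg_comp _ _ cvg_fst b0).
rewrite subr0 in h2.
apply: (mx_cvg_unique h1); apply: cvg_trans h2; apply: near_eq_cvg.
apply: filterS near_I01 => -[a b] /= [a0 ab b1'].
by rewrite /I /= betaf_int_rec.
Qed.

End BetaLimits.

(** * The Gauss product and the gamma integral *)

Section SlowSequences.
Variables (R : realType) (N : nat).
Local Notation M := 'M[R[i]]_N.

(** The convergence of an infinite product: summable relative increments bound [nrm (u n)] by the
    exponential of their sum, after which the absolute increments are summable too. *)
Lemma mx_seq_slow_cvg (u : nat -> M) (b : nat -> R) (L : R) :
  (forall n, 0 <= b n) -> series b @ \oo --> L ->
  (forall n, nrm (u n.+1 - u n) <= nrm (u n) * b n) -> cvgn u.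
Proof.
move=> b0 bL ub.
have sb n : series b n <= L.
  rewrite -(cvg_lim _ bL) //; apply: nondecreasing_cvgn_le; last by apply/cvg_ex; exists L.
  by apply/nondecreasing_seqP => k; rewrite -subr_ge0 seriesSB.
have uE n : nrm (u n) <= nrm (u 0%N) * expR (series b n).
  elim: n => [|n IH]; first by rewrite /series /= big_geq // expR0 mulr1.
  have -> : u n.+1 = (u n.+1 - u n) + u n by rewrite subrK.
  apply: le_trans (nrmD _ _) _; apply: (@le_trans _ _ (nrm (u n) * (1 + b n))).
    by rewrite mulrDr mulr1 [leRHS]addrC lerD2r.
  have -> : series b n.+1 = series b n + b n.
    by rewrite -[b n in RHS](seriesSB b n) addrC subrK.
  rewrite expRD mulrA ler_pM ?nrm_ge0 ?addr_ge0 //.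
  exact: expR_ge1Dx.
apply: (@mx_seq_cvg _ _ _ (fun n => nrm (u 0%N) * expR L * b n)) => [n|].
  apply: le_trans (ub n) _; rewrite ler_wpM2r //; apply: le_trans (uE n) _.
  by rewrite ler_wpM2l ?nrm_ge0 // ler_expR.
have -> : (fun n => nrm (u 0%N) * expR L * b n) = (nrm (u 0%N) * expR L) *: b by [].
by rewrite seriesZ; apply: is_cvgZr; apply/cvg_ex; exists L.
Qed.

(** The comparison series is the telescoping one with terms [2 K (1 / (n + 1) - 1 / (n + 2))]. *)
Lemma series_inv_sqr_bound (K : R) : 0 <= K -> exists2 b : nat -> R,
  (forall n, K / n.+1%:R ^+ 2 <= b n) & series b @ \oo --> 2 * K.
Proof.
move=> K0; exists (fun n => 2 * K * (n.+1%:R^-1 - n.+2%:R^-1)).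
- move=> n; have n1 : 0 < n.+1%:R :> R by rewrite ltr0n.
  have n2 : 0 < n.+2%:R :> R by rewrite ltr0n.
  have -> : 2 * K * (n.+1%:R^-1 - n.+2%:R^-1) = K * (2 / (n.+1%:R * n.+2%:R)).
    by rewrite -[n.+2%:R]natr1; field; rewrite !gt_eqF // natr1.
  rewrite ler_wpM2l // -[leLHS]div1r ler_pdivrMr ?exprn_gt0 // mulrAC.
  rewrite ler_pdivlMr ?mulr_gt0 // mul1r expr2 mulrCA ler_pM2l //.
  by rewrite -natrM ler_nat; lia.
- have -> : series (fun n => 2 * K * (n.+1%:R^-1 - n.+2%:R^-1)) =
     fun n => 2 * K * (1 - n.+1%:R^-1).
    apply/funext; elim=> [|n IH]; first by rewrite /series /= big_geq // invr1 subrr mulr0.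
    rewrite -[LHS](subrK (series (fun n => 2 * K * (n.+1%:R^-1 - n.+2%:R^-1)) n)).
    by rewrite seriesSB IH -mulrDr; congr (_ * _); rewrite addrC addrA subrK.
  have h : (1 - n.+1%:R^-1) @[n --> \oo] --> (1 - 0 : R).
    by apply: cvgB (@cvg_harmonic R); exact: cvg_cst.
  by rewrite subr0 in h; rewrite -[X in _ --> X]mulr1; exact: cvgMr h.
Qed.

End SlowSequences.

Section ReciprocalGamma.
Variables (R : realType) (N : nat).
Local Notation M := 'M[R[i]]_N.
Implicit Types A X : M.

Lemma comm_scalar X (c : R[i]) : GRing.comm X c%:M.
Proof. exact: comm_mx_scalar. Qed.

Lemma mulmx_scalarr X (c : R[i]) : X * c%:M = c *: X.
Proof. exact: mul_mx_scalar. Qed.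

Lemma comm_shift X A (c : R[i]) : GRing.comm X A -> GRing.comm X (A + c%:M).
Proof. by move=> h; apply: commrD h (comm_scalar _ _). Qed.

Lemma pochhammerS A l : pochhammer A l.+1 = pochhammer A l * (A + l%:R%:M).
Proof. exact: big_ord_recr. Qed.

Lemma pochhammer0 A : pochhammer A 0 = 1.
Proof. exact: big_ord0. Qed.

Lemma pochhammer_comm X A l : GRing.comm X A -> GRing.comm X (pochhammer A l).
Proof. by move=> h; apply: commr_prod => i _; exact: comm_shift. Qed.

Definition rgamma_seq A (m : nat) : M :=
  (m`!)%:R^-1 *: (pochhammer A m.+1 * powmx m%:R (- A)).

(* At s = ln ((m + 1) / m) this is the ratio of consecutive Gauss approximants;
   it is 1 + O(s^2), which makes the approximants converge. *)
Definition rgamma_ratio A (s : R) : M :=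
  (1 + (1 - expR (- s))%:C *: A) * expmx ((- s)%:C *: A).

Lemma rgamma_ratio_aux (S : pzRingType) (a e : S) (x : S) :
  (x * a) * e + (1 + (1 - x) * a) * (- a * e) = - ((1 - x) * (a + a * a)) * e.
Proof.
rewrite [(1 + _) * _]mulrA -mulrDl; congr (_ * _).
rewrite mulrN mulrBl mul1r [(1 + _) * a]mulrDl mul1r mulrBl [in RHS]mulrBl mul1r mulrDr.
by rewrite opprB [a + (_ - _)]addrA opprB addrA mulrA.
Qed.

Lemma isD_rgamma_ratio A (s : R) : isD (rgamma_ratio A) s
  (- ((1 - expR (- s))%:C *: (A + A * A)) * expmx ((- s)%:C *: A)).
Proof.
have h : is_derive s 1 (fun s => 1 - expR (- s)) (expR (- s)).
  have h1 : is_derive s 1 (fun s : R => expR (- s)) (expR (- s) * - 1).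
    exact: is_derive_compf (is_derive_expR _) (is_deriveNid s (1 : R)).
  have := is_derive_subf (is_derive_cst (1 : R) s (1 : R)) h1.
  by rewrite mulrN1 opprK add0r.
have hA := isD_add (isD_cst (1 : M) s) (isD_scale h (isD_cst A s)).
rewrite scaler0 addr0 add0r in hA.
apply: isD_eq (isD_mul hA (isD_expmxN A s)) _.
have E (X : M) (r : R) : r%:C *: X = r%:C%:M * X by exact/esym/mul_scalar_mx.
rewrite !E rmorphB rmorph1 raddfB /=.
exact: rgamma_ratio_aux.
Qed.

(** The derivative of the ratio carries the factor [1 - e^-s <= s], so the mean value inequality
    against [K1 s^2 / 2] gives a quadratic bound. *)
Lemma rgamma_ratio_bound A : exists2 K : R, 0 <= K & forall s, 0 <= s -> s <= 1 ->
  nrm (rgamma_ratio A s - 1) <= K * s ^+ 2.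
Proof.
pose K1 := nrm (A + A * A) * (nrm (1 : M) * expR (nrm A)).
have K10 : 0 <= K1 by rewrite !mulr_ge0 ?nrm_ge0 ?expR_ge0.
exists ((N * N)%:R * K1); first by rewrite mulr_ge0.
move=> s s0 s1.
have r0 : rgamma_ratio A 0 = 1.
  by rewrite /rgamma_ratio oppr0 expR0 subrr scale0r addr0 mul1r expmx0.
have dg (u : R) : is_derive u 1 (fun v => K1 / 2 * (v * v)) (K1 * u).
  apply: (is_derive_eq (is_derive_mulcf (K1 / 2)
    (is_derive_mulf (is_derive_id u (1 : R)) (is_derive_id u (1 : R))))).
  by rewrite /=; field.
have := @isD_mean _ _ (rgamma_ratio A) _ _ _ 0 s s0
  (fun u _ => isD_rgamma_ratio A u) (fun u _ => dg u).
rewrite r0 !mulr0 subr0 => h; apply: le_trans (h _) _; last first.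
  rewrite le_eqVlt; apply/orP; left; apply/eqP; by field.
move=> u /andP[u0 us].
have e1 : 0 <= 1 - expR (- u) by rewrite subr_ge0 expR_le1 oppr_le0.
have e2 : 1 - expR (- u) <= u by have := expR_ge1Dx (- u); lra.
apply: le_trans (nrmM _ _) _; rewrite nrmN nrmZr ger0_norm // mulrC /K1.
rewrite mulrC [leRHS]mulrAC ler_pM ?mulr_ge0 ?nrm_ge0 //.
  by rewrite mulrC ler_wpM2l ?nrm_ge0.
apply: le_trans (nrm_expmx _) _; rewrite ler_wpM2l ?nrm_ge0 // ler_expR nrmZr normrN.
by rewrite ger0_norm // ler_piMl ?nrm_ge0 //; exact: le_trans us s1.
Qed.

Lemma rgamma_seqS_aux (S : pzRingType) (p a c q : S) : c * a = a * c ->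
  p * a * (c * q) = p * c * (a * q).
Proof. by move=> ca; rewrite !mulrA -[p * a * c]mulrA -ca mulrA. Qed.

Lemma rgamma_seqS A m : (0 < m)%N ->
  rgamma_seq A m.+1 = rgamma_seq A m * rgamma_ratio A (ln (m.+1%:R / m%:R)).
Proof.
move=> m0.
have m0' : 0 < m%:R :> R by rewrite ltr0n.
have m1' : 0 < m.+1%:R :> R by rewrite ltr0n.
have q0 : 0 < m.+1%:R / m%:R :> R by rewrite divr_gt0.
have e1 : powmx m.+1%:R (- A) = powmx m%:R (- A) * powmx (m.+1%:R / m%:R) (- A).
  have e0 : m.+1%:R = m%:R * (m.+1%:R / m%:R) :> R by rewrite mulrC divfK ?gt_eqF.
  by rewrite [in LHS]e0 (powmxMl _ m0' q0).
rewrite /rgamma_seq /rgamma_ratio expRN lnK ?posrE // invf_div.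
have -> : expmx ((- ln (m.+1%:R / m%:R))%:C *: A) = powmx (m.+1%:R / m%:R) (- A).
  by rewrite /powmx rmorphN scaleNr scalerN.
rewrite pochhammerS e1.
have cA : GRing.comm (powmx m%:R (- A)) A.
  exact: powmx_comm (commr_sym (commrN (commr_refl A))).
(* The factor gained by the Pochhammer symbol, divided by the [m + 1] gained by the factorial. *)
have -> : 1 + (1 - m%:R / m.+1%:R)%:C *: A = (m.+1%:R)^-1 *: (A + (m.+1)%:R%:M).
  rewrite scalerDr addrC; congr (_ *: _ + _).
    have -> : 1 - m%:R / m.+1%:R = (m.+1%:R)^-1 :> R.
      have : m.+1%:R != 0 :> R by rewrite gt_eqF.
      by rewrite -[m.+1%:R]natr1 => ?; field.
    by rewrite fmorphV rmorph_nat.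
  rewrite scale_scalar_mx mulVf //; by rewrite pnatr_eq0.
rewrite [X in _ = X]scalemxMl !scalemxMl !scalemxMr scalerA factS natrM invfM; congr (_ *: _).
  by rewrite mulrC.
exact: rgamma_seqS_aux (comm_shift _ cA).
Qed.

Lemma cvg_rgamma A : rgamma_seq A @ \oo --> rgammamx A.
Proof.
suff : cvgn (rgamma_seq A) by [].
have [K K0 hK] := rgamma_ratio_bound A.
have [b hb bL] := series_inv_sqr_bound K0.
(* The recursion divides by [m], so the sequence is followed from [m = 1] on. *)
suff /cvg_ex[/= l hl] : cvgn (fun n => rgamma_seq A n.+1).
  by apply/cvg_ex; exists l; rewrite -(cvg_shiftS (rgamma_seq A)).
have b0 n : 0 <= b n by apply: le_trans (hb n); rewrite divr_ge0 ?exprn_ge0.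
apply: (@mx_seq_slow_cvg _ _ (fun n => rgamma_seq A n.+1) b _ b0 bL) => n.
have -> : rgamma_seq A n.+2 - rgamma_seq A n.+1 =
    rgamma_seq A n.+1 * (rgamma_ratio A (ln (n.+2%:R / n.+1%:R)) - 1).
  by rewrite mulrBr mulr1 (rgamma_seqS A (ltn0Sn n)).
apply: le_trans (nrmM _ _) _; rewrite ler_wpM2l ?nrm_ge0 //.
apply: le_trans (hb n).
have n0 : 0 < n.+1%:R :> R by rewrite ltr0n.
have l1 : ln (n.+2%:R / n.+1%:R) <= n.+1%:R^-1 :> R.
  have -> : n.+2%:R / n.+1%:R = 1 + n.+1%:R^-1 :> R.
    by rewrite -[n.+2%:R]natr1 mulrDl divff ?gt_eqF // mul1r.
  by apply: le_ln1Dx; apply: lt_trans (_ : 0 < _); rewrite ?ltrN10 // invr_gt0.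
have l0 : 0 <= ln (n.+2%:R / n.+1%:R) :> R.
  by apply: ln_ge0; rewrite ler_pdivlMr // mul1r ler_nat.
have l2 : n.+1%:R^-1 <= 1 :> R by rewrite invf_le1 // ler1n.
apply: le_trans (hK _ l0 (le_trans l1 l2)) _; rewrite ler_wpM2l // -exprVn.
by rewrite lerXn2r // nnegrE // invr_ge0 ltW.
Qed.

Lemma rgammamx_comm A X : GRing.comm X A -> GRing.comm (rgammamx A) X.
Proof.
move=> XA; apply: (mx_cvg_comm (cvg_rgamma (A := A))) => m; rewrite /rgamma_seq.
rewrite /GRing.comm scalemxMl scalemxMr; congr (_ *: _); apply: commr_sym.
by apply: commrM; [exact: pochhammer_comm|apply/commr_sym/powmx_comm/commr_sym/commrN].
Qed.

End ReciprocalGamma.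

Section GammaIntegral.
Variables (R : realType) (N : nat).
Local Notation M := 'M[R[i]]_N.
Variable C : M.
Hypothesis dC : decay C.

Definition Ipos : set R := [set` `]0, +oo[].

Lemma IposP (w : R) : Ipos w <-> 0 < w.
Proof. by rewrite /Ipos /= in_itv /= andbT. Qed.

Lemma Ipos_open : open Ipos.
Proof. exact: interval_open. Qed.

Lemma Ipos_interval : is_interval Ipos.
Proof. exact: interval_is_interval. Qed.

Definition gammaf (w : R) : M := (expR (- w))%:C *: powmx w (C - 1).

Lemma gammaf_cont : cont_on Ipos gammaf.
Proof.
move=> w /IposP w0.
have h1 : is_derive w 1 (fun s : R => expR (- s)) (expR (- w) * - 1).
  exact: is_derive_compf (is_derive_expR _) (is_deriveNid w (1 : R)).
exact: isD_cvg (isD_scale h1 (isD_powmx (C - 1) w0)).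
Qed.

(* [Phi_d w = - 1 / (1 + w ^ d)] is the bounded primitive dominating the gamma
   integrand. *)
Definition Phi (d w : R) : R := - (1 + w `^ d)^-1.

Definition dPhi (d w : R) : R := d * w `^ (d - 1) / (1 + w `^ d) ^+ 2.

Lemma is_derive_Phi (d w : R) : 0 < w -> is_derive w 1 (Phi d) (dPhi d w).
Proof.
move=> w0; have wd0 : 0 < w `^ d by rewrite powR_gt0.
have h1 : is_derive w 1 (fun w : R => 1 + w `^ d) (0 + d * w `^ (d - 1)).
  exact: is_derive_addf (is_derive_cst (1 : R) w (1 : R)) (is_derive1_powR d w0).
have n0 : 1 + w `^ d != 0 by rewrite gt_eqF // addr_gt0.
have h2 := is_deriveN (@is_deriveV R (fun w => 1 + w `^ d) w _ 1 n0 h1).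
apply: (is_derive_eq h2); rewrite /dPhi add0r scaleNr opprK.
by rewrite [LHS]mulrC.
Qed.

Lemma Phi_bounds (d w : R) : -1 <= Phi d w <= 0.
Proof.
have h : 1 <= 1 + w `^ d by rewrite lerDl powR_ge0.
rewrite /Phi lerN2 oppr_le0 invr_ge0 invf_le1 ?(le_trans _ h) // ?h //.
exact: lt_le_trans h.
Qed.

Lemma Phi_cvg_right (d : R) : 0 < d -> cvg (Phi d w @[w --> (0 : R)^'+]).
Proof.
move=> d0; apply: is_cvgN; apply: is_cvgV; last first.
  by apply: is_cvgD; [exact: is_cvg_cst|apply/cvg_ex; exists 0; exact: powR_cvg0].
have h : (1 + w `^ d) @[w --> (0 : R)^'+] --> (1 + 0 : R).
  by apply: cvgD (powR_cvg0 d0); exact: cvg_cst.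
by rewrite (cvg_lim _ h) // addr0 oner_eq0.
Qed.

Lemma Phi_cvg_infty (d : R) : 0 < d -> Phi d w @[w --> +oo] --> (0 : R).
Proof.
move=> d0; apply/cvgr0Pnorm_le => e e0.
have ei0 : 0 < e^-1 by rewrite invr_gt0.
near=> w.
have w0 : 0 < w by near: w; exact: nbhs_pinfty_gt.
have we : e^-1 `^ d^-1 <= w by near: w; exact: nbhs_pinfty_ge.
have : e^-1 <= w `^ d.
  have := @ge0_ler_powR R d (ltW d0) (e^-1 `^ d^-1) w.
  rewrite !nnegrE => /(_ (powR_ge0 _ _) (ltW w0) we).
  by rewrite -powRrM mulVf ?gt_eqF // powRr1 // ltW.
have wd0 : 0 < w `^ d by rewrite powR_gt0.
have q : 0 < (1 + w `^ d)^-1 by rewrite invr_gt0 addr_gt0.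
move=> h; rewrite normrN (gtr0_norm q).
rewrite -[leRHS]invrK lef_pV2 ?posrE ?addr_gt0 //; apply: le_trans h _; lra.
Unshelve. all: by end_near. Qed.

(** This is [decay_bound] divided by [w], which turns the majorant into an exact derivative. *)
Lemma gammaf_bound (n : nat) : exists d K : R, [/\ 0 < d, 0 <= K & forall w, 0 < w ->
  nrm (gammaf w) * (1 + w) ^+ n <= K * dPhi d w].
Proof.
have [d [K [d0 d1 h]]] := decay_bound n dC.
exists d, (`|K| / d); split; [exact: d0|by rewrite divr_ge0 // ltW|move=> w w0].
have := h w w0; rewrite -(powmxB1 C w0) nrmZr gtr0_norm //.
have wd : w `^ d = w * w `^ (d - 1) by rewrite mulr_powRB1 // ltW.
rewrite /gammaf nrmZr gtr0_norm ?expR_gt0 // => {}h.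
rewrite -(ler_pM2l w0).
have -> : w * (expR (- w) * nrm (powmx w (C - 1)) * (1 + w) ^+ n) =
   w * nrm (powmx w (C - 1)) * (1 + w) ^+ n * expR (- w) by ring.
apply: le_trans h _; rewrite /dPhi.
have -> : w * (`|K| / d * (d * w `^ (d - 1) / (1 + w `^ d) ^+ 2)) =
  `|K| * (w `^ d / (1 + w `^ d) ^+ 2).
  have n1 : 1 + w * w `^ (d - 1) != 0.
    by rewrite gt_eqF // ltr_pwDl // mulr_ge0 ?powR_ge0 // ltW.
  have n2 : d != 0 by rewrite gt_eqF.
  by rewrite wd; field; rewrite n1 n2.
by rewrite ler_wpM2r ?ler_norm // divr_ge0 ?powR_ge0 // exprn_ge0 // addr_ge0 ?powR_ge0.
Qed.

Lemma gammaf_improper_cvg : improper_cvg (0 : R)^'+ (pinfty_nbhs R) gammaf.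
Proof.
have [d [K [d0 K0 h]]] := gammaf_bound 0.
apply: (@improper_cvg_dominated _ _ Ipos gammaf (fun w => K * Phi d w)
  (fun w => K * dPhi d w) Ipos_open Ipos_interval gammaf_cont _ _ _ _ _ _ 1).
- by move=> u /IposP u0; exact: is_derive_mulcf (is_derive_Phi d u0).
- by move=> u /IposP u0; have := h u u0; rewrite expr0 mulr1.
- exact/IposP.
- near=> a; split; last by near: a; apply: nbhs_right_le.
  by apply/IposP; near: a; exact: nbhs_right_gt.
- near=> b; have b1 : 1 <= b by near: b; exact: nbhs_pinfty_ge.
  by split => //; apply/IposP; exact: lt_le_trans b1.
- by apply: is_cvgMr; exact: Phi_cvg_right.
- by apply: is_cvgMr; apply/cvg_ex; exists 0; exact: Phi_cvg_infty.
Unshelve. all: by end_near. Qed.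

Lemma cvg_gammamx : integralmx ab.1 ab.2 gammaf
  @[ab --> filter_prod (0 : R)^'+ (pinfty_nbhs R)] --> gammamx C.
Proof. exact: gammaf_improper_cvg. Qed.

End GammaIntegral.

(** * Comparison of rescaled beta integrals with the gamma integral *)

Section BetaGamma.
Variables (R : realType) (N : nat).
Local Notation M := 'M[R[i]]_N.
Variables (Q C : M).
Hypotheses (dQ : decay Q) (dC : decay C).

(** A quantitative form of [(1 - w / m)^m -> e^-w]. The lower bound combines Bernoulli's inequality
    for [(1 - y^2)^m] with [1 - y^2 = (1 + y) (1 - y) <= e^y (1 - y)]. *)
Lemma onem_exp_bounds (y : R) (m : nat) : 0 <= y -> y <= 1 ->
  expR (- (m%:R * y)) * (1 - m%:R * y ^+ 2) <= (1 - y) ^+ m /\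
  (1 - y) ^+ m <= expR (- (m%:R * y)).
Proof.
move=> y0 y1.
have e1 : expR (- (m%:R * y)) = expR (- y) ^+ m by rewrite -expRM_natl mulrN.
have y1' : 0 <= 1 - y by rewrite subr_ge0.
split; last first.
  by rewrite e1 lerXn2r ?nnegrE ?expR_ge0 //; exact: expR_ge1Dx.
have bern : 1 - m%:R * y ^+ 2 <= (1 - y ^+ 2) ^+ m.
  elim: m {e1} => [|m IH]; first by rewrite mul0r subr0 expr0.
  have z0 : 0 <= y ^+ 2 by rewrite sqr_ge0.
  have z1 : y ^+ 2 <= 1 by rewrite exprn_ile1.
  have m0 : 0 <= m%:R :> R by rewrite ler0n.
  rewrite [leRHS]exprS -natr1; apply: (@le_trans _ _ ((1 - y ^+ 2) * (1 - m%:R * y ^+ 2))).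
    move: z0 z1 m0; move: (y ^+ 2) (m%:R : R) => a b a0 a1 b0.
    have -> : (1 - a) * (1 - b * a) = 1 - (b + 1) * a + b * a ^+ 2 by ring.
    by rewrite lerDl mulr_ge0 ?sqr_ge0.
  by rewrite ler_wpM2l // subr_ge0.
apply: (@le_trans _ _ (expR (- y) ^+ m * (1 - y ^+ 2) ^+ m)).
  by rewrite e1 ler_wpM2l // exprn_ge0 // expR_ge0.
rewrite -exprMn lerXn2r ?nnegrE //.
  by rewrite mulr_ge0 ?expR_ge0 // subr_ge0 exprn_ile1.
have -> : 1 - y ^+ 2 = (1 + y) * (1 - y) by ring.
rewrite mulrA ler_piMl //.
apply: (@le_trans _ _ (expR (- y) * expR y)); last by rewrite -expRD addNr expR0.
by rewrite ler_pM2l ?expR_gt0 // expR_ge1Dx.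
Qed.

Lemma powmx_bounded : exists2 K : R, 0 <= K &
  forall v, 0 < v -> v <= 1 -> nrm (powmx v Q) <= K.
Proof.
have [d [K [d0 d1 h]]] := decay_powmx dQ.
exists `|K| => // v v0 v1; apply: le_trans (h v v0 v1) _.
have p1 : v `^ d <= 1.
  by have := @ge0_ler_powR R d (ltW d0) v 1; rewrite !nnegrE powR1; apply; rewrite // ltW.
apply: (@le_trans _ _ (`|K| * v `^ d)); first by rewrite ler_wpM2r ?powR_ge0 ?ler_norm.
by rewrite ler_piMr.
Qed.

Lemma powmx_onem_lip : exists2 K : R, 0 <= K & forall y, 0 < y -> y < 1 ->
  nrm (powmx (1 - y) Q - 1) <= K * y.
Proof.
have [K K0 hK] := powmx_bounded.
pose K1 := (N * N)%:R * (2 * (2 * (nrm Q * K))).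
pose K2 := 2 * (K + nrm (1 : M)).
have K10 : 0 <= K1 by rewrite !mulr_ge0 ?nrm_ge0.
have K20 : 0 <= K2 by rewrite !mulr_ge0 ?addr_ge0 ?nrm_ge0.
exists (K1 + K2) => [|y y0 y1]; first exact: addr_ge0.
have v0 : 0 < 1 - y by rewrite subr_gt0.
have [yh|yh] := leP y (1 / 2).
- rewrite mulrDl; apply: ler_wpDr; first by rewrite mulr_ge0 // ltW.
  have := @isD_lip _ _ (fun v => powmx v Q) (fun v => Q * powmx v (Q - 1))
    (2 * (nrm Q * K)) (1 - y) 1; rewrite powmx1 nrmBC /K1 => h.
  apply: le_trans (h _ _ _) _.
  + by lra.
  + by move=> u /andP[u0 u1]; apply: isD_powmx; exact: lt_le_trans u0.
  + move=> u /andP[u0 u1].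
    have u00 : 0 < u by exact: lt_le_trans u0.
    have uh : 1 / 2 <= u by lra.
    apply: le_trans (nrmM _ _) _; rewrite mulrCA ler_wpM2l ?nrm_ge0 //.
    have := hK u u00 u1; rewrite -(powmxB1 Q u00) nrmZr gtr0_norm // => h2.
    have := nrm_ge0 (powmx u (Q - 1)); move: h2 uh; move: (nrm _) => X; nra.
  + rewrite le_eqVlt; apply/orP; left; apply/eqP; by ring.
- rewrite mulrDl; apply: ler_wpDl; first by rewrite mulr_ge0 // ltW.
  apply: le_trans (nrmB _ _) _; apply: (@le_trans _ _ (K + nrm (1 : M))).
    by rewrite lerD2r hK //; lra.
  have := nrm_ge0 (1 : M); rewrite /K2; move: (nrm _) => X X0; nra.
Qed.

End BetaGamma.

Section BetaGammaLimit.
Variables (R : realType) (N : nat).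
Local Notation M := 'M[R[i]]_N.
Variables (Q C : M).
Hypotheses (QC : GRing.comm Q C) (dQ : decay Q) (dC : decay C).

Notation FP := (filter_prod (0 : R)^'+ (1 : R)^'-).

(** The index [m.+1] makes the power of [v] equal to [v^m v^Q]: with [w = m - m v], the factor [v^m]
    is to be compared with [e^-w] and [v^Q] with the identity. *)
Lemma betaf_gammaf_diffE (m : nat) (v : R) : (0 < m)%N -> 0 < v -> v < 1 ->
  betaf Q C m.+1 v * powmx m%:R C - m%:R%:C *: gammaf C (m%:R - m%:R * v) =
  m%:R%:C *: (powmx (m%:R - m%:R * v) (C - 1) *
    ((v ^+ m)%:C *: powmx v Q - (expR (- (m%:R - m%:R * v)))%:C *: (1 : M))).
Proof.
move=> m0 v0 v1.
have m0' : 0 < m%:R :> R by rewrite ltr0n.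
have w0 : 0 < 1 - v by rewrite subr_gt0.
have -> : m%:R - m%:R * v = (1 - v) * m%:R by ring.
rewrite (powmxMl _ w0 m0') /gammaf (powmxMl _ w0 m0') /betaf.
rewrite -(powmxB1 Q v0) -{1}(powmxB1 C m0').
have h : GRing.comm (powmx v (Q - 1)) (powmx m%:R (C - 1)).
  apply: powmx_comm2; apply: commrB (commr1 _).
  exact: commr_sym (commrB (commr_sym QC) (commr1 C)).
move: (powmx v (Q - 1)) (powmx m%:R (C - 1)) (powmx (1 - v) (C - 1)) h => q p c h.
rewrite [(v ^+ m)%:C *: _]scalerA -rmorphM -exprSr !scalemxMl !scalemxMr scalerA.
rewrite [RHS](_ : _ = m%:R%:C *: (c * p * ((v ^+ m.+1)%:C *: q)) -
    m%:R%:C *: (c * p * ((expR (- ((1 - v) * m%:R)))%:C *: (1 : M)))); last first.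
  by rewrite mulrBr scalerBr.
rewrite !scalemxMr mulr1 !scalerA; congr (_ *: _ - _ *: _).
  by rewrite mulrC.
by rewrite -mulrA h mulrA.
Qed.

(** The error of [v^m v^Q] against [e^-w] is at most [e^-w] times a multiple of [w (1 + w) / m]. The
    division by [m] cancels the Jacobian [m], and the weight [(1 + w)^2] in [gammaf_bound] absorbs
    the polynomial. *)
Lemma betaf_gammaf_bound : exists d K : R, [/\ 0 < d, 0 <= K &
  forall (m : nat) (v : R), (0 < m)%N -> 0 < v -> v < 1 ->
  nrm (betaf Q C m.+1 v * powmx m%:R C - m%:R%:C *: gammaf C (m%:R - m%:R * v))
    <= K * dPhi d (m%:R - m%:R * v)].
Proof.
have [d [K [d0 K0 hK]]] := gammaf_bound dC 2.
have [L L0 hL] := powmx_onem_lip dQ.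
pose K' := L + nrm (1 : M).
have K'0 : 0 <= K' by rewrite addr_ge0 ?nrm_ge0.
exists d, (K' * K); split => //; first exact: mulr_ge0.
move=> m v m0 v0 v1; rewrite betaf_gammaf_diffE //.
have m0' : 0 < m%:R :> R by rewrite ltr0n.
have y0 : 0 < 1 - v by rewrite subr_gt0.
have y1 : 1 - v < 1 by lra.
set w := m%:R - m%:R * v; have wE : w = m%:R * (1 - v) by rewrite /w; ring.
have w0 : 0 < w by rewrite wE mulr_gt0.
have [b1 b2] := onem_exp_bounds m (ltW y0) (ltW y1).
have vE : 1 - (1 - v) = v by ring.
rewrite vE -wE in b1 b2.
have lip := hL _ y0 y1; rewrite vE in lip.
have D : nrm ((v ^+ m)%:C *: powmx v Q - (expR (- w))%:C *: (1 : M)) <=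
    expR (- w) * (K' * (w * (1 + w) / m%:R)).
  have -> : (v ^+ m)%:C *: powmx v Q - (expR (- w))%:C *: (1 : M) =
      (v ^+ m)%:C *: (powmx v Q - 1) + (v ^+ m - expR (- w))%:C *: (1 : M).
    by rewrite rmorphB scalerBl scalerBr addrA subrK.
  apply: le_trans (nrmD _ _) _; rewrite !nrmZr.
  have vm0 : 0 <= v ^+ m by rewrite exprn_ge0 // ltW.
  rewrite (ger0_norm vm0).
  have h1 : v ^+ m * nrm (powmx v Q - 1) <= expR (- w) * (L * (1 - v)).
    by apply: ler_pM => //; exact: nrm_ge0.
  have h2 : `|v ^+ m - expR (- w)| <= expR (- w) * (m%:R * (1 - v) ^+ 2).
    rewrite ler0_norm ?subr_le0 // opprB.
    by move: b1; rewrite mulrBr mulr1; lra.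
  have h3 : `|v ^+ m - expR (- w)| * nrm (1 : M) <=
      expR (- w) * (m%:R * (1 - v) ^+ 2) * nrm (1 : M).
    by rewrite ler_wpM2r ?nrm_ge0.
  apply: le_trans (lerD h1 h3) _.
  rewrite -mulrA -mulrDr ler_wpM2l ?expR_ge0 // /K' wE.
  have -> : m%:R * (1 - v) * (1 + m%:R * (1 - v)) / m%:R = (1 - v) * (1 + m%:R * (1 - v)).
    by field; rewrite gt_eqF.
  have n1 := nrm_ge0 (1 : M); move: (nrm 1) n1 => n n0.
  have yy : 0 <= m%:R * (1 - v) ^+ 2 by rewrite mulr_ge0 ?sqr_ge0 // ltW.
  have p1 := mulr_ge0 L0 yy; have p2 := mulr_ge0 n0 (ltW y0).
  have -> : (L + n) * ((1 - v) * (1 + m%:R * (1 - v))) =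
    L * (1 - v) + m%:R * (1 - v) ^+ 2 * n + (L * (m%:R * (1 - v) ^+ 2) + n * (1 - v)) by ring.
  by rewrite lerDl addr_ge0.
rewrite nrmZr gtr0_norm //.
apply: (@le_trans _ _ (m%:R * (nrm (powmx w (C - 1)) * (expR (- w) * (K' * (w * (1 + w) / m%:R)))))).
  rewrite ler_pM2l //; apply: le_trans (nrmM _ _) _.
  by rewrite ler_wpM2l ?nrm_ge0.
have -> : m%:R * (nrm (powmx w (C - 1)) * (expR (- w) * (K' * (w * (1 + w) / m%:R)))) =
  K' * (expR (- w) * nrm (powmx w (C - 1)) * (w * (1 + w))).
  by field; rewrite gt_eqF.
rewrite -[leRHS]mulrA ler_wpM2l //; apply: le_trans (hK w w0).
rewrite /gammaf nrmZr gtr0_norm ?expR_gt0 // ler_wpM2l ?mulr_ge0 ?expR_ge0 ?nrm_ge0 //.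
by rewrite expr2 ler_pM2r ?lerDr //; lra.
Qed.

Lemma gammaf_affine_cont (m : nat) : (0 < m)%N ->
  cont_on (@I01 R) (fun v => gammaf C (m%:R - m%:R * v)).
Proof.
move=> m0 v /I01P/andP[v0 v1].
have m0' : 0 < m%:R :> R by rewrite ltr0n.
have h : is_derive v 1 (fun v : R => m%:R - m%:R * v) (- m%:R).
  by apply: is_derive_ext (is_derive_affine (- m%:R) m%:R v) => u; rewrite mulNr addrC.
apply: (@cvg_comp _ _ _ (fun v => m%:R - m%:R * v) (gammaf C) _ (nbhs (m%:R - m%:R * v))).
  exact: is_derive_continuous h.
apply: gammaf_cont; apply/IposP.
by rewrite subr_gt0 gtr_pMr.
Qed.

(** In the variable [v] the majorant has primitive [- (K / m) Phi (m - m v)], and [Phi] takes values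
    in [-1, 0]; hence a bound [K / m] that does not depend on [a] and [b]. *)
Lemma beta_gamma_int : exists2 K : R, 0 <= K & forall (m : nat) (a b : R),
  (0 < m)%N -> 0 < a -> a <= b -> b < 1 ->
  nrm (integralmx a b (betaf Q C m.+1) * powmx m%:R C
       - integralmx (m%:R - m%:R * b) (m%:R - m%:R * a) (gammaf C)) <= K / m%:R.
Proof.
have [d [K [d0 K0 hK]]] := betaf_gammaf_bound.
exists ((N * N)%:R * (2 * K)); first by rewrite !mulr_ge0.
move=> m a b m0 a0 ab b1.
have m0' : 0 < m%:R :> R by rewrite ltr0n.
have Ia : I01 a by apply/I01P; rewrite a0 (le_lt_trans ab).
have Ib : I01 b by apply/I01P; rewrite b1 (lt_le_trans a0).
have a1 : a < 1 by exact: le_lt_trans ab b1.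
have cf k := @betaf_cont _ _ Q C k.
have cg := gammaf_affine_cont m0.
have oI := @I01_open R; have iI := @I01_interval R.
have e1 := integralmxMr oI iI (powmx m%:R C) (cf m.+1) Ia Ib ab.
have cmg : cont_on (@I01 R) (fun v => m%:R%:C%:M * gammaf C (m%:R - m%:R * v)).
  exact: cont_onM (@cont_on_cst _ _ _ _) cg.
have e2 := integralmxMl oI iI (m%:R%:C%:M) cg Ia Ib ab.
have cfm : cont_on (@I01 R) (fun v => betaf Q C m.+1 v * powmx m%:R C).
  exact: cont_onM (cf m.+1) (@cont_on_cst _ _ _ _).
have e3 := integralmxB oI iI cfm cmg Ia Ib ab.
have Pa : Ipos (m%:R - m%:R * a) by apply/IposP; rewrite subr_gt0 gtr_pMr.
have Pb : Ipos (m%:R - m%:R * b) by apply/IposP; rewrite subr_gt0 gtr_pMr.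
have e4 := integralmx_affineN (@Ipos_open R) (@Ipos_interval R) m0' (@gammaf_cont _ _ C) Pa Pb ab.
rewrite -e4 -[m%:R%:C *: _]mul_scalar_mx.
have -> : integralmx a b (betaf Q C m.+1) * powmx m%:R C -
   m%:R%:C%:M *m integralmx a b (fun v => gammaf C (m%:R - m%:R * v)) =
   integralmx a b (fun v => betaf Q C m.+1 v * powmx m%:R C
     - m%:R%:C%:M * gammaf C (m%:R - m%:R * v)).
  by rewrite e3 e1 e2.
have dg (v : R) : a <= v <= b ->
    is_derive v 1 (fun v => - (K / m%:R) * Phi d (m%:R - m%:R * v)) (K * dPhi d (m%:R - m%:R * v)).
  move=> /andP[av vb].
  have h : is_derive v 1 (fun v : R => m%:R - m%:R * v) (- m%:R).
    by apply: is_derive_ext (is_derive_affine (- m%:R) m%:R v) => u; rewrite mulNr addrC.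
  have w0 : 0 < m%:R - m%:R * v by rewrite subr_gt0 gtr_pMr // (le_lt_trans vb).
  apply: (is_derive_eq (is_derive_mulcf (- (K / m%:R))
    (@is_derive_compf R (Phi d) (fun v => m%:R - m%:R * v) v _ _ (is_derive_Phi d w0) h))).
  by field; rewrite gt_eqF.
apply: le_trans (integralmx_le oI iI (cont_onB cfm cmg) Ia Ib ab dg _) _.
  move=> u /andP[au ub]; rewrite [_%:M * _]mul_scalar_mx.
  by apply: hK => //; [exact: lt_le_trans au|exact: le_lt_trans b1].
have /andP[p1 p2] := Phi_bounds d (m%:R - m%:R * b).
have /andP[p3 p4] := Phi_bounds d (m%:R - m%:R * a).
rewrite -!mulrA ler_wpM2l // ler_wpM2l //.
have Km : 0 <= K / m%:R by rewrite divr_ge0 // ltW.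
move: p1 p2 p3 p4 Km; move: (Phi _ _) (Phi _ _) (K / m%:R) => x y k; nra.
Qed.

(** A diagonal choice of endpoints. For each [m] take [(a, b)] so close to (0, 1) that the truncated
    beta integral, times [m^C], is within [1 / (m + 1)] of its limit. With [1 - b <= 1 / (m + 1)^2]
    and [a <= 1 / 2], the images [m (1 - b)] and [m (1 - a)] tend to 0 and to infinity, so the
    truncated gamma integrals converge. *)
Lemma beta_gamma : beta Q C m.+1 * powmx m%:R C @[m --> \oo] --> gammamx C.
Proof.
have [K K0 hK] := beta_gamma_int.
pose e (m : nat) : R := m.+1%:R^-1.
have e0 m : 0 < e m by rewrite invr_gt0.
have near_ab m : \forall ab \near FP, [/\ 0 < ab.1, ab.1 <= ab.2, ab.2 < 1 &
    [/\ ab.1 <= 1 / 2, 1 - e m ^+ 2 <= ab.2 &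
     nrm (integralmx ab.1 ab.2 (betaf Q C m.+1) * powmx m%:R C
          - beta Q C m.+1 * powmx m%:R C) <= e m]].
  have h1 : \forall ab \near FP, ab.1 <= 1 / 2 /\ 1 - e m ^+ 2 <= ab.2.
    exists ([set a | a <= 1 / 2], [set b | 1 - e m ^+ 2 <= b]) => /=.
      split; first by apply: nbhs_right_le.
      by apply: nbhs_left_ge; rewrite ltrBlDr ltrDl exprn_gt0.
    by move=> [a b].
  have FPP : ProperFilter FP by typeclasses eauto.
  have h2 := cvg_mxMr (m := powmx m%:R C) (@cvg_beta _ _ Q C dQ dC m.+1).
  have {h2}/cvg_nrmP/cvgr0Pnorm_le/(_ _ (e0 m)) h2 := h2 FPP.
  apply: filterS3 (@near_I01 R) h1 h2 => -[a b] [a0 ab b1] [ah bh].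
  by rewrite ger0_norm ?nrm_ge0 // => h; split.
have FPP : ProperFilter FP by typeclasses eauto.
have [ab abP] := choice (fun m => @filter_ex _ FP FPP _ (near_ab m)).
pose c (m : nat) := (m%:R - m%:R * (ab m).2, m%:R - m%:R * (ab m).1).
have c_cvg : c @ \oo --> filter_prod (0 : R)^'+ (pinfty_nbhs R).
  have c1 : (c m).1 @[m --> \oo] --> (0 : R).
    apply: (@squeeze_cvgr _ _ _ _ (fun=> 0) e); [|exact: cvg_cst|exact: cvg_harmonic].
    near=> m; have [a0 aleb b1 [_ hb _]] := abP m.
    have m0 : 0 <= m%:R :> R by rewrite ler0n.
    rewrite /c /= subr_ge0 ler_piMr ?(ltW b1) //=.
    have me : m%:R * e m <= 1 by rewrite ler_pdivrMr // mul1r ler_nat.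
    apply: (@le_trans _ _ (m%:R * e m * e m)); last by rewrite ler_piMl // ltW.
    rewrite -mulrA -expr2 -{1}[m%:R]mulr1 -mulrBr ler_wpM2l //; lra.
  have c2 : (c m).2 @[m --> \oo] --> +oo.
    apply/cvgryPge => A; near=> m; have [a0 aleb b1 [ha _ _]] := abP m.
    have mA : 2 * A <= m%:R by near: m; exact: nbhs_infty_ger.
    have m0 : 0 <= m%:R :> R by rewrite ler0n.
    rewrite /c /=; apply: (@le_trans _ _ (m%:R - m%:R * (1 / 2))); first by lra.
    by rewrite lerD2l lerN2 ler_wpM2l.
  move=> P [[A B] /= [hA hB] AB].
  have cA := c1 _ hA; have cB := c2 _ hB.
  suff : \forall m \near \oo, P (c m) by [].
  near=> m; apply: AB => /=; split.
  - have : 0 < (c m).1 -> A (c m).1 by near: m; exact: cA.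
    apply; rewrite /c /= subr_gt0 gtr_pMr; first by have [] := abP m.
    by rewrite ltr0n; near: m; exact: nbhs_infty_gt.
  - by near: m; exact: cB.
have h3 := cvg_comp _ _ c_cvg (cvg_gammamx dC).
move/cvg_nrmP: h3 => h3.
apply: (@cvg_mx_le _ _ _ _ _ _ _ (fun m => e m + K * 2 * e m +
   nrm (integralmx (c m).1 (c m).2 (gammaf C) - gammamx C))); last first.
  have ee : e @ \oo --> (0 : R) by exact: cvg_harmonic.
  have h := cvgD (cvgD ee (cvgMr (a := K * 2) ee)) h3.
  by rewrite mulr0 !addr0 in h; exact: h.
near=> m.
have m0 : (0 < m)%N by near: m; exact: nbhs_infty_gt.
have [a0 aleb b1 [_ _ hab]] := abP m.
have hi := hK m _ _ m0 a0 aleb b1.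
rewrite nrmBC in hab.
have Ke : K / m%:R <= K * 2 * e m.
  rewrite -mulrA ler_wpM2l // /e -[leLHS]div1r ler_pdivrMr ?ltr0n // mulrAC.
  by rewrite ler_pdivlMr ?ltr0n // mul1r -natrM ler_nat; lia.
move: hab (le_trans hi Ke); rewrite /c /=.
move: (integralmx _ _ (gammaf C)) (integralmx _ _ _ * _) (beta _ _ _ * _) => X Y Z h1 h2.
have -> : Z - gammamx C = (Z - Y) + (Y - X) + (X - gammamx C).
  by rewrite (addrA (Z - Y)) subrK addrA subrK.
by apply: le_trans (nrmD _ _) _; rewrite lerD2r; apply: le_trans (nrmD _ _) (lerD h1 h2).
Unshelve. all: by end_near. Qed.

End BetaGammaLimit.

(** * Beta and gamma *)

Section BetaIdentities.
Variables (R : realType) (N : nat).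
Local Notation M := 'M[R[i]]_N.
Implicit Types (Q C A X : M).

Notation FP := (filter_prod (0 : R)^'+ (1 : R)^'-).

Lemma comm_inv (S : pzRingType) (x y z : S) : GRing.comm x y -> y * z = 1 -> z * y = 1 ->
  GRing.comm x z.
Proof.
move=> xy yz zy; rewrite /GRing.comm.
by rewrite -[x * z]mul1r -zy -!mulrA [y * (x * z)]mulrA -xy -mulrA yz mulr1.
Qed.

Lemma comm_poch_shift Q X (m : nat) (c : R[i]) : GRing.comm X Q ->
  GRing.comm (X + c%:M) (pochhammer Q m).
Proof.
move=> XQ; apply: pochhammer_comm; apply/commr_sym/comm_shift; exact: commr_sym.
Qed.

Lemma beta_poch_aux (S : pzRingType) (b0 b1 b2 p p' q r : S) :
  b0 * p = b1 * p' -> b1 * q = b2 * r -> p' * q = q * p' -> p' * r = r * p' ->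
  b0 * (p * q) = b2 * (p' * r).
Proof. by move=> h1 h2 h3 h4; rewrite mulrA h1 h4 -mulrA h3 mulrA h2 mulrA. Qed.

Lemma beta_poch Q C m : GRing.comm Q C -> decay Q -> decay C ->
  beta Q C 0 * pochhammer Q m = beta Q C m * pochhammer (Q + C) m.
Proof.
move=> QC dQ dC; elim: m => [|m IH]; first by rewrite !pochhammer0.
rewrite !pochhammerS; apply: beta_poch_aux IH (beta_rec QC dQ dC m) _ _.
- by apply/commr_sym/comm_poch_shift; apply: commrD (commr_refl _) QC.
- by apply/commr_sym/comm_poch_shift.
Qed.

Lemma rgamma_seq_aux (S : pzRingType) (b0 b1 p p' tQ tC tC' : S) :
  b0 * p = b1 * p' -> tC * p' = p' * tC -> tC * tQ = tQ * tC -> tC * tC' = 1 ->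
  b0 * (p * tQ) = b1 * tC * (p' * (tQ * tC')).
Proof.
move=> h1 h2 h3 h4.
by rewrite mulrA h1 -[RHS]mulrA [tC * _]mulrA h2 -!mulrA [tC * (tQ * _)]mulrA h3 -mulrA h4 mulr1.
Qed.

(** The Gauss approximant has [m.+1] Pochhammer factors, whence [beta_poch] at [m.+1]; the leftover
    power [m^C] is the one that [beta_gamma] asks for. *)
Lemma beta_rgamma_seq Q C m : GRing.comm Q C -> decay Q -> decay C ->
  beta Q C 0 * rgamma_seq Q m = beta Q C m.+1 * powmx m%:R C * rgamma_seq (Q + C) m.
Proof.
move=> QC dQ dC; rewrite /rgamma_seq.
apply: (etrans (scalemxMr _ _ _)); apply: (etrans _ (esym (scalemxMr _ _ _))).
apply: (congr1 (fun X => (m`!)%:R^-1 *: X)).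
have CQC : GRing.comm C (Q + C) := commrD (commr_sym QC) (commr_refl C).
have NQC : GRing.comm (- Q) (- C) := commrN (commr_sym (commrN (commr_sym QC))).
have -> : powmx m%:R (- (Q + C)) = powmx m%:R (- Q) * powmx m%:R (- C) :> M.
  by rewrite opprD; exact: powmxD.
apply: rgamma_seq_aux (beta_poch m.+1 QC dQ dC) _ _ (powmxN _ _).
- by apply: pochhammer_comm; exact: powmx_comm.
- by apply: powmx_comm2; apply/commrN/commr_sym.
Qed.

Lemma beta_rgamma Q C : GRing.comm Q C -> decay Q -> decay C ->
  beta Q C 0 * rgammamx Q = gammamx C * rgammamx (Q + C).
Proof.
move=> QC dQ dC.
have h1 : beta Q C 0 * rgamma_seq Q m @[m --> \oo] --> beta Q C 0 * rgammamx Q.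
  exact: cvg_mxMl (@cvg_rgamma _ _ Q).
have h2 : beta Q C m.+1 * powmx m%:R C * rgamma_seq (Q + C) m @[m --> \oo] -->
    gammamx C * rgammamx (Q + C).
  exact: cvg_mxM (beta_gamma QC dQ dC) (@cvg_rgamma _ _ (Q + C)).
have e : (fun m => beta Q C 0 * rgamma_seq Q m) =
  (fun m => beta Q C m.+1 * powmx m%:R C * rgamma_seq (Q + C) m).
  by apply/funext => m; exact: beta_rgamma_seq.
by rewrite e in h1; exact: mx_cvg_unique h1 h2.
Qed.

(** For [Q = I] the kernel reduces to [(1 - v)^(C - I)], and its product with [C] has the primitive
    [- (1 - v)^C]. *)
Lemma beta1_0 C : decay C -> beta 1 C 0 * C = 1.
Proof.
move=> dC.
have FPP : ProperFilter FP by typeclasses eauto.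
have h1 : integralmx ab.1 ab.2 (betaf 1 C 0) * C @[ab --> FP] --> beta 1 C 0 * C.
  exact: cvg_mxMr (@cvg_beta _ _ 1 C (@decay1 R N) dC 0).
apply: (mx_cvg_unique h1).
have b1 : betab 1 C 0 v @[v --> (1 : R)^'-] --> (0 : M).
  by have [] := betab_cvg0 (@decay1 R N) dC 0.
have c1 : powmx (1 - v) C @[v --> (1 : R)^'-] --> (0 : M).
  have [d [K [d0 _ h]]] := decay_powmx dC.
  apply: (@cvg_mx_le _ _ _ _ _ _ _ (fun v => K * (1 - v) `^ d)).
    near=> v; rewrite subr0; apply: h.
      by rewrite subr_gt0; near: v; exact: nbhs_left_lt.
    by rewrite gerBl; near: v; apply: nbhs_left_ge.
  by rewrite -[X in _ --> X](mulr0 K); apply: cvgMr; exact: powR_onem_cvg0.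
have c0 : powmx (1 - v) C @[v --> (0 : R)^'+] --> (1 : M).
  have h := isD_cvg (isD_onem_powmx C (ltr01 : (0 : R) < 1)).
  rewrite subr0 powmx1 in h; exact: cvg_at_right_filter h.
have h2 : powmx (1 - ab.1) C - powmx (1 - ab.2) C @[ab --> FP] --> (1 : M) - 0.
  exact: cvgB (cvg_comp _ _ cvg_fst c0) (cvg_comp _ _ cvg_snd c1).
rewrite subr0 in h2; apply: cvg_trans h2; apply: near_eq_cvg.
apply: filterS (@near_I01 R) => -[a b] /= [a0 ab b1'].
have Ia : I01 a by apply/I01P; rewrite a0 (le_lt_trans ab).
have Ib : I01 b by apply/I01P; rewrite b1' (lt_le_trans a0).
have cf := @betaf_cont _ _ 1 C 0.
have e1 := integralmxMr (@I01_open R) (@I01_interval R) C cf Ia Ib ab.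
apply: (etrans _ e1); apply/esym.
have e2 := @integralmx_FTC2 _ _ (fun v => betaf 1 C 0 v * C) (fun v => - powmx (1 - v) C) a b ab.
rewrite e2 ?opprK; first by rewrite addrC.
- move=> u /andP[au ub]; have u1 : u < 1 by exact: le_lt_trans ub b1'.
  apply: isD_eq (isD_opp (isD_onem_powmx C u1)) _.
  rewrite /betaf expr0 scale1r subrr /powmx scaler0 expmx0 mulr1 mulNr opprK.
  apply/esym/expmxZ_comm/commr_sym/commrB; [exact: commr_refl|exact: commr1].
- move=> u uab; have Iu : I01 u by exact: (@I01_interval R) Ia Ib u uab.
  exact: cont_onM cf (@cont_on_cst _ _ _ _) u Iu.
Unshelve. all: by end_near. Qed.

Lemma pochhammer1 m : pochhammer (1 : M) m = (m`!)%:R%:M.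
Proof.
elim: m => [|m IH]; first by rewrite pochhammer0.
rewrite pochhammerS IH factS mulnC natrM.
have -> : (1 : M) + m%:R%:M = m.+1%:R%:M by rewrite -nat1r raddfD.
by rewrite mulmx_scalarr scale_scalar_mx [X in X%:M]mulrC.
Qed.

Lemma pochhammer_1D C m : pochhammer (1 + C) m * C = pochhammer C m.+1.
Proof.
rewrite /pochhammer big_ord_recl /= raddf0 addr0.
have -> : \prod_(i < m) (C + (bump 0 i)%:R%:M) = pochhammer (1 + C) m.
  apply: eq_bigr => i _; rewrite /bump leq0n add1n -nat1r raddfD addrA [C + _]addrC.
  by [].
by apply/esym/pochhammer_comm/commrD; [exact: commr1|exact: commr_refl].
Qed.

Lemma rgamma_seq_inv_aux (S : pzRingType) (b t p t' c : S) :
  t * p = p * t -> t * t' = 1 -> b * t * (p * t' * c) = b * (p * c).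
Proof. by move=> h1 h2; rewrite -!mulrA [t * _]mulrA h1 -mulrA [t * (t' * _)]mulrA h2 mul1r. Qed.

(** From [beta_poch] and [beta1_0], [beta 1 C m.+1] times [(C)_(m+2)] is [(m+1)!]. The approximant
    contains only [(C)_(m+1)]; the correction [1 + C / (m + 1)], which tends to 1, supplies the last
    factor. *)
Lemma rgamma_seq_beta1 C m : decay C ->
  beta 1 C m.+1 * powmx m%:R C * (rgamma_seq C m * (1 + (m.+1%:R)^-1 *: C)) = 1.
Proof.
move=> dC.
have h : beta 1 C m.+1 * pochhammer C m.+2 = ((m.+1)`!)%:R%:M.
  rewrite -pochhammer_1D mulrA -(beta_poch m.+1 (commr_sym (commr1 C)) (@decay1 R N) dC).
  by rewrite pochhammer1 mulmx_scalarr scalemxMl beta1_0 // scalemx1.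
have e : 1 + (m.+1%:R)^-1 *: C = (m.+1%:R)^-1 *: (C + m.+1%:R%:M).
  by rewrite scalerDr addrC scale_scalar_mx mulVf // pnatr_eq0.
have tp : GRing.comm (powmx m%:R C) (pochhammer C m.+1).
  by apply: pochhammer_comm; exact: powmx_comm.
rewrite e /rgamma_seq; move: tp (powmxN C m%:R) h; rewrite (pochhammerS C m.+1).
move: (powmx m%:R C) (powmx m%:R (- C)) (pochhammer C m.+1) (beta 1 C m.+1) => t t' p b.
move: (C + _) => c tp tt' h.
rewrite scalemxMl !scalemxMr (rgamma_seq_inv_aux b c tp tt') h scalerA scale_scalar_mx.
have n1 : (m.+1%:R : R[i]) != 0 by rewrite pnatr_eq0.
have n2 : (m`!%:R : R[i]) != 0 by rewrite pnatr_eq0 -lt0n fact_gt0.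
rewrite factS natrM [X in X%:M](_ : _ = 1) //.
by move: n1 n2; move: (m.+1%:R) (m`!%:R) => u v u0 v0; field; rewrite u0 v0.
Qed.

Lemma cvg_1D_inv C : 1 + ((m.+1%:R : R[i])^-1) *: C @[m --> \oo] --> (1 : M).
Proof.
apply: (@cvg_mx_le _ _ _ _ _ _ _ (fun m => m.+1%:R^-1 * nrm C)).
  near=> m; rewrite addrC addKr.
  have -> : (m.+1%:R : R[i])^-1 = (m.+1%:R^-1 : R)%:C by rewrite fmorphV rmorph_nat.
  by rewrite nrmZr ger0_norm ?invr_ge0.
rewrite -[X in _ --> X](mul0r (nrm C)).
apply: cvgMl; exact: cvg_harmonic.
Unshelve. all: by end_near. Qed.

Lemma gamma_rgamma C : decay C -> gammamx C * rgammamx C = 1.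
Proof.
move=> dC.
have h0 : rgamma_seq C m * (1 + (m.+1%:R)^-1 *: C) @[m --> \oo] --> rgammamx C * 1.
  exact: cvg_mxM (@cvg_rgamma _ _ C) (@cvg_1D_inv C).
have h1 : beta 1 C m.+1 * powmx m%:R C * (rgamma_seq C m * (1 + (m.+1%:R)^-1 *: C))
    @[m --> \oo] --> gammamx C * (rgammamx C * 1).
  exact: cvg_mxM (beta_gamma (commr_sym (commr1 C)) (@decay1 R N) dC) h0.
have h2 : 1 @[m --> \oo] --> gammamx C * (rgammamx C * 1).
  move: h1; rewrite (_ : (fun x => _) = (fun=> 1)) //.
  by apply/funext => m; exact: rgamma_seq_beta1.
rewrite mulr1 in h2; apply/esym; apply: (mx_cvg_unique _ h2); exact: cvg_cst.
Qed.

Lemma rgamma_gamma C : decay C -> rgammamx C * gammamx C = 1.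
Proof. by move=> dC; apply: mulmx1C; exact: gamma_rgamma. Qed.

Lemma beta_normalize_aux (S : pzRingType) (b rQ rC rQC gQ gC gQC : S) :
  b * rQ = gC * rQC -> rQ * gQ = 1 -> rC * gC = 1 -> gQC * rQC = 1 ->
  rC * gQC = gQC * rC -> rQ * rC * gQC * b = 1.
Proof.
move=> h hQ hC hQC cm.
have -> : b = gC * rQC * gQ by rewrite -h -mulrA hQ mulr1.
rewrite -[rQ * rC * gQC]mulrA cm -!mulrA [rC * (gC * _)]mulrA hC mul1r.
by rewrite [gQC * _]mulrA hQC mul1r.
Qed.

Lemma beta_normalize Q C : GRing.comm Q C -> decay Q -> decay C ->
  rgammamx Q * rgammamx C * gammamx (Q + C) * beta Q C 0 = 1.
Proof.
move=> QC dQ dC; have dQC := decayD QC dQ dC.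
apply: beta_normalize_aux (beta_rgamma QC dQ dC) _ _ _ _.
- exact: rgamma_gamma.
- exact: rgamma_gamma.
- exact: gamma_rgamma.
(* [gammamx] inherits commutation from being the inverse of [rgammamx], with no return to the
   integral. *)
apply: comm_inv (rgamma_gamma dQC) (gamma_rgamma dQC).
apply/commr_sym/rgammamx_comm; apply: rgammamx_comm.
by apply/commr_sym/commrD; [exact: commr_sym|exact: commr_refl].
Qed.

End BetaIdentities.

(** * Total variation of the convergence factors *)

Section PochhammerUnits.
Variables (R : realType) (N : nat).
Local Notation M := 'M[R[i]]_N.
Implicit Types (Q C A X : M).

Lemma decay_unit_nat A (m : nat) : decay A -> A + m%:R%:M \in unitmx.
Proof.
move=> dA; have := decay_unit dA (ler0n R m).
by rewrite rmorph_nat.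
Qed.

Lemma pochhammer_unit A m : decay A -> pochhammer A m \in unitmx.
Proof.
move=> dA; elim: m => [|m IH]; first by rewrite pochhammer0 unitmx1.
by rewrite pochhammerS unitmx_mul IH decay_unit_nat.
Qed.

Lemma invmxM A X : A \in unitmx -> X \in unitmx -> invmx (A * X) = invmx X * invmx A.
Proof.
move=> uA uX; have uAX : A * X \in unitmx by rewrite unitmx_mul uA.
have h : (A * X) * (invmx X * invmx A) = 1.
  have vA : A * invmx A = 1 by exact: mulmxV.
  have vX : X * invmx X = 1 by exact: mulmxV.
  by rewrite mulrA -[A * X * _]mulrA vX mulr1.
by apply: (left_right_inv_unique _ (mulmx1C h)); exact: mulmxV.
Qed.

Lemma comm_invmx A X : GRing.comm X A -> A \in unitmx -> GRing.comm X (invmx A).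
Proof. by move=> XA uA; apply: comm_inv XA (mulmxV uA) (mulVmx uA). Qed.

Lemma seq_eventually_bounded (f : nat -> R) (n0 : nat) (K : R) :
  (forall n, 0 <= f n) -> (forall n, (n0 <= n)%N -> f n <= K) ->
  exists2 L : R, 0 <= L & forall n, f n <= L.
Proof.
move=> f0 h; exists (`|K| + \sum_(i < n0) f i).
  by rewrite addr_ge0 // sumr_ge0.
move=> n; have [n0n|nn0] := leqP n0 n.
  apply: le_trans (h n n0n) _; apply: le_trans (ler_norm _) _.
  by rewrite lerDl sumr_ge0.
rewrite (bigD1 (Ordinal nn0)) //= addrCA lerDl addr_ge0 // sumr_ge0 //.
Qed.

Lemma cvg_mx_bounded (u : nat -> M) (l : M) : u @ \oo --> l ->
  exists2 K : R, 0 <= K & forall n, nrm (u n) <= K.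
Proof.
move=> /nrm_near_bounded[n0 _ h].
by apply: (seq_eventually_bounded (n0 := n0) (K := nrm l + 1)) => n; [exact: nrm_ge0|exact: h].
Qed.

(** The inverse [X] satisfies [m X = 1 - X A]; once [m >= 2 |A|], the term [X A] is absorbed on the
    left. The finitely many smaller [m] only enlarge the constant. *)
Lemma invmx_shift_bound A : decay A -> exists2 K : R, 0 <= K &
  forall m : nat, m%:R * nrm (invmx (A + m%:R%:M)) <= K.
Proof.
move=> dA.
have [n0 hn0] : exists n0 : nat, 2 * nrm A <= n0%:R.
  by exists (Num.truncn (2 * nrm A)).+1; rewrite ltW // truncnS_gt.
apply: (seq_eventually_bounded (n0 := n0) (K := 2 * nrm (1 : M))) => m.
  by rewrite mulr_ge0 ?nrm_ge0.
move=> n0m; have uA := decay_unit_nat m dA.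
have mA : 2 * nrm A <= m%:R by apply: le_trans hn0 _; rewrite ler_nat.
set X := invmx _.
have e : (m%:R : R)%:C *: X = 1 - X * A.
  have h : X * (A + m%:R%:M) = 1 by exact: mulVmx.
  by rewrite -h mulrDr addrAC subrr add0r mulmx_scalarr rmorph_nat.
have h1 : m%:R * nrm X <= nrm (1 : M) + nrm X * nrm A.
  rewrite -[m%:R](ger0_norm (ler0n R m)) -nrmZr e.
  by apply: le_trans (nrmB _ _) _; rewrite lerD2l nrmM.
have h2 := ler_wpM2r (nrm_ge0 X) mA.
lra.
Qed.

End PochhammerUnits.

Section TelescopingPower.
Variable R : realType.

(** With [h = 1 / m], [(1 - h)^d <= e^(- d h) <= 1 / (1 + d h) <= 1 - d h / 2], the last step
    because [d h <= 1]. *)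
Lemma powR_pred_bound (d : R) (m : nat) : 0 < d -> d <= 1 -> (0 < m)%N ->
  (m.-1%:R / m%:R) `^ d <= 1 - d / (2 * m%:R).
Proof.
move=> d0 d1; case: m => // m _ /=.
have m1 : 0 < m.+1%:R :> R by rewrite ltr0n.
have m1' : 1 <= m.+1%:R :> R by rewrite ler1n.
pose h : R := m.+1%:R^-1.
have h0 : 0 < h by rewrite invr_gt0.
have h1 : h <= 1 by rewrite invf_le1.
have -> : d / (2 * m.+1%:R) = d * h / 2 by rewrite /h; field; rewrite gt_eqF.
have -> : m%:R / m.+1%:R = 1 - h.
  have : m.+1%:R != 0 :> R by rewrite gt_eqF.
  by rewrite /h -[m.+1%:R]natr1 => ?; field.
have dh0 : 0 < d * h by rewrite mulr_gt0.
have dh1 : d * h <= 1 by rewrite mulr_ile1 // ltW.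
(* At [h = 1] the base is 0, where the power is not given by the logarithm. *)
have [h11|h1n] := eqVneq h 1.
  by rewrite h11 subrr powR0 ?gt_eqF //; lra.
have hlt : h < 1 by rewrite lt_neqAle h1n.
have hp : 0 < 1 - h by rewrite subr_gt0.
rewrite /powR gt_eqF //.
have l1 : ln (1 - h) <= - h by apply: le_ln1Dx; lra.
apply: (@le_trans _ _ (expR (- (d * h)))).
  by rewrite ler_expR -mulrN ler_wpM2l // ltW.
rewrite expRN -[leLHS]div1r ler_pdivrMr ?expR_gt0 //.
apply: (@le_trans _ _ ((1 - d * h / 2) * (1 + d * h))).
  move: dh0 dh1; move: (d * h) => y y0 y1; nra.
by rewrite ler_wpM2l ?expR_ge1Dx //; lra.
Qed.

(** The [m]-th term of the Riemann sum for dw / w with step [s] is at most a multiple of the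
    increment of [Phi] over the same step. The sum telescopes and, [Phi] being bounded, is bounded
    uniformly in [s]. *)
Lemma Phi_telescope (d s : R) (m : nat) : 0 < d -> d <= 1 -> 0 < s -> (0 < m)%N ->
  m%:R^-1 * ((m%:R * s) `^ d / (1 + (m%:R * s) `^ d) ^+ 2) <=
  2 / d * (Phi d (m%:R * s) - Phi d (m.-1%:R * s)).
Proof.
move=> d0 d1 s0 m0.
have m0' : 0 < m%:R :> R by rewrite ltr0n.
have hb := powR_pred_bound d0 d1 m0.
have -> : m.-1%:R * s = m.-1%:R / m%:R * (m%:R * s) by field; rewrite gt_eqF.
have z1 : 0 <= m.-1%:R / m%:R :> R by rewrite divr_ge0.
have z2 : 0 <= m%:R * s by rewrite mulr_ge0 // ltW.
have td : 0 <= 2 / d by rewrite divr_ge0 // ltW.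
rewrite /Phi (powRM _ z1 z2).
have p0 : 0 < (m%:R * s) `^ d by rewrite powR_gt0 // mulr_gt0.
have c0 : 0 <= (m.-1%:R / m%:R) `^ d by exact: powR_ge0.
move: ((m.-1%:R / m%:R) `^ d) ((m%:R * s) `^ d) hb p0 c0 => c p hb p0 c0.
have c1 : c <= 1 by apply: le_trans hb _; rewrite gerBl divr_ge0 ?mulr_ge0 // ltW.
have q0 : 0 <= c * p by rewrite mulr_ge0 // ltW.
have e : - (1 + p)^-1 - - (1 + c * p)^-1 = (p - c * p) / ((1 + p) * (1 + c * p)).
  by field; rewrite !gt_eqF //; lra.
rewrite e.
apply: (@le_trans _ _ (2 / d * ((p - c * p) / (1 + p) ^+ 2))).
  have -> : m%:R^-1 * (p / (1 + p) ^+ 2) = 2 / d * (p * (d / (2 * m%:R)) / (1 + p) ^+ 2).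
    field; rewrite !gt_eqF //; lra.
  rewrite ler_wpM2l // ler_wpM2r ?invr_ge0 ?sqr_ge0 //.
  have -> : p - c * p = p * (1 - c) by ring.
  by apply: ler_wpM2l; [exact: ltW|lra].
rewrite ler_wpM2l // ler_wpM2l //.
  by rewrite subr_ge0 ger_pMl.
rewrite lef_pV2 ?posrE ?mulr_gt0 ?exprn_gt0 //; try lra.
rewrite expr2 ler_wpM2l //; first by lra.
by rewrite lerD2l ger_pMl.
Qed.

End TelescopingPower.

Lemma mul_inv_solve (S : pzRingType) (v p x q : S) : v * p = 1 -> p * x = q -> v * q = x.
Proof. by move=> vp <-; rewrite mulrA vp mul1r. Qed.

Lemma betabY_aux (S : pzRingType) (p p' q t u u' s' g g' x U c : S) :
  g = p * u' -> u' * u = 1 -> g' = p' * s' -> s' * (u * t) = 1 -> g * x = 1 ->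
  (u * t) * g = g * (u * t) -> (u * t) * g' = g' * (u * t) -> p' = q * c -> c * U = 1 ->
  p * (t * (x * g') * U) = q.
Proof.
move=> hg uu hg' ss gx cg cg' hp cU.
have -> : p = g * u by rewrite hg -mulrA uu mulr1.
have -> : g * u * (t * (x * g') * U) = (g * (u * t)) * x * g' * U by rewrite !mulrA.
by rewrite -cg -[u * t * g * x]mulrA gx mulr1 cg' hg' -[p' * s' * _]mulrA ss mulr1 hp -mulrA cU mulr1.
Qed.

Section TotalVariation.
Variables (R : realType) (N : nat).
Local Notation M := 'M[R[i]]_N.
Variables (Q C : M).
Hypotheses (QC : GRing.comm Q C) (dQ : decay Q) (dC : decay C).

Let dQC : decay (Q + C) := decayD QC dQ dC.

(** The coefficient of the boundary term in [sigma m - sigma m.+1]. *)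
Definition betabY (m : nat) : M := invmx (pochhammer Q m.+1) * pochhammer (Q + C) m.

(** The inverse of the Gauss approximant [rgamma_seq Q m], written through a beta integral so that
    its convergence to [gammamx Q] is already known. *)
Let X (m : nat) : M :=
  (1 + (m.+1%:R)^-1 *: Q) * (beta 1 Q m.+1 * powmx m%:R Q).

Let rgX m : rgamma_seq Q m * X m = 1.
Proof.
have h := mulmx1C (rgamma_seq_beta1 m dQ).
by rewrite /X mulrA; exact: h.
Qed.

Let XB_bounded : exists2 K : R, 0 <= K &
  forall m, nrm (X m * rgamma_seq (Q + C) m) <= K.
Proof.
have h1 : X m @[m --> \oo] --> 1 * gammamx Q.
  exact: cvg_mxM (@cvg_1D_inv _ _ Q) (beta_gamma (commr_sym (commr1 Q)) (@decay1 R N) dQ).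
have h2 : X m * rgamma_seq (Q + C) m @[m --> \oo] --> 1 * gammamx Q * rgammamx (Q + C).
  exact: cvg_mxM h1 (@cvg_rgamma _ _ (Q + C)).
exact: cvg_mx_bounded h2.
Qed.

(** Rewriting both Pochhammer symbols by Gauss approximants isolates the growth [m^C] and the
    inverse of [Q + C + m], of order [1 / m]; the factor between them is bounded. *)
Let betabYE m : betabY m =
  powmx m%:R C * (X m * rgamma_seq (Q + C) m) * invmx (Q + C + m%:R%:M).
Proof.
have uQ := pochhammer_unit m.+1 dQ.
have vQ : invmx (pochhammer Q m.+1) * pochhammer Q m.+1 = 1 by exact: mulVmx.
have uU := decay_unit_nat m dQC.
have vU : (Q + C + m%:R%:M) * invmx (Q + C + m%:R%:M) = 1 by exact: mulmxV.
suff h : pochhammer Q m.+1 * (powmx m%:R C * (X m * rgamma_seq (Q + C) m)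
    * invmx (Q + C + m%:R%:M)) = pochhammer (Q + C) m.
  exact: mul_inv_solve vQ h.
have f0 : (m`!%:R : R[i]) != 0 by rewrite pnatr_eq0 -lt0n fact_gt0.
pose g := pochhammer Q m.+1 * powmx m%:R (- Q).
pose g' := pochhammer (Q + C) m.+1 * powmx m%:R (- (Q + C)).
have gX : g * ((m`!%:R)^-1 *: X m) = 1.
  by rewrite scalemxMr -scalemxMl; exact: rgX.
have -> : X m * rgamma_seq (Q + C) m = ((m`!%:R)^-1 *: X m) * g'.
  by rewrite /rgamma_seq scalemxMl; exact: scalemxMr.
have eP : powmx m%:R (Q + C) = powmx m%:R Q * powmx m%:R C by exact: powmxD.
have Qs : GRing.comm (Q + C) Q.
  by apply/commr_sym/commrD; [exact: commr_refl|exact: QC].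
have k1 : powmx m%:R (- Q) * powmx m%:R Q = 1 :> M by apply: mulmx1C; exact: powmxN.
have k2 : powmx m%:R (- (Q + C)) * powmx m%:R (Q + C) = 1 :> M.
  by apply: mulmx1C; exact: powmxN.
have k3 : GRing.comm (powmx m%:R (Q + C)) g.
  apply: commrM.
    by apply: pochhammer_comm; exact: powmx_comm.
  by apply: powmx_comm2; exact: commrN.
have k4 : GRing.comm (powmx m%:R (Q + C)) g'.
  apply: commrM.
    by apply: pochhammer_comm; apply: powmx_comm; exact: commr_refl.
  by apply: powmx_comm2; exact/commrN/commr_refl.
have {}k2 := etrans (congr1 (fun Z => powmx m%:R (- (Q + C)) * Z) (esym eP)) k2.
have {}k3 := eq_ind _ (fun Z => GRing.comm Z g) k3 _ eP.
have {}k4 := eq_ind _ (fun Z => GRing.comm Z g') k4 _ eP.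
exact: (betabY_aux (erefl g) k1 (erefl g') k2 gX k3 k4 (pochhammerS (Q + C) m) vU).
Qed.

(** The powers [(1 - v)^C] and [m^C] merge into [w^C] with [w = m (1 - v)], and [v^m <= e^-w]; this
    leaves a function of [w] divided by [m], the shape needed by [Phi_telescope]. *)
Let betabY_term : exists d K : R, [/\ 0 < d, d <= 1, 0 <= K & forall (m : nat) (v : R),
  (0 < m)%N -> 0 < v -> v < 1 ->
  nrm (betab Q C m v * betabY m) <=
    K * (m%:R^-1 * ((m%:R * (1 - v)) `^ d / (1 + (m%:R * (1 - v)) `^ d) ^+ 2))].
Proof.
have [d [K1 [d0 d1 h1]]] := decay_bound 0 dC.
have [K2 K20 h2] := powmx_bounded dQ.
have [K3 K30 h3] := XB_bounded.
have [K4 K40 h4] := invmx_shift_bound dQC.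
exists d, (`|K1| * K2 * K3 * K4); split => //; first by rewrite !mulr_ge0.
move=> m v m0 v0 v1.
have m0' : 0 < m%:R :> R by rewrite ltr0n.
have s0 : 0 < 1 - v by rewrite subr_gt0.
have s1 : 1 - v <= 1 by lra.
set w := m%:R * (1 - v); have w0 : 0 < w by rewrite mulr_gt0.
have e : betab Q C m v * betabY m = (v ^+ m)%:C *: (powmx v Q * powmx w C *
    (X m * rgamma_seq (Q + C) m) * invmx (Q + C + m%:R%:M)).
  rewrite betabYE /betab /w (powmxMl C m0' s0) scalemxMl; congr (_ *: _).
  have c1 : powmx (1 - v) C * powmx v Q = powmx v Q * powmx (1 - v) C.
    by apply/esym/powmx_comm2.
  have c2 : powmx (1 - v) C * powmx m%:R C = powmx m%:R C * powmx (1 - v) C.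
    by apply: powmx_comm2; exact: commr_refl.
  move: (powmx (1 - v) C) (powmx v Q) (powmx m%:R C) (X m) (rgamma_seq _ _) (invmx _) c1 c2.
  by move=> a b c x y z c1 c2; rewrite c1 !mulrA -[b * a * c]mulrA c2 !mulrA.
rewrite e nrmZr ger0_norm ?exprn_ge0 ?(ltW v0) //.
have [_ vm] := onem_exp_bounds m (ltW s0) s1.
rewrite subKr -/w in vm.
have k1 := h1 w w0; rewrite expr0 mulr1 in k1.
have k2 := h2 v v0 (ltW v1).
have k3 := h3 m.
have k4 : nrm (invmx (Q + C + m%:R%:M)) <= K4 * m%:R^-1.
  by rewrite ler_pdivlMr // mulrC; exact: h4.
have wd0 : 0 <= w `^ d / (1 + w `^ d) ^+ 2.
  by rewrite divr_ge0 ?powR_ge0 ?exprn_ge0 ?addr_ge0 ?powR_ge0.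
move: (powmx v Q) (powmx w C) (X m * _) (invmx _) k1 k2 k3 k4 => a b c z k1 k2 k3 k4.
apply: (@le_trans _ _ (expR (- w) * (K2 * nrm b * K3 * (K4 * m%:R^-1)))).
  apply: ler_pM; rewrite ?exprn_ge0 ?nrm_ge0 ?(ltW v0) //.
  apply: nrmMr_le k4; apply: nrmMr_le k3; apply: nrmMr_le k2 (lexx _).
have -> : expR (- w) * (K2 * nrm b * K3 * (K4 * m%:R^-1)) =
  (nrm b * expR (- w)) * (K2 * K3 * K4 * m%:R^-1) by ring.
have -> : `|K1| * K2 * K3 * K4 * (m%:R^-1 * (w `^ d / (1 + w `^ d) ^+ 2)) =
  (`|K1| * (w `^ d / (1 + w `^ d) ^+ 2)) * (K2 * K3 * K4 * m%:R^-1) by ring.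
rewrite ler_wpM2r ?mulr_ge0 ?invr_ge0 //.
by apply: le_trans k1 _; rewrite ler_wpM2r ?ler_norm.
Qed.

Lemma betabY_sum : exists2 K : R, 0 <= K & forall (n : nat) (v : R), 0 < v -> v < 1 ->
  \sum_(0 <= m < n) nrm (betab Q C m v * betabY m) <= K.
Proof.
have [d [K [d0 d1 K0 h]]] := betabY_term.
have [e1 [e2 [L [e10 e20 hL]]]] := betab_bound dQ dC.
(* Bounds the term [m = 0], which lies outside [betabY_term]. *)
pose B := `|L| * nrm (betabY 0).
have B0 : 0 <= B by rewrite mulr_ge0 ?nrm_ge0.
pose c := K * (2 / d).
have c0 : 0 <= c by rewrite !mulr_ge0 ?invr_ge0 ?(ltW d0).
exists (B + c); first by rewrite addr_ge0.
move=> n v v0 v1.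
have s0 : 0 < 1 - v by rewrite subr_gt0.
case: n => [|n]; first by rewrite big_geq // addr_ge0.
suff H : \sum_(0 <= m < n.+1) nrm (betab Q C m v * betabY m) <=
    B + c * (Phi d (n%:R * (1 - v)) - Phi d (0%:R * (1 - v))).
  apply: le_trans H _; rewrite lerD2l ler_piMr //.
  have /andP[p1 p2] := Phi_bounds d (n%:R * (1 - v)).
  have /andP[p3 p4] := Phi_bounds d (0%:R * (1 - v)).
  lra.
elim: n => [|n IH].
  rewrite big_nat1 subrr mulr0 addr0; apply: le_trans (nrmM _ _) _.
  rewrite ler_wpM2r ?nrm_ge0 // /betab expr0 scale1r.
  apply: le_trans (hL v v0 v1) _.
  have p1 (y e : R) : 0 < e -> 0 < y -> y < 1 -> y `^ e <= 1.
    move=> e0 y0 y1.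
    by have := @ge0_ler_powR R e (ltW e0) y 1; rewrite !nnegrE powR1; apply; rewrite // ltW.
  apply: (@le_trans _ _ (`|L| * ((1 - v) `^ e2 * v `^ e1))).
    by rewrite ler_wpM2r ?mulr_ge0 ?powR_ge0 ?ler_norm.
  by rewrite ler_piMr // mulr_ile1 ?powR_ge0 ?p1 //; lra.
rewrite big_nat_recr //=; apply: le_trans (lerD IH (h _ v (ltn0Sn n) v0 v1)) _.
have := ler_wpM2l K0 (Phi_telescope d0 d1 s0 (ltn0Sn n)); rewrite /= [leRHS]mulrA -/c.
move: (K * _) (Phi _ _) (Phi _ _) (Phi _ _) => y p1 p2 p3; rewrite !mulrBr; lra.
Qed.

(* Convergence factors: as (a, b) tends to (0, 1), [sigma m a b] tends to
   [beta Q C 0] for every m. *)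
Definition sigma (m : nat) (a b : R) : M :=
  integralmx a b (betaf Q C m) * invmx (pochhammer Q m) * pochhammer (Q + C) m.

(** This is [betaf_int_rec] multiplied on the right by [betabY m], whose inverse Pochhammer factor
    cancels [Q + m] in the first product and whose second factor absorbs [Q + C + m] in the
    other. *)
Lemma sigmaS m a b : 0 < a -> a <= b -> b < 1 ->
  sigma m a b - sigma m.+1 a b = (betab Q C m b - betab Q C m a) * betabY m.
Proof.
move=> a0 ab b1; rewrite -(betaf_int_rec QC m a0 ab b1) /sigma /betabY.
have uQ := pochhammer_unit m dQ; have uQ1 := pochhammer_unit m.+1 dQ.
have us := decay_unit_nat m dQ.
have i1 : invmx (pochhammer Q m.+1) = invmx (Q + m%:R%:M) * invmx (pochhammer Q m).
  by rewrite pochhammerS invmxM.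
have v1 : (Q + m%:R%:M) * invmx (Q + m%:R%:M) = 1 by exact: mulmxV.
have cm : (Q + C + m%:R%:M) * invmx (pochhammer Q m.+1) =
          invmx (pochhammer Q m.+1) * (Q + C + m%:R%:M).
  apply: comm_invmx => //; apply: comm_poch_shift.
  by apply/commr_sym/commrD; [exact: commr_refl|exact: QC].
have cm2 : (Q + C + m%:R%:M) * pochhammer (Q + C) m = pochhammer (Q + C) m * (Q + C + m%:R%:M).
  by apply: comm_poch_shift; exact: commr_refl.
rewrite mulrBl; congr (_ - _).
  by rewrite i1 !mulrA -[_ * _ * invmx (Q + _)]mulrA v1 mulr1.
rewrite (pochhammerS (Q + C)) -cm2 !mulrA -[_ * (Q + C + _) * invmx _]mulrA cm.
by rewrite !mulrA.
Qed.

(** The variation along multiples of [k] is at most the variation along all indices; the boundary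
    terms at [a] and at [b] contribute [K] each. *)
Lemma sigma_TV (k : nat) : exists2 K : R, 0 <= K & forall (n : nat) (a b : R),
  0 < a -> a <= b -> b < 1 ->
  \sum_(0 <= l < n) nrm (sigma (k * l.+1) a b - sigma (k * l) a b) <= K.
Proof.
have [K K0 h] := betabY_sum.
exists (K + K) => [|n a b a0 ab b1]; first exact: addr_ge0.
pose t m := nrm (sigma m.+1 a b - sigma m a b).
have tK j : series t j <= K + K.
  have b0 : 0 < b by exact: lt_le_trans ab.
  have a1 : a < 1 by exact: le_lt_trans b1.
  apply: le_trans (lerD (h j b b0 b1) (h j a a0 a1)).
  rewrite /series /= -big_split /=; apply: ler_sum => m _.
  by rewrite /t nrmBC sigmaS // mulrBl nrmB.
apply: le_trans (tK (k * n)%N).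
elim: n => [|n IH]; first by rewrite muln0 /series /= !big_geq.
rewrite big_nat_recr //=.
have kn : (k * n <= k * n.+1)%N by rewrite leq_mul2l leqnSn orbT.
have := @nrm_increments _ _ (fun m => sigma m a b) t _ _ kn (fun _ _ => lexx _).
by move: IH; lra.
Qed.

End TotalVariation.

Lemma summation_by_parts_aux (S : pzRingType) (A L x u w Z : S) :
  u * (A - L) - Z + u * x = w * (A + x - L) - (Z + (w - u) * (A + x - L)).
Proof.
rewrite addrAC -mulrDr [A - L + x]addrAC; set y := A + x - L.
by rewrite mulrBl opprD opprB [RHS]addrCA [w * y + _]addrC subrK addrC.
Qed.

Lemma sub_chain (V : zmodType) (a b p q : V) : a - b = (a - p) + (p - q) - (b - q).
Proof. by rewrite opprB (addrA (a - p)) subrK addrA subrK. Qed.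

(** * Abel summation and the interchange of sum and integral *)

Section AbelSummation.
Variables (R : realType) (N : nat).
Local Notation M := 'M[R[i]]_N.

(** The partial sums are centred at [L], so that both terms on the right contain only tails of the
    series, which become small when [L] is its sum. *)
Lemma summation_by_parts (s a : nat -> M) (L : M) (n : nat) :
  series (fun l => s l * a l) n - s 0%N * L =
  s n * (series a n - L) - \sum_(0 <= l < n) (s l.+1 - s l) * (series a l.+1 - L).
Proof.
elim: n => [|n IH].
  by rewrite /series /= !big_geq // !sub0r subr0 mulrN.
have e : series (fun l => s l * a l) n.+1 = series (fun l => s l * a l) n + s n * a n.
  by rewrite /series /= big_nat_recr.
rewrite e big_nat_recr //= addrAC IH.
have ea : series a n.+1 = series a n + a n by rewrite /series /= big_nat_recr.
rewrite ea; move: (series a n) (a n) (s n) (s n.+1) (\sum_(_ <= _ < _) _).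
by move=> A x u w Z; exact: summation_by_parts_aux.
Qed.

Context {T : Type} {F : set_system T} {FF : ProperFilter F}.

(* Abel's argument: convergence factors of uniformly bounded variation that
   tend to a common limit transform a convergent series regularly. *)
Lemma abel_TV (s : T -> nat -> M) (a : nat -> M) (L s0 : M) (K : R) (H : T -> M) :
  series a @ \oo --> L ->
  (\forall x \near F, forall n, \sum_(0 <= l < n) nrm (s x l.+1 - s x l) <= K) ->
  (forall l, s x l @[x --> F] --> s0) ->
  (\forall x \near F, series (fun l => s x l * a l) @ \oo --> H x) ->
  H @ F --> s0 * L.
Proof.
move=> aL TV sl hH.
pose r l := series a l - L.
have rL : r l @[l --> \oo] --> (0 : M).
  have h : r l @[l --> \oo] --> L - L by exact: cvgB aL (cvg_cst L).
  by rewrite subrr in h.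
have [Rm Rm0 hRm] := cvg_mx_bounded rL.
have K0 : 0 <= K by have [x hx] := filter_ex TV; have := hx 0%N; rewrite big_geq.
suff h0 : nrm (H x - s x 0%N * L) @[x --> F] --> (0 : R).
  have h1 : H x - s x 0%N * L @[x --> F] --> (0 : M).
    by apply/cvg_nrmP; under eq_fun do rewrite subr0.
  have h2 : (H x - s x 0%N * L) + s x 0%N * L @[x --> F] --> 0 + s0 * L.
    exact: cvgD h1 (cvg_mxMr (sl 0%N)).
  have e : (fun x => (H x - s x 0%N * L) + s x 0%N * L) = H.
    by apply/funext => x; rewrite subrK.
  by rewrite add0r e in h2.
apply/cvgr0Pnorm_le => e e0.
have e3 : 0 < e / 3 by rewrite divr_gt0.
(* The [+ 1] keeps the division valid when [K = 0]. *)
pose e1 := e / 3 / (K + 1).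
have e10 : 0 < e1 by rewrite divr_gt0 // ltr_wpDl.
have [l0 _ hl0] : \forall l \near \oo, nrm (r l) <= e1.
  move/cvg_nrmP/cvgr0Pnorm_le: rL => /(_ _ e10); apply: filterS => l.
  by rewrite subr0 ger0_norm ?nrm_ge0.
(* With [l0] fixed, finitely many increments remain, and each tends to 0 because all factors share
   the limit [s0]. *)
have D0 : Rm * \sum_(0 <= l < l0) nrm (s x l.+1 - s x l) @[x --> F] --> (0 : R).
  have h : \sum_(0 <= l < l0) nrm (s x l.+1 - s x l) @[x --> F] -->
      \sum_(0 <= l < l0) nrm (s0 - s0).
    apply: (@cvg_bigsum _ _ _ _ _ _ (fun l x => nrm (s x l.+1 - s x l)) (fun=> nrm (s0 - s0))) => l.
    exact: cvg_nrm (cvgB (sl l.+1) (sl l)).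
  rewrite -[X in _ --> X](mulr0 Rm); apply: cvgMr.
  have Z : \sum_(0 <= l < l0) nrm (s0 - s0) = 0 by rewrite big1 // => l _; rewrite subrr nrm0.
  by rewrite Z in h.
move/cvgr0Pnorm_le: D0 => /(_ _ e3) D0.
near=> x; rewrite ger0_norm ?nrm_ge0 //.
have hx : series (fun l => s x l * a l) @ \oo --> H x by near: x.
have TVx : forall n, \sum_(0 <= l < n) nrm (s x l.+1 - s x l) <= K by near: x.
have Dx : Rm * \sum_(0 <= l < l0) nrm (s x l.+1 - s x l) <= e / 3.
  apply: le_trans (ler_norm _) _; near: x; exact: D0.
have hx2 : series (fun l => s x l * a l) n - s x 0%N * L @[n --> \oo] --> H x - s x 0%N * L.
  exact: cvgB hx (cvg_cst _).
apply: (nrm_lim_le hx2).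
(* Here [x] is fixed and [n] grows: bounded variation gives [nrm (s x n) <= nrm (s x 0) + K], so the
   boundary term vanishes. *)
have snr : (nrm (s x 0%N) + K) * nrm (r n) @[n --> \oo] --> (0 : R).
  rewrite -[X in _ --> X](mulr0 (nrm (s x 0%N) + K)); apply: cvgMr.
  have h : nrm (r l) @[l --> \oo] --> nrm (0 : M) by exact: cvg_nrm rL.
  by rewrite nrm0 in h.
move/cvgr0Pnorm_le: snr => /(_ _ e3); apply: filterS => n hn.
have {}hn := le_trans (ler_norm _) hn.
rewrite summation_by_parts -/(r n).
have h1 : nrm (s x n * r n) <= e / 3.
  apply: le_trans (nrmM _ _) _; apply: le_trans hn; rewrite ler_wpM2r ?nrm_ge0 //.
  have -> : s x n = s x 0%N + (s x n - s x 0%N) by rewrite addrC subrK.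
  apply: le_trans (nrmD _ _) _; rewrite lerD2l.
  apply: le_trans (TVx n).
  have := @nrm_increments _ _ (s x) (fun l => nrm (s x l.+1 - s x l)) 0 n (leq0n n) (fun _ _ => lexx _).
  by rewrite {2}/series /= big_geq // subr0.
have h2 : nrm (\sum_(0 <= l < n) (s x l.+1 - s x l) * (series a l.+1 - L)) <= e / 3 + e / 3.
  apply: le_trans (nrm_sum _ _ _) _.
  (* Below [l0] the tails are merely bounded by [Rm] but the increments are small; from [l0] on the
     tails are at most [e1] and the increments sum to at most [K]. *)
  apply: (@le_trans _ _ (\sum_(0 <= l < n) (nrm (s x l.+1 - s x l) * e1 +
      Rm * (if (l < l0)%N then nrm (s x l.+1 - s x l) else 0)))).
    apply: ler_sum => l _; apply: le_trans (nrmM _ _) _.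
    have [ll|ll] := ltnP l l0.
      apply: ler_wpDl; first by rewrite mulr_ge0 ?nrm_ge0 // ltW.
      by rewrite mulrC ler_wpM2r ?nrm_ge0 //; exact: hRm.
    rewrite mulr0 addr0 ler_wpM2l ?nrm_ge0 //; apply: hl0 => /=; exact: leqW.
  rewrite big_split /= -mulr_suml -mulr_sumr; apply: lerD.
    apply: (@le_trans _ _ (K * e1)); first by rewrite ler_wpM2r // ltW.
    rewrite /e1 mulrCA ler_piMr ?(ltW e3) // ler_pdivrMr ?ltr_wpDl //; lra.
  apply: le_trans Dx; rewrite ler_wpM2l //.
  rewrite -big_mkcond /=.
  have [nl|ln] := leqP n l0.
    rewrite (big_cat_nat _ (n := n) (p := l0)) //=; apply: ler_wpDr.
      by apply: sumr_ge0 => l _; exact: nrm_ge0.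
    by rewrite big_mkcond /=; apply: ler_sum => l _; case: ifP => // _; exact: nrm_ge0.
  rewrite (big_cat_nat _ (n := l0)) //=; last exact: ltnW.
  rewrite [X in _ + X]big_nat_cond [X in _ + X]big1 ?addr0; last first.
    by move=> l /andP[/andP[l0l _]]; rewrite ltnNge l0l.
  by rewrite big_mkcond /=; apply: ler_sum => l _; case: ifP => // _; exact: nrm_ge0.
apply: le_trans (nrmB _ _) _; apply: le_trans (lerD h1 h2) _; lra.
Unshelve. all: by end_near. Qed.

End AbelSummation.

(** * Matrix power series in [v ^ k] on (0, 1) *)

Section PowerSeries.
Variables (R : realType) (N k : nat).
Local Notation M := 'M[R[i]]_N.
Variable T : nat -> M.
Hypothesis k0 : (0 < k)%N.

Definition pterm (v : R) (l : nat) : M := (v ^+ (k * l))%:C *: T l.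

Hypothesis T_cvg : forall v : R, 0 < v -> v < 1 -> cvgn (series (pterm v)).

Definition psum (v : R) : M := limn (series (pterm v)).

Lemma cvg_psum v : 0 < v -> v < 1 -> series (pterm v) @ \oo --> psum v.
Proof. exact: T_cvg. Qed.

(** Abel's lemma: at a point [c] between [b] and 1 the terms are bounded, so for [v <= b] the series
    is dominated by a geometric one of ratio [(b / c) ^ k], and the tail bound does not depend on
    [v]. *)
Lemma psum_tail (b : R) : 0 < b -> b < 1 -> exists2 d : nat -> R, d @ \oo --> (0 : R) &
  forall (v : R) (n : nat), 0 < v -> v <= b -> nrm (psum v - series (pterm v) n) <= d n.
Proof.
move=> b0 b1; pose c := (b + 1) / 2.
have c0 : 0 < c by rewrite /c; lra.
have c1 : c < 1 by rewrite /c; lra.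
have bc : b < c by rewrite /c; lra.
have [K K0 hK] : exists2 K : R, 0 <= K & forall l, nrm (pterm c l) <= K.
  have h := cvg_psum c0 c1.
  have h2 : series (pterm c) n.+1 - series (pterm c) n @[n --> \oo] --> psum c - psum c.
    have h' := h; rewrite -(cvg_shiftS (series (pterm c))) in h'.
    exact: cvgB h' h.
  have [K K0 hK] := cvg_mx_bounded h2; exists K => // l.
  by have := hK l; rewrite seriesSB.
pose q := (b / c) ^+ k.
have bc0 : 0 < b / c by rewrite divr_gt0.
have bc1 : b / c < 1 by rewrite ltr_pdivrMr // mul1r.
have q0 : 0 <= q by rewrite exprn_ge0 // ltW.
have q1 : q < 1 by rewrite exprn_ilt1 // ?ltW // -lt0n.
have gcvg := @cvg_geometric_series R K q; rewrite ger0_norm // in gcvg.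
have {}gcvg := gcvg q1.
exists (fun n => K * (1 - q)^-1 - series (geometric K q) n).
  have h : K * (1 - q)^-1 - series (geometric K q) n @[n --> \oo] -->
     K * (1 - q)^-1 - K * (1 - q)^-1 by exact: cvgB (cvg_cst _) gcvg.
  by rewrite subrr in h.
move=> v n v0 vb.
have v1 : v < 1 by exact: le_lt_trans b1.
have hv := cvg_psum v0 v1.
have h2 : series (pterm v) m - series (pterm v) n @[m --> \oo] --> psum v - series (pterm v) n.
  exact: cvgB hv (cvg_cst _).
apply: (nrm_lim_le h2); near=> m.
have nm : (n <= m)%N by near: m; exact: nbhs_infty_ge.
apply: (@le_trans _ _ (series (geometric K q) m - series (geometric K q) n)).
  apply: nrm_increments => // l _; rewrite seriesSB /geometric /=.
  rewrite /pterm nrmZr ger0_norm ?exprn_ge0 ?(ltW v0) //.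
  have := hK l; rewrite /pterm nrmZr ger0_norm ?exprn_ge0 ?(ltW c0) // => hl.
  apply: (@le_trans _ _ (b ^+ (k * l) * nrm (T l))).
    by rewrite ler_wpM2r ?nrm_ge0 // lerXn2r ?nnegrE // ltW.
  have -> : b ^+ (k * l) = q ^+ l * c ^+ (k * l).
    by rewrite /q -exprM -exprMn divfK // gt_eqF.
  by rewrite -mulrA mulrC ler_wpM2r // exprn_ge0.
rewrite lerD2r -(cvg_lim _ gcvg) //; apply: nondecreasing_cvgn_le.
  apply/nondecreasing_seqP => j; rewrite -subr_ge0 seriesSB /geometric /=.
  by rewrite mulr_ge0 // exprn_ge0.
by apply/cvg_ex; eexists; exact: gcvg.
Unshelve. all: by end_near. Qed.

Lemma pterm_cont l : cont_on (@I01 R) (fun v => pterm v l).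
Proof.
move=> v _; exact: isD_cvg (isD_scale (is_derive_expn (k * l) v) (isD_cst (T l) v)).
Qed.

Lemma psum_cont : cont_on (@I01 R) psum.
Proof.
move=> v0 /I01P/andP[v00 v01].
pose b := (v0 + 1) / 2.
have b0 : 0 < b by rewrite /b; lra.
have b1 : b < 1 by rewrite /b; lra.
have v0b : v0 < b by rewrite /b; lra.
have [d d0 hd] := psum_tail b0 b1.
suff h : nrm (psum v - psum v0) @[v --> v0] --> (0 : R).
  by have [_] := @cvg_nrmP _ _ _ (nbhs v0) _ psum (psum v0); apply.
apply/cvgr0Pnorm_le => e e0.
have e3 : 0 < e / 3 by rewrite divr_gt0.
move/cvgr0Pnorm_le: d0 => /(_ _ e3)[n _ /(_ n (leqnn n)) hn].
have {}hn := le_trans (ler_norm _) hn.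
have cs := @cont_on_sum _ _ (@I01 R) (fun l v => pterm v l) n pterm_cont.
have Iv0 : I01 v0 by apply/I01P/andP.
have /cvg_nrmP/cvgr0Pnorm_le/(_ _ e3) hs := cs v0 Iv0.
near=> v; rewrite ger0_norm ?nrm_ge0 //.
have vpos : 0 < v by near: v; exact: lt_nbhsr.
have vb : v <= b by apply: ltW; near: v; exact: lt_nbhsl.
have h1 := hd v n vpos vb.
have h2 := hd v0 n v00 (ltW v0b).
have h3 : nrm (series (pterm v) n - series (pterm v0) n) <= e / 3.
  by apply: le_trans (ler_norm _) _; near: v; exact: hs.
have -> : psum v - psum v0 = (psum v - series (pterm v) n) +
   (series (pterm v) n - series (pterm v0) n) - (psum v0 - series (pterm v0) n).
  exact: sub_chain.
apply: le_trans (nrmB _ _) _; apply: le_trans (lerD (le_trans (nrmD _ _) (lerD h1 h3)) h2) _.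
lra.
Unshelve. all: by end_near. Qed.

End PowerSeries.

(** * Pochhammer symbols of the parameters [Delta k Q] *)

Section DeltaProduct.
Variables (R : realType) (N : nat).
Local Notation M := 'M[R[i]]_N.
Implicit Types (Q A X : M).

Lemma pochhammerD A (m n : nat) :
  pochhammer A (m + n) = pochhammer A m * \prod_(0 <= j < n) (A + (m + j)%:R%:M).
Proof.
elim: n => [|n IH]; first by rewrite addn0 big_geq // mulr1.
by rewrite addnS pochhammerS IH big_nat_recr //= mulrA.
Qed.

Lemma prod_scalemx (I : Type) (r : seq I) (c : R[i]) (f : I -> M) :
  \prod_(i <- r) (c *: f i) = c ^+ size r *: \prod_(i <- r) f i.
Proof.
elim: r => [|i r IH]; first by rewrite !big_nil expr0 scale1r.
by rewrite !big_cons IH scalemxMl scalemxMr scalerA exprS.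
Qed.

(* Gauss: (M)_{kl} = k^{kl} prod_j ((M + j) / k)_l. *)
Lemma pochhammer_Delta Q (k l : nat) : (0 < k)%N ->
  \prod_(X <- Delta k Q) pochhammer X l = ((k%:R^-1) ^+ (k * l)) *: pochhammer Q (k * l).
Proof.
move=> k0; have kn : (k%:R : R[i]) != 0 by rewrite pnatr_eq0 -lt0n.
rewrite /Delta big_map; elim: l => [|l IH].
  by rewrite muln0 expr0 scale1r pochhammer0 big1 // => j _; rewrite pochhammer0.
pose D (j : nat) : M := k%:R^-1 *: (Q + j%:R%:M).
have cD (X : M) j : GRing.comm X Q -> GRing.comm X (D j).
  by move=> h; rewrite /GRing.comm scalemxMl scalemxMr (comm_shift _ h).
have cDD i j : GRing.comm (D i) (D j).
  exact: cD (commr_sym (cD _ _ (commr_refl Q))).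
have -> : \prod_(j <- iota 0 k) pochhammer (k%:R^-1 *: (Q + j%:R%:M)) l.+1 =
  \prod_(j <- iota 0 k) (pochhammer (D j) l * (D j + l%:R%:M)).
  by apply: eq_bigr => j _; rewrite -/(D j) pochhammerS.
rewrite prodrM_comm; last first.
  move=> i j _ _; apply/commr_sym/pochhammer_comm/commr_sym/comm_shift; exact: cDD.
rewrite IH mulnS addnC pochhammerD exprD -scalerA scalemxMl; congr (_ *: _).
rewrite -scalemxMr; congr (_ * _).
have -> : \prod_(j <- iota 0 k) (D j + l%:R%:M) =
   \prod_(j <- iota 0 k) (k%:R^-1 *: (Q + (k * l + j)%:R%:M)).
  apply: eq_bigr => j _; rewrite /D.
  have -> : l%:R%:M = k%:R^-1 *: (k * l)%:R%:M :> M.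
    by rewrite scale_scalar_mx natrM mulKf.
  by rewrite -scalerDr -addrA -raddfD -natrD [(j + _)%N]addnC.
by rewrite prod_scalemx size_iota /index_iota subn0.
Qed.

End DeltaProduct.

(** * Integration of the power series against the beta kernel *)

Section Interchange.
Variables (R : realType) (N k : nat).
Local Notation M := 'M[R[i]]_N.
Variables (Q C : M) (T : nat -> M).
Hypotheses (QC : GRing.comm Q C) (dQ : decay Q) (dC : decay C) (k0 : (0 < k)%N).
Hypothesis T_cvg : forall v : R, 0 < v -> v < 1 -> cvgn (series (pterm k T v)).

Notation FP := (filter_prod (0 : R)^'+ (1 : R)^'-).

Let dQC : decay (Q + C) := decayD QC dQ dC.

Definition intf (v : R) : M := betaf Q C 0 v * psum k T v.

Lemma intf_cont : cont_on (@I01 R) intf.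
Proof. exact: cont_onM (@betaf_cont _ _ Q C 0) (psum_cont k0 T_cvg). Qed.

Lemma betaf0_bounded (a b : R) : 0 < a -> a <= b -> b < 1 ->
  exists2 K : R, 0 <= K & forall v, a <= v <= b -> nrm (betaf Q C 0 v) <= K.
Proof.
move=> a0 ab b1.
have [K1 K10 h1] := powmx_bounded dQ; have [K2 K20 h2] := powmx_bounded dC.
have b1' : 0 < 1 - b by rewrite subr_gt0.
exists ((1 - b)^-1 * K2 * (a^-1 * K1)).
  by rewrite !mulr_ge0 ?invr_ge0 ?(ltW a0) ?(ltW b1').
move=> v /andP[av vb].
have v0 : 0 < v by exact: lt_le_trans av.
have v1 : 0 < 1 - v by lra.
rewrite /betaf expr0 scale1r; apply: nrmMr_le.
- have := h2 (1 - v) v1; rewrite -(powmxB1 C v1) nrmZr gtr0_norm // => h.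
  rewrite mulrC ler_pdivlMr //; apply: le_trans (h _); last by lra.
  by rewrite mulrC ler_wpM2r ?nrm_ge0 //; lra.
- have := h1 v v0; rewrite -(powmxB1 Q v0) nrmZr gtr0_norm // => h.
  rewrite mulrC ler_pdivlMr //; apply: le_trans (h _); last by lra.
  by rewrite mulrC ler_wpM2r ?nrm_ge0.
Qed.

(** On [a, b] the kernel is bounded and, since [b < 1], the series converges uniformly; this is
    where term by term integration is legitimate. *)
Lemma intf_series (a b : R) : 0 < a -> a <= b -> b < 1 ->
  series (fun l => integralmx a b (betaf Q C (k * l)) * T l) @ \oo --> integralmx a b intf.
Proof.
move=> a0 ab b1.
have Ia : I01 a by apply/I01P; rewrite a0 (le_lt_trans ab).
have Ib : I01 b by apply/I01P; rewrite b1 (lt_le_trans a0).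
have oI := @I01_open R; have iI := @I01_interval R.
have b0 : 0 < b by exact: lt_le_trans ab.
have [d d0 hd] := psum_tail k0 T_cvg b0 b1.
have [K K0 hK] := betaf0_bounded a0 ab b1.
have cf l := @betaf_cont _ _ Q C l.
pose g n v := betaf Q C 0 v * series (pterm k T v) n.
have cg n : cont_on (@I01 R) (g n).
  have cS := @cont_on_sum _ _ (@I01 R) (fun l v => pterm k T v l) n (@pterm_cont _ _ k T).
  exact: cont_onM (cf 0%N) cS.
have gE n : integralmx a b (g n) = series (fun l => integralmx a b (betaf Q C (k * l)) * T l) n.
  have cfT l : cont_on (@I01 R) (fun v => betaf Q C (k * l) v * T l).
    exact: cont_onM (cf _) (@cont_on_cst _ _ _ _).
  have -> : g n = (fun v => \sum_(0 <= l < n) (betaf Q C (k * l) v * T l)).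
    apply/funext => v; rewrite /g /series /= mulr_sumr; apply: eq_bigr => l _.
    by rewrite /pterm /betaf expr0 scale1r scalemxMr scalemxMl.
  rewrite (integralmx_sum oI iI n cfT Ia Ib ab); apply: eq_bigr => l _.
  exact: (integralmxMr oI iI (T l) (cf (k * l)%N) Ia Ib ab).
apply: (@cvg_mx_le _ _ _ _ _ _ _ (fun n => (N * N)%:R * (2 * (K * (b - a))) * d n)); last first.
  by rewrite -[X in _ --> X](mulr0 ((N * N)%:R * (2 * (K * (b - a))))); apply: cvgMr.
near=> n; rewrite -gE nrmBC.
have e := integralmxB oI iI intf_cont (cg n) Ia Ib ab.
rewrite -e.
have -> : (N * N)%:R * (2 * (K * (b - a))) * d n =
  (N * N)%:R * (2 * (K * d n * (b - a))) by ring.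
apply: (integralmx_le_cst oI iI (cont_onB intf_cont (cg n)) Ia Ib ab) => v vab.
rewrite /intf /g -mulrBr; apply: nrmMr_le; first exact: hK.
by case/andP: vab => av vb; apply: hd => //; exact: lt_le_trans av.
Unshelve. all: by end_near. Qed.

(** The part of the truncated integral that does not depend on [(a, b)]: it goes to the terms of the
    series, while [sigma] keeps the rest as a convergence factor. *)
Definition Sratio (m : nat) : M := pochhammer Q m * invmx (pochhammer (Q + C) m).

Lemma sigma_Sratio m a b : sigma Q C m a b * Sratio m = integralmx a b (betaf Q C m).
Proof.
have uQ := pochhammer_unit m dQ; have uC := pochhammer_unit m dQC.
have v1 : invmx (pochhammer Q m) * pochhammer Q m = 1 by exact: mulVmx.
have v2 : pochhammer (Q + C) m * invmx (pochhammer (Q + C) m) = 1 by exact: mulmxV.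
have c1 : pochhammer (Q + C) m * pochhammer Q m = pochhammer Q m * pochhammer (Q + C) m.
  apply/commr_sym/pochhammer_comm/commr_sym/pochhammer_comm/commr_sym.
  exact: commrD (commr_refl Q) QC.
rewrite /sigma /Sratio.
move: (integralmx _ _ _) (pochhammer Q m) (pochhammer (Q + C) m)
  (invmx (pochhammer Q m)) (invmx (pochhammer (Q + C) m)) v1 v2 c1.
move=> W p p' q q' v1 v2 c1.
by rewrite mulrA -[W * q * p' * p]mulrA c1 mulrA -[W * q * p]mulrA v1 mulr1 -mulrA v2 mulr1.
Qed.

Lemma cvg_sigma m : sigma Q C m ab.1 ab.2 @[ab --> FP] --> beta Q C 0.
Proof.
have uQ := pochhammer_unit m dQ.
have e : beta Q C 0 = beta Q C m * invmx (pochhammer Q m) * pochhammer (Q + C) m.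
  have v1 : pochhammer Q m * invmx (pochhammer Q m) = 1 by exact: mulmxV.
  have c1 : pochhammer (Q + C) m * invmx (pochhammer Q m) =
            invmx (pochhammer Q m) * pochhammer (Q + C) m.
    apply: comm_invmx => //; apply/pochhammer_comm/commr_sym/pochhammer_comm.
    exact: commrD (commr_refl Q) QC.
  by rewrite -mulrA -c1 mulrA -(beta_poch m QC dQ dC) -mulrA v1 mulr1.
rewrite e; exact: cvg_mxMr (cvg_mxMr (@cvg_beta _ _ Q C dQ dC m)).
Qed.

Lemma intf_limit (L : M) : series (fun l => Sratio (k * l) * T l) @ \oo --> L ->
  integralmx ab.1 ab.2 intf @[ab --> FP] --> beta Q C 0 * L.
Proof.
move=> hL; have [K K0 hK] := sigma_TV QC dQ dC k.
have FPP : ProperFilter FP by typeclasses eauto.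
apply: (@abel_TV R N _ FP FPP (fun ab l => sigma Q C (k * l) ab.1 ab.2)
  (fun l => Sratio (k * l) * T l) L (beta Q C 0) K _ hL).
- by apply: filterS (@near_I01 R) => -[a b] /= [a0 ab b1] n; exact: hK.
- by move=> l; exact: cvg_sigma.
- apply: filterS (@near_I01 R) => -[a b] /= [a0 ab b1].
  have h := intf_series a0 ab b1.
  have e : (fun l => sigma Q C (k * l) a b * (Sratio (k * l) * T l)) =
    (fun l => integralmx a b (betaf Q C (k * l)) * T l).
    by apply/funext => l; rewrite mulrA sigma_Sratio.
  by rewrite e.
Qed.

End Interchange.

(** * Terms of the incomplete exponential matrix function *)

Section IncompleteExponential.
Variables (R : realType) (N : nat).
Local Notation M := 'M[R[i]]_N.
Implicit Types (P Q C : M) (A B : seq M) (f g : R -> M).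

Lemma eq_integralmx (a b : R) f g : (forall u, a <= u <= b -> f u = g u) ->
  integralmx a b f = integralmx a b g.
Proof.
move=> fg; apply/matrixP => i j; rewrite !mxE; congr (_ +i* _).
- by apply: eq_Rintegral => u; rewrite inE /= in_itv /= => /fg ->.
- by apply: eq_Rintegral => u; rewrite inE /= in_itv /= => /fg ->.
Qed.

Lemma incE_termM x P Q A B (z c : R[i]) l :
  incE_term x P Q A B (z * c) l = c ^+ l *: incE_term x P Q A B z l.
Proof. by rewrite /incE_term scalerA exprMn mulrAC mulrC. Qed.

Lemma prod_pochhammer_unit B l : (forall X, X \in B -> decay X) ->
  \prod_(X <- B) pochhammer X l \in unitmx.
Proof.
elim: B => [|X B IH] h; first by rewrite big_nil unitmx1.
rewrite big_cons unitmx_mul pochhammer_unit; last by apply: h; rewrite inE eqxx.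
by apply: IH => Y YB; apply: h; rewrite inE YB orbT.
Qed.

Lemma invmxZ_unit (c : R[i]) (X : M) : c != 0 -> X \in unitmx ->
  invmx (c *: X) = c^-1 *: invmx X.
Proof.
by move=> c0 uX; apply: invmxZ; rewrite unitmxZ ?unitfE.
Qed.

Lemma Sratio_term_aux (S : pzRingType) (a p q b g : S) : GRing.comm a p -> GRing.comm a q ->
  (a * p) * (q * b) * g = p * q * (a * b * g).
Proof.
by move=> ap aq; rewrite ap !mulrA -[p * a * q]mulrA aq !mulrA.
Qed.

Lemma scale_cancel (c : R) (I J D W E : M) : c != 0 ->
  c^-1%:C *: I = J -> J = D * W -> E = c%:C *: D -> I = E * W.
Proof.
move=> c0 h1 h2 ->; rewrite scalemxMl -h2 -h1 scalerA -rmorphM mulfV //.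
by rewrite scale1r.
Qed.

(** The powers of [k] from the upper and lower [Delta] parameters cancel. Inversion reverses the
    lower product, so the inverse symbol of [Q + C] lands next to that of [Q], and both have only
    the product over [A] to cross. *)
Lemma incE_term_Delta x P Q C A B z (k l : nat) : (0 < k)%N ->
  decay (Q + C) -> (forall X, X \in B -> decay X) ->
  (forall X, X \in A -> GRing.comm X Q) -> (forall X, X \in A -> GRing.comm X C) ->
  incE_term x P Q (A ++ Delta k Q) (B ++ Delta k (Q + C)) z l =
  Sratio Q C (k * l) * incE_term x P Q A B z l.
Proof.
move=> k0 dQC dB AQ AC; rewrite /incE_term scalemxMr; congr (_ *: _).
have kn : (k%:R : R[i])^-1 ^+ (k * l) != 0.
  by rewrite expf_eq0 negb_and invr_eq0 pnatr_eq0 -lt0n k0 orbT.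
have uB := prod_pochhammer_unit l dB.
have uC := pochhammer_unit (k * l) dQC.
rewrite !big_cat /= (pochhammer_Delta Q l k0) (pochhammer_Delta (Q + C) l k0).
have uC' : (k%:R : R[i])^-1 ^+ (k * l) *: pochhammer (Q + C) (k * l) \in unitmx.
  by rewrite unitmxZ ?unitfE.
rewrite (invmxM uB uC') (invmxZ_unit kn uC) /Sratio.
have cp : GRing.comm (\prod_(X <- A) pochhammer X l) (pochhammer Q (k * l)).
  apply/pochhammer_comm/commr_sym; rewrite big_seq; apply: commr_prod => X XA.
  by apply/pochhammer_comm/commr_sym/AQ.
have cq : GRing.comm (\prod_(X <- A) pochhammer X l) (invmx (pochhammer (Q + C) (k * l))).
  apply: comm_invmx => //; apply/pochhammer_comm/commr_sym.
  rewrite big_seq; apply: commr_prod => X XA.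
  by apply/pochhammer_comm/commr_sym/commrD; [exact: AQ|exact: AC].
move: (incgammamx _ _) (rgammamx _) (\prod_(X <- A) _) (invmx (\prod_(X <- B) _)) cp cq.
move: (pochhammer Q _) (invmx _) (_ ^+ (k * l)) kn => p q c c0 g h a b cp cq.
have -> : a * (c *: p) * (c^-1 *: q * b) = (a * p) * (q * b).
  by rewrite scalemxMl !scalemxMr scalemxMl scalerA mulVf // scale1r.
rewrite -mulrA -[RHS]mulrA.
have e := Sratio_term_aux b (g * h) cp cq.
by rewrite -!mulrA in e *; exact: e.
Qed.

End IncompleteExponential.

(** The integrand may be singular at both ends, hence a joint improper limit whose existence is part
    of the claim. Commutation of [Q] and [C] drives the beta recurrence, and their commutation with
    the [A_i] lets the new Pochhammer symbols be extracted from each term. [cvg_rhs] is the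
    convergent series that Abel's argument needs at the endpoint. *)
Theorem theorem3p12 (R : realType) (N r s k : nat)
    (P Q C : 'M[R[i]]_N) (A : r.-tuple 'M[R[i]]_N) (B : s.-tuple 'M[R[i]]_N)
    (x t : R) (z : R[i])
    (x_gt0 : 0 < x) (t_lt_x : t < x) (k_gt0 : (0 < k)%N)
    (P_pos : re_pos P) (Q_pos : re_pos Q) (C_pos : re_pos C)
    (A_pos : forall i : 'I_r, re_pos (tnth A i))
    (B_pos : forall j : 'I_s, re_pos (tnth B j))
    (QC_comm : comm_mx Q C)
    (QA_comm : forall i : 'I_r, comm_mx Q (tnth A i))
    (CA_comm : forall i : 'I_r, comm_mx C (tnth A i))
    (cvg_lhs : forall u : R, t < u < x ->
       incE_cvg x P Q A B (z * ((u - t) ^+ k)%:C))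
    (cvg_rhs : incE_cvg x P Q (A ++ Delta k Q) (B ++ Delta k (Q + C))
       (z * ((x - t) ^+ k)%:C)) :
  let f (u : R) := powmx (x - u) (C - 1%:M) * powmx (u - t) (Q - 1%:M)
                   * incE x P Q A B (z * ((u - t) ^+ k)%:C) in
  improper_cvg t^'+ x^'- f /\
  rgammamx Q * rgammamx C * gammamx (Q + C) * improper t^'+ x^'- f
  = powmx (x - t) (C + Q - 1%:M)
    * incE x P Q (A ++ Delta k Q) (B ++ Delta k (Q + C))
        (z * ((x - t) ^+ k)%:C).
Proof.
move=> f.
have QC : GRing.comm Q C := QC_comm.
have dQ := re_pos_decay Q_pos; have dC := re_pos_decay C_pos.
have dQC := decayD QC dQ dC.
pose X := x - t; have X0 : 0 < X by rewrite subr_gt0.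
have Xne : X != 0 by rewrite gt_eqF.
(* The length [X] of the interval is absorbed into [z], so that the remaining variable [v] runs over
   (0, 1). *)
pose T := incE_term x P Q A B (z * (X ^+ k)%:C).
have termE v : incE_term x P Q A B (z * ((X * v) ^+ k)%:C) = pterm k T v.
  apply/funext => l; rewrite /pterm /T exprMn rmorphM mulrA incE_termM.
  by rewrite -rmorphXn -exprM.
have T_cvg v : 0 < v -> v < 1 -> cvgn (series (pterm k T v)).
  move=> v0 v1; rewrite -termE.
  have -> : X * v = (X * v + t) - t by rewrite addrK.
  apply: cvg_lhs; rewrite ltrDr mulr_gt0 //= -ltrBrDr -/X.
  by rewrite gtr_pMr.
pose L := incE x P Q (A ++ Delta k Q) (B ++ Delta k (Q + C)) (z * (X ^+ k)%:C).
have hL : series (fun l => Sratio Q C (k * l) * T l) @ \oo --> L.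
  have e : (fun l => Sratio Q C (k * l) * T l) =
      incE_term x P Q (A ++ Delta k Q) (B ++ Delta k (Q + C)) (z * (X ^+ k)%:C).
    have hB Y : Y \in tval B -> decay Y.
      by move=> /tnthP[i ->]; exact: re_pos_decay (B_pos i).
    have hA1 Y : Y \in tval A -> GRing.comm Y Q.
      by move=> /tnthP[i ->]; exact: commr_sym (QA_comm i).
    have hA2 Y : Y \in tval A -> GRing.comm Y C.
      by move=> /tnthP[i ->]; exact: commr_sym (CA_comm i).
    apply/funext => l; apply/esym.
    exact: (incE_term_Delta x P (z * (X ^+ k)%:C) l k_gt0 dQC hB hA1 hA2).
  by rewrite e; exact: cvg_rhs.
have lim0 := intf_limit QC dQ dC k_gt0 T_cvg hL.
(* The map [(u - t) / X], written in the affine form [c * u + d] of the substitution rule. *)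
pose phi (u : R) := X^-1 * u + - (t / X).
have phiE u : phi u = (u - t) / X by rewrite /phi; field.
have int_f a b : t < a -> a <= b -> b < x ->
    integralmx a b f = powmx X (C + Q - 1) * integralmx (phi a) (phi b) (intf k Q C T).
  move=> ta ab bx.
  have I u : t < u -> u < x -> I01 (phi u).
    move=> tu ux; apply/I01P; rewrite phiE ltr_pdivrMr // mul1r /X ltrD2r ux andbT.
    by rewrite divr_gt0 // subr_gt0.
  have Ia := I a ta (le_lt_trans ab bx); have Ib := I b (lt_le_trans ta ab) bx.
  have ch := @intf_cont _ _ k Q C T k_gt0 T_cvg.
  (* The constant powers of [X] that leave the kernel. The Jacobian supplies one further factor [X],
     which completes the exponent [C + Q - 1]. *)
  pose D := powmx X (C - 1) * powmx X (Q - 1).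
  have chD := cont_onM (@cont_on_cst _ _ (@I01 R) D) ch.
  have Xi0 : 0 < X^-1 by rewrite invr_gt0.
  have e1 := integralmx_affine (@I01_open R) (@I01_interval R) Xi0 chD Ia Ib ab.
  have pab : phi a <= phi b by rewrite !phiE ler_pM2r // lerD2r.
  have e2 := integralmxMl (@I01_open R) (@I01_interval R) D ch Ia Ib pab.
  have e3 : powmx X (C + Q - 1) = X%:C *: D.
    have -> : C + Q - 1 = ((C - 1) + (Q - 1)) + 1.
      by rewrite addrACA -!addrA addNr addr0.
    rewrite (powmxD1 _ X0) powmxD //.
    apply: commrB (commr1 _); apply: commr_sym; apply: commrB (commr1 _); exact: QC.
  have e4 : integralmx a b f = integralmx a b (fun u => D * intf k Q C T (phi u)).
    apply: eq_integralmx => u /andP[au ub].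
    have tu : t < u by exact: lt_le_trans au.
    have ux : u < x by exact: le_lt_trans bx.
    have /I01P/andP[v0 v1] := I u tu ux.
    have w0 : 0 < 1 - phi u by rewrite subr_gt0.
    have uE : u - t = X * phi u by rewrite phiE; field.
    have xE : x - u = X * (1 - phi u) by rewrite phiE /X; field.
    rewrite /f uE xE (powmxMl _ X0 w0) (powmxMl _ X0 v0) /incE termE /intf /D /betaf.
    rewrite expr0 scale1r -/(psum k T (phi u)).
    have cm : powmx (1 - phi u) (C - 1) * powmx X (Q - 1) =
              powmx X (Q - 1) * powmx (1 - phi u) (C - 1).
      apply: powmx_comm2; apply: commrB (commr1 _).
      by apply: commr_sym; apply: commrB (commr1 _); exact: QC.
    move: (psum _ _ _) (powmx X (C - 1)) (powmx (1 - phi u) _) (powmx X _) (powmx (phi u) _) cm.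
    by move=> p a1 a2 a3 a4 cm; rewrite !mulrA -[a1 * a2 * a3]mulrA cm !mulrA.
  apply: (etrans e4).
  exact: (scale_cancel Xne e1 e2 e3).
have lim1 : integralmx ab.1 ab.2 f @[ab --> filter_prod t^'+ x^'-] -->
    powmx X (C + Q - 1) * (beta Q C 0 * L).
  have dphi v : {for v, continuous phi}.
    exact: is_derive_continuous (is_derive_affine _ _ v).
  have phi_lt u v : u < v -> phi u < phi v by move=> uv; rewrite ltrD2r ltr_pM2l ?invr_gt0.
  have p1 : phi @ t^'+ --> (0 : R)^'+.
    have := cvg_at_right_right (dphi t) (phi_lt t).
    by rewrite (phiE t) subrr mul0r.
  have p2 : phi @ x^'- --> (1 : R)^'-.
    have := cvg_at_left_left (dphi x) (fun u => @phi_lt u x).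
    by rewrite (phiE x) divff.
  have p3 : (fun ab : R * R => (phi ab.1, phi ab.2)) @ filter_prod t^'+ x^'- -->
      filter_prod (0 : R)^'+ (1 : R)^'-.
    move=> S [[U V] /= [hU hV] UV]; exists (phi @^-1` U, phi @^-1` V).
      by split; [exact: p1|exact: p2].
    by move=> [a b] /= [ha hb]; exact: UV.
  have F2 : Filter (filter_prod t^'+ x^'-) by exact: filter_prod_filter.
  have h : (fun ab : R * R => powmx X (C + Q - 1) *
        integralmx (phi ab.1) (phi ab.2) (intf k Q C T)) @ filter_prod t^'+ x^'- -->
      powmx X (C + Q - 1) * (beta Q C 0 * L).
    by apply: cvg_mxMl; exact: (cvg_comp _ _ p3 lim0).
  apply: cvg_trans h; apply: (@near_eq_cvg _ _ (filter_prod t^'+ x^'-) F2).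
  (* Separating the endpoints by the midpoint guarantees [a <= b]. *)
  pose c := (t + x) / 2.
  exists ([set a | t < a <= c], [set b | c <= b < x]) => /=.
    split; near=> a; apply/andP; split.
    - by near: a; exact: nbhs_right_gt.
    - by near: a; apply: nbhs_right_le; rewrite /c; lra.
    - by near: a; apply: nbhs_left_ge; rewrite /c; lra.
    - by near: a; exact: nbhs_left_lt.
  move=> [a b] /= [/andP[ta ac] /andP[cb bx]].
  by rewrite -int_f //; exact: le_trans cb.
split; first by apply/cvg_ex; eexists; exact: lim1.
have -> : improper t^'+ x^'- f = powmx X (C + Q - 1) * (beta Q C 0 * L).
  by apply: mx_cvg_lim; exact: lim1.
have hG := beta_normalize QC dQ dC.
set G := rgammamx Q * rgammamx C * gammamx (Q + C) in hG *.
have cQ : GRing.comm (powmx X (C + Q - 1)) Q.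
  apply: powmx_comm; apply: commr_sym; apply: commrB (commr1 Q).
  exact: commrD QC (commr_refl Q).
have cC : GRing.comm (powmx X (C + Q - 1)) C.
  apply: powmx_comm; apply: commr_sym; apply: commrB (commr1 C).
  exact: commrD (commr_refl C) (commr_sym QC).
(* The power of [X] stands between the normalising factor and the beta integral and must be moved
   past the former. *)
have cG : GRing.comm (powmx X (C + Q - 1)) G.
  apply: commrM; first apply: commrM.
  - exact: commr_sym (rgammamx_comm cQ).
  - exact: commr_sym (rgammamx_comm cC).
  - apply: comm_inv (rgamma_gamma dQC) (gamma_rgamma dQC).
    exact: commr_sym (rgammamx_comm (commrD cQ cC)).
rewrite -/X -/L.
move: (powmx X _) G (beta _ _ _) (L) hG cG => a g b l gb ag.
by rewrite mulrA -ag -mulrA [g * (b * l)]mulrA gb mul1r.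
Unshelve. all: by end_near. Qed.
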